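(* Let $k$ be an algebraically closed field and let $H$ be a cosemisimple Hopf algebra over $k$ whose fusion semiring $R_+(H)$ is free on some datum $(R,*,\circ)$. Let $P\le H$ be the cocenter of $H$. Then $P$ is simple, i.e. the only normal quantum subgroups of $P$ are (up to isomorphism) $\mathrm{id}:P\to P$ and $\varepsilon:P\to k$.
   Context: Conventions: $k$ is an algebraically closed field (any characteristic). Comodules are right and finite-dimensional. All Hopf algebras (including quotients) are cosemisimple over $k$, i.e. their comodule categories are semisimple. $\widehat H$ is the set of isomorphism classes of simple $H$-comodules. The fusion semiring $R_+(H)$ is the Grothendieck semiring of the category of $H$-comodules (addition: direct sum; multiplication: tensor product); additively it is the free commutative monoid on $\widehat H$. It carries the involution $x\mapsto x^*$ given by duals. Free fusion semirings: Let $R$ be a set with an involution $*:R\to R$ and a map $\circ:R\times R\to R\cup\{\emptyset\}$. Let $\langle R\rangle$ be the free monoid (words) on $R$. Extend $*$ to $\langle R\rangle$ by $(r_1\ldots r_k)^*=r_k^*\ldots r_1^*$, and extend $\circ$ by $(r_1\ldots r_k)\circ(s_1\ldots s_l)=r_1\ldots r_{k-1}(r_k\circ s_1)s_2\ldots s_l$, which is $\emptyset$ if $r_k\circ s_1=\emptyset$ (and also if one of the two words is empty). $R_+(H)$ is free on $(R,*,\circ)$ if there is a bijection $\langle R\rangle\to\widehat H$, $x\mapsto a_x$, sending the empty word to the trivial comodule, with $a_{x^*}=(a_x)^*$, and such that for all $x,y\in\langle R\rangle$ $$a_xa_y=\sum_{x=vg,\ y=g^*w}(a_{vw}+a_{v\circ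 w}),$$ the sum being over all $v,g,w\in\langle R\rangle$ with $x=vg$, $y=g^*w$, where the term $a_{v\circ w}$ is omitted when $v\circ w=\emptyset$. Normality and simplicity: a Hopf algebra map $\pi:H\to K$ is normal if $\{h\in H: \pi(h_1)\otimes h_2=1_K\otimes h\}$ equals $\{h\in H: h_1\otimes\pi(h_2)=h\otimes 1_K\}$ (Sweedler notation); this common set is then a Hopf subalgebra of $H$, called the Hopf kernel of $\pi$. A normal quantum subgroup of $H$ is a normal surjective Hopf algebra map $\pi:H\to K$ with $K$ cosemisimple, considered up to isomorphism of arrows with source $H$. $H$ is simple if its only normal quantum subgroups are $\mathrm{id}:H\to H$ and $\varepsilon:H\to k$. Center and cocenter: a Hopf algebra map $\pi:H\to K$ is central if $\pi(h_1)\otimes h_2=\pi(h_2)\otimes h_1$ in $K\otimes H$ for all $h\in H$. The category of central arrows of $H$ has as objects the central maps $H\to k[\Gamma]$ with $\Gamma$ a group, and as morphisms the commutative triangles under $H$. It has an initial object, called the center of $H$; this is a normal surjection, and the cocenter $P\le H$ is its Hopf kernel. *)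

(* Defs.v *)
From HB Require Import structures.
From mathcomp Require Import all_boot all_algebra.
From mathcomp Require Import finmap boolp.
From mathcomp.multinomials Require Import monalg.

Set Implicit Arguments.
Unset Strict Implicit.
Unset Printing Implicit Defensive.

Import GRing.Theory.
Local Open Scope quotient_scope.
Local Open Scope ring_scope.

Section LinearFacts.
Variables (k : fieldType) (U V : lmodType k) (f : U -> V).
Hypothesis lf : linear f.

Lemma linfD : {morph f : x y / x + y}.
Proof. by move=> x y; have := lf 1 x y; rewrite !scale1r. Qed.

Lemma linf0 : f 0 = 0.
Proof. by apply: (addIr (f 0)); rewrite -linfD !add0r. Qed.

Lemma linfZ c x : f (c *: x) = c *: f x.
Proof. by have := lf c x 0; rewrite linf0 !addr0. Qed.

Lemma linf_sum I (r : seq I) (F : I -> U) :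
  f (\sum_(i <- r) F i) = \sum_(i <- r) f (F i).
Proof. exact: (big_morph f linfD linf0). Qed.

End LinearFacts.

Definition bilin (k : fieldType) (U V W : lmodType k) (b : U -> V -> W) : Prop :=
  (forall u, linear (b u)) /\ (forall v, linear (b^~ v)).

Section Tensor.
Variables (k : fieldType) (U V : lmodType k).

Definition tsum (W : lmodType k) (b : U -> V -> W) (s : seq (U * V)) : W :=
  \sum_(p <- s) b p.1 p.2.

(* Two formal sums of pairs are identified when every bilinear map, with any  *)
(* target, takes the same value on them: by the universal property of the     *)
(* tensor product this is equality of the sums of pure tensors.               *)
Definition teq (s t : seq (U * V)) : bool :=
  `[< forall (W : lmodType k) (b : U -> V -> W), bilin b -> tsum b s = tsum b t >].

Lemma teq_refl : reflexive teq.
Proof. by move=> s; apply/asboolP. Qed.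

Lemma teq_sym : symmetric teq.
Proof.
by move=> s t; apply/asboolP/asboolP => E W b hb; rewrite (E W b hb).
Qed.

Lemma teq_trans : transitive teq.
Proof.
move=> t s r /asboolP E1 /asboolP E2; apply/asboolP => W b hb.
by rewrite (E1 W b hb) (E2 W b hb).
Qed.

Canonical teq_equiv := EquivRel teq teq_refl teq_sym teq_trans.

Definition tensor : Type := {eq_quot teq}%qT.

HB.instance Definition _ := Choice.on tensor.
HB.instance Definition _ : EqQuotient _ teq tensor := EqQuotient.on tensor.

Definition tlift (W : lmodType k) (b : U -> V -> W) (x : tensor) : W :=
  tsum b (repr x).

Definition mktensor (s : seq (U * V)) : tensor := \pi_(tensor) s.

Lemma tlift_mk (W : lmodType k) (b : U -> V -> W) s : bilin b -> tlift b (mktensor s) = tsum b s.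
Proof.
move=> hb; rewrite /tlift; have : teq (repr (mktensor s)) s.
  by have /eqmodP := reprK (mktensor s).
by move=> /asboolP/(_ W b hb).
Qed.

Lemma tensor_ext (x y : tensor) :
  (forall (W : lmodType k) (b : U -> V -> W), bilin b -> tlift b x = tlift b y) -> x = y.
Proof.
move=> E; rewrite -[x]reprK -[y]reprK; apply/eqmodP; apply/asboolP => W b hb.
exact: E.
Qed.

Definition tens_zero : tensor := mktensor [::].
Definition tens_add (x y : tensor) : tensor := mktensor (repr x ++ repr y).
Definition tens_scale (c : k) (x : tensor) : tensor :=
  mktensor [seq (c *: p.1, p.2) | p <- repr x].
Definition tens_opp (x : tensor) : tensor := tens_scale (-1) x.

Section Lift0.
Variables (W : lmodType k) (b : U -> V -> W).
Hypothesis hb : bilin b.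

Lemma tlift_zero : tlift b tens_zero = 0.
Proof. by rewrite tlift_mk // /tsum big_nil. Qed.

Lemma tlift_add x y : tlift b (tens_add x y) = tlift b x + tlift b y.
Proof. by rewrite tlift_mk // /tsum big_cat. Qed.

Lemma tlift_scale c x : tlift b (tens_scale c x) = c *: tlift b x.
Proof.
rewrite tlift_mk // /tsum big_map scaler_sumr; apply: eq_bigr => p _ /=.
exact: (linfZ (hb.2 p.2)).
Qed.

Lemma tlift_opp x : tlift b (tens_opp x) = - tlift b x.
Proof. by rewrite tlift_scale scaleN1r. Qed.

End Lift0.

Let tE := (tlift_add, tlift_zero, tlift_opp, tlift_scale).

Lemma tens_addA : associative tens_add.
Proof. by move=> x y z; apply: tensor_ext => W b hb; rewrite !tE // addrA. Qed.
Lemma tens_addC : commutative tens_add.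
Proof. by move=> x y; apply: tensor_ext => W b hb; rewrite !tE // addrC. Qed.
Lemma tens_add0 : left_id tens_zero tens_add.
Proof. by move=> x; apply: tensor_ext => W b hb; rewrite !tE // add0r. Qed.
Lemma tens_addN : left_inverse tens_zero tens_opp tens_add.
Proof. by move=> x; apply: tensor_ext => W b hb; rewrite !tE // addNr. Qed.

HB.instance Definition _ :=
  GRing.isZmodule.Build tensor tens_addA tens_addC tens_add0 tens_addN.

Lemma tens_scaleA c d x : tens_scale c (tens_scale d x) = tens_scale (c * d) x.
Proof. by apply: tensor_ext => W b hb; rewrite !tE // scalerA. Qed.
Lemma tens_scale1 : left_id 1 tens_scale.
Proof. by move=> x; apply: tensor_ext => W b hb; rewrite !tE // scale1r. Qed.
Lemma tens_scaleDr : right_distributive tens_scale +%R.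
Proof. by move=> c x y; apply: tensor_ext => W b hb; rewrite !tE // scalerDr. Qed.
Lemma tens_scaleDl x : {morph tens_scale^~ x : c d / c + d}.
Proof. by move=> c d; apply: tensor_ext => W b hb; rewrite !tE // scalerDl. Qed.

HB.instance Definition _ := GRing.Zmodule_isLmodule.Build k tensor
  tens_scaleA tens_scale1 tens_scaleDr tens_scaleDl.

Definition pure (u : U) (v : V) : tensor := mktensor [:: (u, v)].

Lemma tlift_linear (W : lmodType k) (b : U -> V -> W) : bilin b -> linear (tlift b).
Proof. by move=> hb c x y; rewrite tlift_add // tlift_scale. Qed.

Lemma tlift_pure (W : lmodType k) (b : U -> V -> W) u v : bilin b -> tlift b (pure u v) = b u v.
Proof. by move=> hb; rewrite tlift_mk // /tsum big_seq1. Qed.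

Lemma pure_bilin : bilin pure.
Proof.
split=> [u|v] c x y; apply: tensor_ext => W b hb;
  rewrite (tlift_linear hb) !tlift_pure //.
- exact: hb.1.
- exact: hb.2.
Qed.

Lemma tensorE (x : tensor) : x = \sum_(p <- repr x) pure p.1 p.2.
Proof.
apply: tensor_ext => W b hb; rewrite (linf_sum (tlift_linear hb)).
by rewrite /tlift; apply: eq_bigr => p _; rewrite -/(tlift _ _) tlift_pure.
Qed.

Lemma tensor_linext (W : lmodType k) (f g : tensor -> W) :
  linear f -> linear g -> (forall u v, f (pure u v) = g (pure u v)) -> f =1 g.
Proof.
move=> lf lg E x; rewrite [x]tensorE (linf_sum lf) (linf_sum lg).
by apply: eq_bigr => p _.
Qed.

End Tensor.

Arguments tensor {k} U%_type V%_type.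
Notation "U ⊗ V" := (tensor U V) (at level 40, left associativity) : type_scope.
Notation "u ⊗ v" := (pure u v) (at level 40, left associativity) : ring_scope.

Section LinearClosure.
Variable k : fieldType.
Implicit Types U V W : lmodType k.

Lemma lin_id U : linear (@idfun U).
Proof. by []. Qed.

Lemma lin_comp U V W (f : V -> W) (g : U -> V) :
  linear f -> linear g -> linear (fun x => f (g x)).
Proof. by move=> lf lg c x y; rewrite lg lf. Qed.

Lemma lin_add U V (f g : U -> V) :
  linear f -> linear g -> linear (fun x => f x + g x).
Proof. by move=> lf lg c x y; rewrite lf lg scalerDr addrACA. Qed.

Lemma lin_sumf U V I (r : seq I) (F : I -> U -> V) :
  (forall i, linear (F i)) -> linear (fun x => \sum_(i <- r) F i x).
Proof.
move=> lF c x y; rewrite scaler_sumr -big_split /=.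
by apply: eq_bigr => i _; rewrite lF.
Qed.

Lemma lin_pure2 U V (u : U) : linear (@pure k U V u).
Proof. exact: (@pure_bilin k U V).1. Qed.

Lemma lin_pure1 U V (v : V) : linear ((@pure k U V)^~ v).
Proof. exact: (@pure_bilin k U V).2. Qed.

Lemma tlift_lin U V W W' (F : W' -> U -> V -> W) (x : U ⊗ V) :
  (forall u v, linear (fun w => F w u v)) -> linear (fun w => tlift (F w) x).
Proof. by move=> lF; apply: lin_sumf => p. Qed.

End LinearClosure.

#[local] Hint Extern 0 (linear idfun) => exact: lin_id : core.

Section TensorMaps.
Variable k : fieldType.

Definition tmap (U V U' V' : lmodType k) (f : U -> U') (g : V -> V') :
    U ⊗ V -> U' ⊗ V' :=
  tlift (fun u v => f u ⊗ g v).

Definition tswap (U V : lmodType k) : U ⊗ V -> V ⊗ U :=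
  tlift (fun u v => v ⊗ u).

Definition tassoc (U V W : lmodType k) : (U ⊗ V) ⊗ W -> U ⊗ (V ⊗ W) :=
  tlift (fun t w => tlift (fun u v => u ⊗ (v ⊗ w)) t).

Section Map.
Variables (U V U' V' : lmodType k) (f : U -> U') (g : V -> V').
Hypotheses (lf : linear f) (lg : linear g).

Lemma tmap_bilin : bilin (fun u v => f u ⊗ g v).
Proof.
by split=> [u|v]; [apply: lin_comp (lin_pure2 _) lg
                  | apply: (lin_comp (lin_pure1 _) lf)].
Qed.

Lemma tmap_linear : linear (tmap f g).
Proof. exact: tlift_linear tmap_bilin. Qed.

Lemma tmap_pure u v : tmap f g (u ⊗ v) = f u ⊗ g v.
Proof. exact: tlift_pure tmap_bilin. Qed.

End Map.

Section Swap.
Variables U V : lmodType k.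

Lemma tswap_bilin : bilin (fun (u : U) (v : V) => v ⊗ u).
Proof. by split=> [u|v]; [apply: lin_pure1 | apply: lin_pure2]. Qed.

Lemma tswap_linear : linear (@tswap U V).
Proof. exact: tlift_linear tswap_bilin. Qed.

Lemma tswap_pure (u : U) (v : V) : tswap (u ⊗ v) = v ⊗ u.
Proof. exact: tlift_pure tswap_bilin. Qed.

End Swap.

Section Assoc.
Variables U V W : lmodType k.

Lemma tassoc_bilin1 (w : W) : bilin (fun (u : U) (v : V) => u ⊗ (v ⊗ w)).
Proof.
split=> [u|v]; last exact: lin_pure1.
exact: (lin_comp (lin_pure2 _) (lin_pure1 _)).
Qed.

Lemma tassoc_bilin :
  bilin (fun (t : U ⊗ V) (w : W) => tlift (fun u v => u ⊗ (v ⊗ w)) t).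
Proof.
split=> [t|w]; last exact: tlift_linear (tassoc_bilin1 w).
apply: tlift_lin => u v; exact: (lin_comp (lin_pure2 _) (lin_pure2 _)).
Qed.

Lemma tassoc_linear : linear (@tassoc U V W).
Proof. exact: tlift_linear tassoc_bilin. Qed.

Lemma tassoc_pure (u : U) (v : V) (w : W) : tassoc (u ⊗ v ⊗ w) = u ⊗ (v ⊗ w).
Proof.
rewrite /tassoc (tlift_pure _ _ tassoc_bilin).
exact: tlift_pure (tassoc_bilin1 w).
Qed.

End Assoc.
End TensorMaps.

Section TensorVect.
Variables (k : fieldType) (U V : vectType k).

Import VectorInternalTheory.

Let m := dim U.
Let n := dim V.

Definition tens_coords : U ⊗ V -> 'M[k]_(m, n) :=
  tlift (fun (u : U) (v : V) => (v2r u)^T *m v2r v).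

Definition tens_of_coords (M : 'M[k]_(m, n)) : U ⊗ V :=
  \sum_i \sum_j M i j *: (@r2v k U (delta_mx 0 i) ⊗ @r2v k V (delta_mx 0 j)).

Lemma tens_coords_bilin : bilin (fun (u : U) (v : V) => (v2r u)^T *m v2r v).
Proof.
split=> [u|v] c x y; first by rewrite linearP linearP.
by rewrite !linearP /= mulmxDl -scalemxAl.
Qed.

Lemma tens_coords_linear : linear tens_coords.
Proof. exact: tlift_linear tens_coords_bilin. Qed.

Lemma tens_of_coords_linear : linear tens_of_coords.
Proof.
apply: lin_sumf => i; apply: lin_sumf => j c x y.
by rewrite !mxE scalerDl scalerA.
Qed.

Lemma tens_coordsK : cancel tens_coords tens_of_coords.
Proof.
move=> x; move: x; apply: tensor_linext => //.
  exact: (lin_comp tens_of_coords_linear tens_coords_linear).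
move=> u v; rewrite /tens_coords (tlift_pure _ _ tens_coords_bilin).
have r2v_sum d (r : 'rV[k]_d) : r = \sum_i r 0 i *: delta_mx 0 i.
  exact: row_sum_delta.
rewrite -[in RHS](v2rK u) -[in RHS](v2rK v).
rewrite [in RHS](r2v_sum _ (v2r u)) [in RHS](r2v_sum _ (v2r v)) !linear_sum /=.
rewrite /tens_of_coords (linf_sum (lin_pure1 _)); apply: eq_bigr => i _.
rewrite (linf_sum (lin_pure2 _)); apply: eq_bigr => j _.
rewrite !linearZ /= (linfZ (lin_pure1 _)) (linfZ (lin_pure2 _)) scalerA.
by rewrite !mxE big_ord1 !mxE.
Qed.

Lemma tens_of_coordsK : cancel tens_of_coords tens_coords.
Proof.
move=> M; rewrite [RHS]matrix_sum_delta /tens_of_coords.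
rewrite (linf_sum tens_coords_linear); apply: eq_bigr => i _.
rewrite (linf_sum tens_coords_linear); apply: eq_bigr => j _.
rewrite (linfZ tens_coords_linear) /tens_coords (tlift_pure _ _ tens_coords_bilin).
by rewrite !r2vK trmx_delta mul_delta_mx.
Qed.

Lemma tensor_vect_axiom : Vector.axiom (m * n) (U ⊗ V).
Proof.
exists (fun x => mxvec (tens_coords x)).
  by move=> c x y; rewrite tens_coords_linear linearP.
exists (fun r => tens_of_coords (vec_mx r)) => x.
  by rewrite mxvecK tens_coordsK.
by rewrite tens_of_coordsK vec_mxK.
Qed.

HB.instance Definition _ := Lmodule_hasFinDim.Build k (tensor U V) tensor_vect_axiom.

End TensorVect.

Section TensorAlg.
Variables (k : fieldType) (A B : algType k).
Implicit Types (a : A) (b : B) (s t : A ⊗ B).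

Definition tens_mul s t : A ⊗ B :=
  tlift (fun a b => tlift (fun a' b' => (a * a') ⊗ (b * b')) t) s.

Lemma lin_mull (C : algType k) (x : C) : linear ( *%R x).
Proof. by move=> c y z; rewrite mulrDr scalerAr. Qed.

Lemma lin_mulr (C : algType k) (x : C) : linear ( *%R^~ x).
Proof. by move=> c y z; rewrite mulrDl scalerAl. Qed.

Lemma tens_mul_bilin1 a b : bilin (fun a' b' => (a * a') ⊗ (b * b')).
Proof.
split=> [a'|b']; first exact: (lin_comp (lin_pure2 _) (@lin_mull _ _)).
exact: (lin_comp (lin_pure1 _) (@lin_mull _ _)).
Qed.

Lemma tens_mul_bilin2 t :
  bilin (fun a b => tlift (fun a' b' => (a * a') ⊗ (b * b')) t).
Proof.
split=> [a|b]; apply: tlift_lin => a' b'.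
  exact: (lin_comp (lin_pure2 _) (@lin_mulr _ _)).
exact: (lin_comp (lin_pure1 _) (@lin_mulr _ _)).
Qed.

Lemma tens_mull_linear t : linear (tens_mul^~ t).
Proof. exact: tlift_linear (tens_mul_bilin2 t). Qed.

Lemma tens_mulr_linear s : linear (tens_mul s).
Proof. by apply: lin_sumf => p; apply: tlift_linear (tens_mul_bilin1 _ _). Qed.

Lemma tens_mul_pure a b a' b' :
  tens_mul (a ⊗ b) (a' ⊗ b') = (a * a') ⊗ (b * b').
Proof.
rewrite /tens_mul (tlift_pure _ _ (tens_mul_bilin2 _)).
exact: tlift_pure (tens_mul_bilin1 a b).
Qed.

Lemma tens_mulA : associative tens_mul.
Proof.
move=> x y z; move: x; apply: tensor_linext.
- exact: tens_mull_linear.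
- exact: (lin_comp (tens_mull_linear _) (tens_mull_linear _)).
move=> a1 b1; move: y; apply: tensor_linext.
- exact: (lin_comp (tens_mulr_linear _) (tens_mull_linear _)).
- exact: (lin_comp (tens_mull_linear _) (tens_mulr_linear _)).
move=> a2 b2; move: z; apply: tensor_linext.
- exact: (lin_comp (tens_mulr_linear _) (tens_mulr_linear _)).
- exact: tens_mulr_linear.
by move=> a3 b3; rewrite !tens_mul_pure !mulrA.
Qed.

Lemma tens_mul1 : left_id (1 ⊗ 1) tens_mul.
Proof.
move=> x; move: x; apply: tensor_linext => //; first exact: tens_mulr_linear.
by move=> a b; rewrite tens_mul_pure !mul1r.
Qed.

Lemma tens_mulr1 : right_id (1 ⊗ 1) tens_mul.
Proof.
move=> x; move: x; apply: tensor_linext => //; first exact: tens_mull_linear.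
by move=> a b; rewrite tens_mul_pure !mulr1.
Qed.

Lemma tens_mulDl : left_distributive tens_mul +%R.
Proof. by move=> x y z; rewrite (linfD (tens_mull_linear z)). Qed.

Lemma tens_mulDr : right_distributive tens_mul +%R.
Proof. by move=> x y z; rewrite (linfD (tens_mulr_linear x)). Qed.

HB.instance Definition _ := GRing.Zmodule_isPzRing.Build (tensor A B)
  tens_mulA tens_mul1 tens_mulr1 tens_mulDl tens_mulDr.

End TensorAlg.

HB.mixin Record isHopfAlg (k : fieldType) H of GRing.Algebra k H := {
  comul : H -> H ⊗ H;
  counit : H -> k;
  antipode : H -> H;
  comul_linear : linear comul;
  comul_monoid : monoid_morphism comul;
  counit_linear : scalar counit;
  counit_monoid : monoid_morphism counit;
  antipode_linear : linear antipode;
  comulA : forall x, tassoc (tmap comul idfun (comul x)) = tmap idfun comul (comul x);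
  counitl : forall x, tlift (fun y z : H => counit y *: z) (comul x) = x;
  counitr : forall x, tlift (fun y z : H => counit z *: y) (comul x) = x;
  antipodel : forall x, tlift (fun y z : H => antipode y * z) (comul x) = (counit x)%:A;
  antipoder : forall x, tlift (fun y z : H => y * antipode z) (comul x) = (counit x)%:A
}.

#[short(type="hopfAlgType")]
HB.structure Definition HopfAlg (k : fieldType) :=
  {H of GRing.Algebra k H & isHopfAlg k H}.

Section HopfTheory.
Variables (k : fieldType) (H : hopfAlgType k).

HB.instance Definition _ :=
  GRing.isLinear.Build k H (tensor H H) *:%R (@comul k H) comul_linear.
HB.instance Definition _ :=
  GRing.isMonoidMorphism.Build H (tensor H H) (@comul k H) comul_monoid.
HB.instance Definition _ :=
  GRing.isLinear.Build k H k *%R (@counit k H) counit_linear.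
HB.instance Definition _ :=
  GRing.isMonoidMorphism.Build H k (@counit k H) counit_monoid.
HB.instance Definition _ :=
  GRing.isLinear.Build k H H *:%R (@antipode k H) antipode_linear.

End HopfTheory.

(* A bialgebra map between Hopf algebras preserves the antipode. *)
Definition hopf_map (k : fieldType) (H K : hopfAlgType k) (f : H -> K) : Prop :=
  [/\ linear f, monoid_morphism f,
      forall x, comul (f x) = tmap f f (comul x) &
      forall x, counit (f x) = counit x].

Definition arrow_iso (k : fieldType) (H K K' : hopfAlgType k)
    (p : H -> K) (p' : H -> K') : Prop :=
  exists f : K -> K', [/\ hopf_map f, bijective f & f \o p =1 p'].

Section TrivialHopf.
Variable k : fieldType.

Definition triv_comul (x : k^o) : k^o ⊗ k^o := (x : k) *: ((1 : k^o) ⊗ (1 : k^o)).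

Lemma triv_comul_linear : linear triv_comul.
Proof. by move=> c x y; rewrite /triv_comul scalerDl scalerA. Qed.

Lemma triv_comul_monoid : monoid_morphism triv_comul.
Proof.
split=> [|x y]; rewrite /triv_comul; first by rewrite scale1r.
rewrite [RHS]/(_ * _) /= (linfZ (tens_mull_linear _)) (linfZ (tens_mulr_linear _)).
by rewrite tens_mul_pure !mul1r scalerA.
Qed.

Lemma triv_counit_linear : scalar (fun x : k^o => x : k).
Proof. by []. Qed.

Lemma triv_counit_monoid : monoid_morphism (fun x : k^o => x : k).
Proof. by []. Qed.

Lemma triv_comulA x :
  tassoc (tmap triv_comul idfun (triv_comul x)) = tmap idfun triv_comul (triv_comul x).
Proof.
have lc := triv_comul_linear.
rewrite (linfZ (tmap_linear lc (@lin_id _ _))) (linfZ (@tassoc_linear _ _ _ _)).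
rewrite (linfZ (tmap_linear (@lin_id _ _) lc)) !tmap_pure //.
by rewrite /triv_comul !scale1r tassoc_pure.
Qed.

Lemma triv_scale_bilin1 : bilin (fun y z : k^o => (y : k) *: z).
Proof. by split=> [u|v]; [apply: (@lin_mull _ k^o) | apply: (@lin_mulr _ k^o)]. Qed.

Lemma triv_scale_bilin2 : bilin (fun y z : k^o => (z : k) *: y).
Proof. by split=> [u|v]; [apply: (@lin_mulr _ k^o) | apply: (@lin_mull _ k^o)]. Qed.

Lemma triv_counitl x : tlift (fun y z : k^o => (y : k) *: z) (triv_comul x) = x.
Proof.
rewrite (linfZ (tlift_linear triv_scale_bilin1)) (tlift_pure _ _ triv_scale_bilin1).
by rewrite scale1r; apply: mulr1.
Qed.

Lemma triv_counitr x : tlift (fun y z : k^o => (z : k) *: y) (triv_comul x) = x.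
Proof.
rewrite (linfZ (tlift_linear triv_scale_bilin2)) (tlift_pure _ _ triv_scale_bilin2).
by rewrite scale1r; apply: mulr1.
Qed.

Lemma triv_antipode x :
  tlift (fun y z : k^o => (y * z : k^o)) (triv_comul x) = (x : k)%:A.
Proof.
rewrite (linfZ (tlift_linear triv_scale_bilin1)) (tlift_pure _ _ triv_scale_bilin1).
by rewrite scale1r.
Qed.

HB.instance Definition _ := isHopfAlg.Build k k^o
  triv_comul_linear triv_comul_monoid triv_counit_linear triv_counit_monoid
  (@lin_id k k^o) triv_comulA triv_counitl triv_counitr
  triv_antipode triv_antipode.

End TrivialHopf.

Definition galg (k : fieldType) (G : groupType) : Type := {malg k[G]}.

Section GroupAlgebra.
Variables (k : fieldType) (G : groupType).
Local Notation kG := (galg k G).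

HB.instance Definition _ := GRing.Lmodule.copy kG {malg k[G]}.

Definition gelt (g : G) : kG := << g >>.

Definition glift (W : lmodType k) (f : G -> W) (x : kG) : W :=
  \sum_(g <- msupp x) x@_g *: f g.

Lemma glift_sup (W : lmodType k) (f : G -> W) (d : {fset G}) (x : kG) :
  (msupp x `<=` d)%fset -> glift f x = \sum_(g <- d) x@_g *: f g.
Proof.
move=> le; rewrite /glift; apply: (big_fset_incl _ le) => g _ /mcoeff_outdom ->.
by rewrite scale0r.
Qed.

Lemma glift_linear (W : lmodType k) (f : G -> W) : linear (glift f).
Proof.
move=> c x y; pose d := (msupp x `|` msupp y `|` msupp (c *: x + y : kG))%fset.
have [dx dy dz] : [/\ msupp x `<=` d, msupp y `<=` d & msupp (c *: x + y) `<=` d]%fset.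
  split; last exact: fsubsetUr.
  - by rewrite /d -fsetUA fsubsetUl.
  - by rewrite /d [(msupp x `|` _)%fset]fsetUC -fsetUA fsubsetUl.
rewrite (glift_sup f dx) (glift_sup f dy) (glift_sup f dz).
rewrite scaler_sumr -big_split /=; apply: eq_bigr => g _.
by rewrite mcoeffD mcoeffZ scalerDl scalerA.
Qed.

Lemma glift_gelt (W : lmodType k) (f : G -> W) g : glift f (gelt g) = f g.
Proof.
by rewrite (@glift_sup _ _ [fset g]%fset) ?msuppU_le // big_seq_fset1 mcoeffUU scale1r.
Qed.

Lemma galgE (x : kG) : x = \sum_(g <- msupp x) x@_g *: gelt g.
Proof.
rewrite [LHS]monalgE; apply: eq_bigr => g _.
by apply/malgP => h; rewrite [RHS]mcoeffZ !mcoeffU mulrnAr mulr1.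
Qed.

Lemma galg_linext (W : lmodType k) (f h : kG -> W) :
  linear f -> linear h -> (forall g, f (gelt g) = h (gelt g)) -> f =1 h.
Proof.
move=> lf lh E x; rewrite [x]galgE (linf_sum lf) (linf_sum lh).
by apply: eq_bigr => g _; rewrite (linfZ lf) (linfZ lh) E.
Qed.

Definition gmul (x y : kG) : kG :=
  glift (fun g => glift (fun h => gelt (g * h)%g) y) x.

Lemma gmull_linear y : linear (gmul^~ y).
Proof. exact: glift_linear. Qed.

Lemma gmulr_linear x : linear (gmul x).
Proof.
apply: lin_sumf => g c y z.
by rewrite glift_linear scalerDr !scalerA mulrC.
Qed.

Lemma gmul_gelt g h : gmul (gelt g) (gelt h) = gelt (g * h)%g.
Proof. by rewrite /gmul !glift_gelt. Qed.

Lemma gmulA : associative gmul.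
Proof.
move=> x y z; move: x; apply: galg_linext.
- exact: gmull_linear.
- exact: (lin_comp (gmull_linear _) (gmull_linear _)).
move=> a; move: y; apply: galg_linext.
- exact: (lin_comp (gmulr_linear _) (gmull_linear _)).
- exact: (lin_comp (gmull_linear _) (gmulr_linear _)).
move=> b; move: z; apply: galg_linext.
- exact: (lin_comp (gmulr_linear _) (gmulr_linear _)).
- exact: gmulr_linear.
by move=> c; rewrite !gmul_gelt mulgA.
Qed.

Lemma gmul1 : left_id (gelt 1%g) gmul.
Proof.
move=> x; move: x; apply: galg_linext => //; first exact: gmulr_linear.
by move=> g; rewrite gmul_gelt mul1g.
Qed.

Lemma gmulr1 : right_id (gelt 1%g) gmul.
Proof.
move=> x; move: x; apply: galg_linext => //; first exact: gmull_linear.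
by move=> g; rewrite gmul_gelt mulg1.
Qed.

Lemma gmulDl : left_distributive gmul +%R.
Proof. by move=> x y z; rewrite (linfD (gmull_linear z)). Qed.

Lemma gmulDr : right_distributive gmul +%R.
Proof. by move=> x y z; rewrite (linfD (gmulr_linear x)). Qed.

Lemma gone_neq0 : gelt 1%g != 0.
Proof. by rewrite /gelt monalgU_eq0 oner_eq0. Qed.

HB.instance Definition _ := GRing.Zmodule_isNzRing.Build kG
  gmulA gmul1 gmulr1 gmulDl gmulDr gone_neq0.

Lemma gscaleAl c (x y : kG) : c *: (x * y) = (c *: x) * y.
Proof. by rewrite [RHS](linfZ (gmull_linear y)). Qed.

Lemma gscaleAr c (x y : kG) : c *: (x * y) = x * (c *: y).
Proof. by rewrite [RHS](linfZ (gmulr_linear x)). Qed.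

HB.instance Definition _ := GRing.Lmodule_isLalgebra.Build k kG gscaleAl.
HB.instance Definition _ := GRing.Lalgebra_isAlgebra.Build k kG gscaleAr.

Definition gcomul : kG -> kG ⊗ kG := glift (fun g => gelt g ⊗ gelt g).
Definition gcounit : kG -> k^o := glift (fun _ : G => 1 : k^o).
Definition gantipode : kG -> kG := glift (fun g => gelt g^-1%g).

Lemma gcomul_linear : linear gcomul.
Proof. exact: glift_linear. Qed.

Lemma gcounit_linear : linear gcounit.
Proof. exact: glift_linear. Qed.

Lemma gantipode_linear : linear gantipode.
Proof. exact: glift_linear. Qed.

Lemma gcomul_gelt g : gcomul (gelt g) = gelt g ⊗ gelt g.
Proof. exact: glift_gelt. Qed.

Lemma gcounit_gelt g : gcounit (gelt g) = 1.
Proof. exact: glift_gelt. Qed.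

Lemma gantipode_gelt g : gantipode (gelt g) = gelt g^-1%g.
Proof. exact: glift_gelt. Qed.

Lemma gcomul_monoid : monoid_morphism gcomul.
Proof.
split=> [|x y]; first exact: gcomul_gelt.
move: x; apply: galg_linext.
- exact: (lin_comp gcomul_linear (gmull_linear _)).
- exact: (lin_comp (tens_mull_linear _) gcomul_linear).
move=> a; move: y; apply: galg_linext.
- exact: (lin_comp gcomul_linear (gmulr_linear _)).
- exact: (lin_comp (tens_mulr_linear _) gcomul_linear).
move=> b; rewrite [X in gcomul X]gmul_gelt !gcomul_gelt [RHS]tens_mul_pure.
by congr (_ ⊗ _); rewrite -gmul_gelt.
Qed.

Lemma gcounit_monoid : monoid_morphism (gcounit : kG -> k).
Proof.
split=> [|x y]; first exact: gcounit_gelt.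
move: x; apply: (@galg_linext k^o).
- exact: (lin_comp gcounit_linear (gmull_linear _)).
- exact: (lin_comp (@lin_mulr k k^o _) gcounit_linear).
move=> a; move: y; apply: (@galg_linext k^o).
- exact: (lin_comp gcounit_linear (gmulr_linear _)).
- exact: (lin_comp (@lin_mull k k^o _) gcounit_linear).
move=> b; rewrite [X in gcounit X]gmul_gelt !gcounit_gelt.
by rewrite mulr1.
Qed.

Lemma gcomulA x :
  tassoc (tmap gcomul idfun (gcomul x)) = tmap idfun gcomul (gcomul x).
Proof.
have lc := gcomul_linear; move: x; apply: galg_linext.
- apply: lin_comp (@tassoc_linear _ _ _ _) _.
  exact: (lin_comp (tmap_linear lc (@lin_id _ _)) lc).
- exact: (lin_comp (tmap_linear (@lin_id _ _) lc) lc).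
by move=> g; rewrite !(gcomul_gelt, tmap_pure, tassoc_pure).
Qed.

Lemma gcounit_bilin1 : bilin (fun y z : kG => (gcounit y : k) *: z).
Proof.
split=> [u|v] c x y.
  by rewrite scalerDr !scalerA mulrC.
by rewrite gcounit_linear scalerDl -scalerA.
Qed.

Lemma gcounit_bilin2 : bilin (fun y z : kG => (gcounit z : k) *: y).
Proof.
split=> [u|v] c x y.
  by rewrite gcounit_linear scalerDl -scalerA.
by rewrite scalerDr !scalerA mulrC.
Qed.

Lemma gcounitl x : tlift (fun y z : kG => (gcounit y : k) *: z) (gcomul x) = x.
Proof.
move: x; apply: galg_linext => //.
  exact: (lin_comp (tlift_linear gcounit_bilin1) gcomul_linear).
move=> g; rewrite gcomul_gelt (tlift_pure _ _ gcounit_bilin1).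
by rewrite gcounit_gelt scale1r.
Qed.

Lemma gcounitr x : tlift (fun y z : kG => (gcounit z : k) *: y) (gcomul x) = x.
Proof.
move: x; apply: galg_linext => //.
  exact: (lin_comp (tlift_linear gcounit_bilin2) gcomul_linear).
move=> g; rewrite gcomul_gelt (tlift_pure _ _ gcounit_bilin2).
by rewrite gcounit_gelt scale1r.
Qed.

Lemma gantipode_bilin1 : bilin (fun y z : kG => gantipode y * z).
Proof.
split=> [u|v]; first exact: gmulr_linear.
exact: (lin_comp (gmull_linear _) gantipode_linear).
Qed.

Lemma gantipode_bilin2 : bilin (fun y z : kG => y * gantipode z).
Proof.
split=> [u|v]; last exact: gmull_linear.
exact: (lin_comp (gmulr_linear _) gantipode_linear).
Qed.

Lemma gunit_linear : linear (fun x : kG => (gcounit x)%:A : kG).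
Proof. by move=> c x y; rewrite gcounit_linear scalerDl scalerA. Qed.

Lemma gantipodel x :
  tlift (fun y z : kG => gantipode y * z) (gcomul x) = (gcounit x)%:A.
Proof.
move: x; apply: galg_linext.
- exact: (lin_comp (tlift_linear gantipode_bilin1) gcomul_linear).
- exact: gunit_linear.
move=> g; rewrite gcomul_gelt (tlift_pure _ _ gantipode_bilin1).
by rewrite gcounit_gelt scale1r gantipode_gelt [LHS]gmul_gelt mulVg.
Qed.

Lemma gantipoder x :
  tlift (fun y z : kG => y * gantipode z) (gcomul x) = (gcounit x)%:A.
Proof.
move: x; apply: galg_linext.
- exact: (lin_comp (tlift_linear gantipode_bilin2) gcomul_linear).
- exact: gunit_linear.
move=> g; rewrite gcomul_gelt (tlift_pure _ _ gantipode_bilin2).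
by rewrite gcounit_gelt scale1r gantipode_gelt [LHS]gmul_gelt mulgV.
Qed.

HB.instance Definition _ := isHopfAlg.Build k kG
  gcomul_linear gcomul_monoid gcounit_linear gcounit_monoid gantipode_linear
  gcomulA gcounitl gcounitr gantipodel gantipoder.

End GroupAlgebra.

Record comod (k : fieldType) (H : hopfAlgType k) := Comod {
  comod_car :> vectType k;
  coact : comod_car -> comod_car ⊗ H;
  coact_linear : linear coact;
  coactA : forall v,
    tassoc (tmap coact idfun (coact v)) = tmap idfun (@comul k H) (coact v);
  coact_counit : forall v,
    tlift (fun (w : comod_car) (h : H) => counit h *: w) (coact v) = v
}.
Arguments coact {k H} c v : rename.

Section ComodDefs.
Variables (k : fieldType) (H : hopfAlgType k).
Implicit Types V W : comod H.

Definition comod_map V W (f : V -> W) : Prop :=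
  linear f /\ forall v, coact W (f v) = tmap f idfun (coact V v).

Definition comod_iso V W : Prop := exists f : V -> W, comod_map f /\ bijective f.

Definition subcomod V (U : {vspace V}) : Prop :=
  forall v, v \in U ->
    exists t : subvs_of U ⊗ H, coact V v = tmap (vsval : subvs_of U -> V) idfun t.

Definition simple_comod V : Prop :=
  (exists v : V, v != 0) /\
  forall U : {vspace V}, subcomod U -> U = 0%VS \/ U = fullv.

End ComodDefs.

Section ScaleBilin.
Variables (k : fieldType) (U V : lmodType k).

Lemma scale_bilin (f : V -> k^o) :
  linear f -> bilin (fun (u : U) (v : V) => (f v : k) *: u).
Proof.
move=> lf; split=> [u|v] c x y.
  by rewrite lf scalerDl -scalerA.
by rewrite scalerDr !scalerA mulrC.
Qed.

Lemma scale_bilin' (f : U -> k^o) :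
  linear f -> bilin (fun (u : U) (v : V) => (f u : k) *: v).
Proof.
move=> lf; split=> [u|v] c x y.
  by rewrite scalerDr !scalerA mulrC.
by rewrite lf scalerDl -scalerA.
Qed.

End ScaleBilin.

Section TensorNaturality.
Variable k : fieldType.

Lemma tassoc_nat (U U' V W : lmodType k) (f : U -> U') (t : (U ⊗ V) ⊗ W) :
  linear f ->
  tassoc (tmap (tmap f idfun) idfun t) = tmap f idfun (tassoc t).
Proof.
move=> lf; have lf1 := tmap_linear lf (@lin_id _ V).
have lf2 := tmap_linear lf1 (@lin_id _ W).
have lf3 := tmap_linear lf (@lin_id _ (V ⊗ W)%type).
move: t; apply: tensor_linext.
- exact: (lin_comp (@tassoc_linear _ _ _ _) lf2).
- exact: (lin_comp lf3 (@tassoc_linear _ _ _ _)).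
move=> s w; move: s; apply: tensor_linext.
- apply: lin_comp (@tassoc_linear _ _ _ _) _.
  exact: (lin_comp lf2 (@lin_pure1 _ _ _ _)).
- apply: lin_comp lf3 _.
  exact: (lin_comp (@tassoc_linear _ _ _ _) (@lin_pure1 _ _ _ _)).
by move=> u v; rewrite !(tmap_pure, tassoc_pure).
Qed.

Lemma tmap_comp (U U' U'' V V' V'' : lmodType k) (f : U' -> U'') (g : V' -> V'')
    (f' : U -> U') (g' : V -> V') t :
  linear f -> linear g -> linear f' -> linear g' ->
  tmap f g (tmap f' g' t) = tmap (fun x => f (f' x)) (fun x => g (g' x)) t.
Proof.
move=> lf lg lf' lg'; have lff := lin_comp lf lf'; have lgg := lin_comp lg lg'.
move: t; apply: tensor_linext.
- exact: (lin_comp (tmap_linear lf lg) (tmap_linear lf' lg')).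
- exact: tmap_linear.
by move=> u v; rewrite !tmap_pure.
Qed.

End TensorNaturality.

Section TrivialComod.
Variables (k : fieldType) (H : hopfAlgType k).

Definition triv_coact (x : k^o) : k^o ⊗ H := x ⊗ 1.

Lemma triv_coact_linear : linear triv_coact.
Proof. exact: lin_pure1. Qed.

Lemma counit_lin : linear (@counit k H : H -> k^o).
Proof. exact: counit_linear. Qed.

Lemma triv_coactA v :
  tassoc (tmap triv_coact idfun (triv_coact v)) =
  tmap idfun (@comul k H) (triv_coact v).
Proof.
have l1 := triv_coact_linear; have l2 := @comul_linear k H.
rewrite [X in tassoc (tmap _ _ X)]/triv_coact tmap_pure // tassoc_pure.
by rewrite [RHS]tmap_pure // (@comul_monoid k H).1.
Qed.

Lemma triv_coact_counit v :
  tlift (fun (w : k^o) (h : H) => counit h *: w) (triv_coact v) = v.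
Proof.
by rewrite (tlift_pure _ _ (scale_bilin _ counit_lin)) rmorph1 scale1r.
Qed.

Definition triv_comod : comod H :=
  Comod triv_coact_linear triv_coactA triv_coact_counit.

Definition zero_coact (x : 'rV[k]_0) : 'rV[k]_0 ⊗ H := 0.

Lemma zero_coact_linear : linear zero_coact.
Proof. by move=> c x y; rewrite /zero_coact scaler0 addr0. Qed.

Lemma zero_coactA v :
  tassoc (tmap zero_coact idfun (zero_coact v)) =
  tmap idfun (@comul k H) (zero_coact v).
Proof.
have l1 := zero_coact_linear; have l2 := @comul_linear k H.
rewrite (linf0 (tmap_linear l1 (@lin_id _ _))) (linf0 (@tassoc_linear _ _ _ _)).
by rewrite (linf0 (tmap_linear (@lin_id _ _) l2)).
Qed.

Lemma zero_coact_counit v :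
  tlift (fun (w : 'rV[k]_0) (h : H) => counit h *: w) (zero_coact v) = v.
Proof. by rewrite thinmx0; apply/rowP => -[]. Qed.

Definition zero_comod : comod H :=
  Comod zero_coact_linear zero_coactA zero_coact_counit.

End TrivialComod.
Arguments triv_comod {k} H.
Arguments zero_comod {k} H.

Section DirectSum.
Variables (k : fieldType) (H : hopfAlgType k) (V W : comod H).
Local Notation VW := (V * W)%type.

Definition dsum_inl (v : V) : VW := (v, 0).
Definition dsum_inr (w : W) : VW := (0, w).

Definition dsum_coact (x : VW) : VW ⊗ H :=
  tmap dsum_inl idfun (coact V x.1) + tmap dsum_inr idfun (coact W x.2).

Lemma dsum_inl_linear : linear dsum_inl.
Proof. by move=> c x y; congr (_, _); rewrite /= scaler0 addr0. Qed.

Lemma dsum_inr_linear : linear dsum_inr.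
Proof. by move=> c x y; congr (_, _); rewrite /= scaler0 addr0. Qed.

Let linl := tmap_linear dsum_inl_linear (@lin_id _ H).
Let linr := tmap_linear dsum_inr_linear (@lin_id _ H).

Lemma dsum_coact_linear : linear dsum_coact.
Proof.
apply: lin_add => c x y /=.
  by rewrite coact_linear linl.
by rewrite coact_linear linr.
Qed.

Lemma dsum_coact_inl v : dsum_coact (dsum_inl v) = tmap dsum_inl idfun (coact V v).
Proof.
by rewrite /dsum_coact /= (linf0 (@coact_linear _ _ W)) (linf0 linr) addr0.
Qed.

Lemma dsum_coact_inr w : dsum_coact (dsum_inr w) = tmap dsum_inr idfun (coact W w).
Proof.
by rewrite /dsum_coact /= (linf0 (@coact_linear _ _ V)) (linf0 linl) add0r.
Qed.

Lemma dsum_coactA x :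
  tassoc (tmap dsum_coact idfun (dsum_coact x)) =
  tmap idfun (@comul k H) (dsum_coact x).
Proof.
have lD := dsum_coact_linear; have lc := @comul_linear k H.
have E (Y : comod H) (f : Y -> VW) y : linear f ->
    (forall y, dsum_coact (f y) = tmap f idfun (coact Y y)) ->
    tassoc (tmap dsum_coact idfun (tmap f idfun (coact Y y))) =
    tmap idfun (@comul k H) (tmap f idfun (coact Y y)).
  move=> lf fE; rewrite tmap_comp //.
  have -> : (fun x => dsum_coact (f x)) = (fun x => tmap f idfun (coact Y x)).
    exact: funext.
  have lY := @coact_linear k H Y.
  rewrite -(tmap_comp _ (tmap_linear lf (@lin_id _ H)) (@lin_id _ H) lY) //.
  by rewrite tassoc_nat // coactA !tmap_comp.
rewrite [in LHS]/dsum_coact (linfD (tmap_linear lD (@lin_id _ H))).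
rewrite (linfD (@tassoc_linear _ _ _ _)) [in RHS]/dsum_coact.
rewrite (linfD (tmap_linear (@lin_id _ _) lc)).
congr (_ + _); apply: E.
- exact: dsum_inl_linear.
- exact: dsum_coact_inl.
- exact: dsum_inr_linear.
- exact: dsum_coact_inr.
Qed.

Lemma dsum_coact_counit x :
  tlift (fun (w : VW) (h : H) => counit h *: w) (dsum_coact x) = x.
Proof.
have hb (Z : lmodType k) : bilin (fun (z : Z) (h : H) => counit h *: z).
  exact: (scale_bilin Z (@counit_lin k H)).
have E (Y : comod H) (f : Y -> VW) y : linear f ->
    tlift (fun (w : VW) (h : H) => counit h *: w) (tmap f idfun (coact Y y)) = f y.
  move=> lf; rewrite -[in RHS](coact_counit y).
  move: (coact Y y); apply: tensor_linext.
  - exact: (lin_comp (tlift_linear (hb _)) (tmap_linear lf (@lin_id _ _))).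
  - exact: (lin_comp lf (tlift_linear (hb _))).
  move=> u h; rewrite tmap_pure // (tlift_pure _ _ (hb _)).
  by rewrite [in RHS](tlift_pure _ _ (hb Y)) (linfZ lf).
rewrite /dsum_coact (linfD (tlift_linear (hb _))) !E.
- by case: x => v w; congr (_, _); rewrite /= ?addr0 ?add0r.
- exact: dsum_inr_linear.
- exact: dsum_inl_linear.
Qed.

Definition dsum_comod : comod H :=
  Comod dsum_coact_linear dsum_coactA dsum_coact_counit.

End DirectSum.

Definition dsums (k : fieldType) (H : hopfAlgType k) (s : seq (comod H)) : comod H :=
  foldr (@dsum_comod k H) (zero_comod H) s.

Section TensorComod.
Variables (k : fieldType) (H : hopfAlgType k).

Definition tens_legs (V W A : lmodType k) (m : A -> A -> A)
    (s : V ⊗ A) (t : W ⊗ A) : (V ⊗ W) ⊗ A :=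
  tlift (fun v h => tlift (fun w h' => (v ⊗ w) ⊗ m h h') t) s.

Section Legs.
Variables (V W A : lmodType k) (m : A -> A -> A).
Hypothesis hm : bilin m.

Lemma tens_legs_bilin1 v h : bilin (fun (w : W) h' => ((v : V) ⊗ w) ⊗ m h h').
Proof.
split=> [w|h']; first exact: (lin_comp (lin_pure2 _) (hm.1 h)).
exact: (lin_comp (lin_pure1 _) (lin_pure2 _)).
Qed.

Lemma tens_legs_bilin2 (t : W ⊗ A) :
  bilin (fun (v : V) h => tlift (fun w h' => (v ⊗ w) ⊗ m h h') t).
Proof.
split=> [v|h]; apply: tlift_lin => w h'.
  exact: (lin_comp (lin_pure2 _) (hm.2 h')).
exact: (lin_comp (lin_pure1 _) (lin_pure1 _)).
Qed.

Lemma tens_legs_linear1 t : linear (fun s : V ⊗ A => @tens_legs V W A m s t).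
Proof. exact: tlift_linear (tens_legs_bilin2 t). Qed.

Lemma tens_legs_linear2 s : linear (@tens_legs V W A m s).
Proof. by apply: lin_sumf => p; apply: tlift_linear (tens_legs_bilin1 _ _). Qed.

Lemma tens_legs_pure (v : V) (w : W) h h' :
  tens_legs m (v ⊗ h) (w ⊗ h') = (v ⊗ w) ⊗ m h h'.
Proof.
rewrite /tens_legs (tlift_pure _ _ (tens_legs_bilin2 _)).
exact: tlift_pure (tens_legs_bilin1 v h).
Qed.

Lemma tens_legs_ext (Z : lmodType k) (f g : V ⊗ A -> W ⊗ A -> Z) :
  bilin f -> bilin g ->
  (forall v h w h', f (v ⊗ h) (w ⊗ h') = g (v ⊗ h) (w ⊗ h')) ->
  forall s t, f s t = g s t.
Proof.
move=> hf hg E s t; move: s; apply: tensor_linext; [exact: hf.2|exact: hg.2|].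
move=> v h; move: t; apply: tensor_linext; [exact: hf.1|exact: hg.1|].
by move=> w h'; apply: E.
Qed.

Lemma tens_legs_bilin : bilin (@tens_legs V W A m).
Proof. by split; [apply: tens_legs_linear2|apply: tens_legs_linear1]. Qed.

End Legs.

Lemma alg_mul_bilin (A : algType k) : bilin ( *%R : A -> A -> A).
Proof. by split; [apply: lin_mull|apply: lin_mulr]. Qed.

Lemma tens_mul_bilin (A B : algType k) : bilin (@tens_mul k A B).
Proof. by split; [apply: tens_mulr_linear|apply: tens_mull_linear]. Qed.

Lemma bilin_comp (U V U' V' Z Z' : lmodType k) (b : U -> V -> Z)
    (f : U' -> U) (g : V' -> V) (l : Z -> Z') :
  bilin b -> linear f -> linear g -> linear l ->
  bilin (fun x y => l (b (f x) (g y))).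
Proof.
move=> hb lf lg ll; split=> [x|y]; apply: lin_comp ll _.
  exact: (lin_comp (hb.1 _) lg).
exact: (lin_comp (hb.2 _) lf).
Qed.

Variables V W : comod H.

Definition ctens_coact : V ⊗ W -> (V ⊗ W) ⊗ H :=
  tlift (fun v w => tens_legs *%R (coact V v) (coact W w)).

Lemma ctens_bilin :
  bilin (fun v w => tens_legs *%R (coact V v) (coact W w)).
Proof.
have lV := @coact_linear k H V; have lW := @coact_linear k H W.
have hb := @tens_legs_bilin V W H _ (@alg_mul_bilin H).
by have := bilin_comp hb lV lW (@lin_id _ _).
Qed.

Lemma ctens_coact_linear : linear ctens_coact.
Proof. exact: tlift_linear ctens_bilin. Qed.

Lemma ctens_coact_pure v w :
  ctens_coact (v ⊗ w) = tens_legs *%R (coact V v) (coact W w).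
Proof. exact: tlift_pure ctens_bilin. Qed.

Lemma ctens_coactA x :
  tassoc (tmap ctens_coact idfun (ctens_coact x)) =
  tmap idfun (@comul k H) (ctens_coact x).
Proof.
have lD := ctens_coact_linear; have lc := @comul_linear k H.
have lV := @coact_linear k H V; have lW := @coact_linear k H W.
have hm := @alg_mul_bilin H; have hmm := @tens_mul_bilin H H.
have hl := @tens_legs_bilin V W H _ hm.
have hll := @tens_legs_bilin V W _ _ hmm.
have lA (Z : lmodType k) : linear (@tassoc k Z H H) by exact: tassoc_linear.
have li1 := tmap_linear lD (@lin_id _ H).
have li2 (Z : lmodType k) := tmap_linear (@lin_id _ Z) lc.
have E1 (s : V ⊗ H) (t : W ⊗ H) h h' :
    tassoc (tens_legs *%R s t ⊗ (h * h')) =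
    tens_legs (@tens_mul k H H) (tassoc (s ⊗ h)) (tassoc (t ⊗ h')).
  move: s t; apply: tens_legs_ext.
  - have := bilin_comp hl (@lin_id _ _) (@lin_id _ _) (lin_comp (lA _) (lin_pure1 (h * h'))).
    by apply.
  - have := bilin_comp hll (lin_comp (lA V) (lin_pure1 h))
             (lin_comp (lA W) (lin_pure1 h')) (@lin_id _ _).
    by apply.
  by move=> v a w b; rewrite !(tens_legs_pure, tassoc_pure) // tens_mul_pure.
have E2 (s : V ⊗ H) (t : W ⊗ H) :
    tmap idfun (@comul k H) (tens_legs *%R s t) =
    tens_legs (@tens_mul k H H) (tmap idfun (@comul k H) s) (tmap idfun (@comul k H) t).
  move: s t; apply: tens_legs_ext.
  - by have := bilin_comp hl (@lin_id _ _) (@lin_id _ _) (li2 _); apply.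
  - by have := bilin_comp hll (li2 V) (li2 W) (@lin_id _ _); apply.
  by move=> v a w b; rewrite !(tens_legs_pure, tmap_pure) // rmorphM.
have E3 (s : V ⊗ H) (t : W ⊗ H) :
    tassoc (tmap ctens_coact idfun (tens_legs *%R s t)) =
    tens_legs (@tens_mul k H H)
      (tassoc (tmap (coact V) idfun s)) (tassoc (tmap (coact W) idfun t)).
  move: s t; apply: tens_legs_ext.
  - have := bilin_comp hl (@lin_id _ _) (@lin_id _ _) (lin_comp (lA _) li1).
    by apply.
  - have := bilin_comp hll (lin_comp (lA V) (tmap_linear lV (@lin_id _ H)))
             (lin_comp (lA W) (tmap_linear lW (@lin_id _ H))) (@lin_id _ _).
    by apply.
  move=> v a w b; rewrite !(tens_legs_pure, tmap_pure) //=.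
  by rewrite ctens_coact_pure E1.
move: x; apply: tensor_linext.
- exact: (lin_comp (lA _) (lin_comp li1 lD)).
- exact: (lin_comp (li2 _) lD).
by move=> v w; rewrite ctens_coact_pure E3 !coactA E2.
Qed.

Lemma ctens_coact_counit x :
  tlift (fun (w : (V ⊗ W)%type) (h : H) => counit h *: w) (ctens_coact x) = x.
Proof.
have hb (Z : lmodType k) : bilin (fun (z : Z) (h : H) => counit h *: z).
  exact: (scale_bilin Z (@counit_lin k H)).
have hl := @tens_legs_bilin V W H _ (@alg_mul_bilin H).
have E (s : V ⊗ H) (t : W ⊗ H) :
    tlift (fun (w : (V ⊗ W)%type) (h : H) => counit h *: w) (tens_legs *%R s t) =
    tlift (fun (w : V) (h : H) => counit h *: w) s ⊗
    tlift (fun (w : W) (h : H) => counit h *: w) t.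
  move: s t; apply: tens_legs_ext.
  - by have := bilin_comp hl (@lin_id _ _) (@lin_id _ _) (tlift_linear (hb _)); apply.
  - have := bilin_comp (@pure_bilin k V W) (tlift_linear (hb V)) (tlift_linear (hb W))
              (@lin_id _ _).
    by apply.
  move=> v a w b; rewrite tens_legs_pure; last exact: alg_mul_bilin.
  rewrite !tlift_pure // rmorphM -scalerA.
  by rewrite (linfZ (lin_pure1 _)) (linfZ (lin_pure2 _)).
move: x; apply: tensor_linext => //.
  exact: (lin_comp (tlift_linear (hb _)) ctens_coact_linear).
by move=> v w; rewrite ctens_coact_pure E !coact_counit.
Qed.

Definition ctens : comod H :=
  Comod ctens_coact_linear ctens_coactA ctens_coact_counit.

End TensorComod.

(* The dual comodule V^*, with f_0(v) f_1 = f(v_0) S(v_1), i.e. the sum of    *)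
(* e^i ⊗ S((f ⊗ id) (coact e_i)) over a basis (e_i) of V with dual basis e^i. *)
Section DualComod.
Variables (k : fieldType) (H : hopfAlgType k) (V : comod H).

Let n := \dim {:V}.
Let e : n.-tuple V := vbasis {:V}.

Definition dual_vec (i : 'I_n) : 'Hom(V, k^o) := linfun (coord e i : V -> k^o).

Definition contract (f : V -> k^o) : V ⊗ H -> H := tlift (fun v h => (f v : k) *: h).

Definition dual_coact (f : 'Hom(V, k^o)) : 'Hom(V, k^o) ⊗ H :=
  \sum_(i < n) dual_vec i ⊗ antipode (contract f (coact V e`_i)).

Let cmat : 'M[H]_n := \matrix_(j, i) contract (coord e j) (coact V e`_i).

Let eb : basis_of {:V} e := vbasisP _.
Let ef : free e := basis_free eb.

Let coordE v : v = \sum_(i < n) coord e i v *: e`_i.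
Proof. exact: coord_basis eb (memvf v). Qed.

Let dual_vecE i v : dual_vec i v = coord e i v.
Proof. by rewrite lfunE. Qed.

Let lin_coord i : linear (coord e i : V -> k^o).
Proof. by move=> c x y; rewrite linearP. Qed.

Let lin_hom (f : 'Hom(V, k^o)) : linear f.
Proof. by move=> c x y; rewrite linearP. Qed.

Let lin_contract f : linear f -> linear (contract f).
Proof. by move=> lf; apply: tlift_linear (scale_bilin' _ lf). Qed.

Let contract_pure f v h : linear f -> contract f (v ⊗ h) = (f v : k) *: h.
Proof. by move=> lf; rewrite /contract (tlift_pure _ _ (scale_bilin' _ lf)). Qed.

Let legE (W : lmodType k) (x : V ⊗ W) :
  x = \sum_(j < n) e`_j ⊗ tlift (fun v w => (coord e j v : k) *: w) x.
Proof.
have hb j : bilin (fun (v : V) (w : W) => (coord e j v : k) *: w).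
  exact: (scale_bilin' W (lin_coord j)).
move: x; apply: tensor_linext => //.
  by apply: lin_sumf => j; apply: (lin_comp (lin_pure2 _) (tlift_linear (hb j))).
move=> v w; rewrite {1}(coordE v) (linf_sum (lin_pure1 _)).
apply: eq_bigr => j _; rewrite (tlift_pure _ _ (hb j)).
by rewrite (linfZ (lin_pure1 _)) (linfZ (lin_pure2 _)).
Qed.

Let coactE (i : 'I_n) : coact V e`_i = \sum_(j < n) e`_j ⊗ cmat j i.
Proof. by rewrite {1}[coact V _]legE; apply: eq_bigr => j _; rewrite !mxE. Qed.

Let coord_e (i j : 'I_n) : coord e i e`_j = (i == j)%:R.
Proof. by rewrite coord_free // eq_sym. Qed.

Let contractE (f : V -> k^o) (i : 'I_n) :
  linear f -> contract f (coact V e`_i) = \sum_(j < n) (f e`_j : k) *: cmat j i.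
Proof.
move=> lf; rewrite coactE (linf_sum (lin_contract lf)).
by apply: eq_bigr => j _; rewrite contract_pure.
Qed.

Let cmat_comul l i : comul (cmat l i) = \sum_(j < n) cmat l j ⊗ cmat j i.
Proof.
have lc := @comul_linear k H; have lV := @coact_linear k H V.
have := coactA e`_i; rewrite coactE.
rewrite (linf_sum (tmap_linear lV (@lin_id _ H))) (linf_sum (@tassoc_linear _ _ _ _)).
rewrite (linf_sum (tmap_linear (@lin_id _ V) lc)).
pose ev := tlift (fun (v : V) (t : (H ⊗ H)%type) => (coord e l v : k) *: t).
have hb := scale_bilin' (tensor H H) (lin_coord l).
have lev : linear ev by exact: tlift_linear hb.
move=> /(congr1 ev); rewrite !(linf_sum lev) => E.
have -> : comul (cmat l i) = \sum_(j < n) ev (tmap idfun (@comul k H) (e`_j ⊗ cmat j i)).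
  rewrite (bigD1 l) //= big1 ?addr0 => [|j /negbTE jl].
    by rewrite tmap_pure // /ev (tlift_pure _ _ hb) coord_e eqxx scale1r.
  by rewrite tmap_pure // /ev (tlift_pure _ _ hb) /= coord_e eq_sym jl scale0r.
rewrite -E; apply: eq_bigr => j _; rewrite tmap_pure // coactE.
rewrite (linf_sum (lin_pure1 _)) (linf_sum (@tassoc_linear _ _ _ _)) (linf_sum lev).
rewrite (bigD1 l) //= big1 ?addr0 => [|j' /negbTE jl].
  by rewrite tassoc_pure /ev (tlift_pure _ _ hb) coord_e eqxx scale1r.
by rewrite tassoc_pure /ev (tlift_pure _ _ hb) coord_e eq_sym jl scale0r.
Qed.

Let cmat_counit j i : counit (cmat j i) = (j == i)%:R.
Proof.
have hb := scale_bilin V (@counit_lin k H).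
have := coact_counit e`_i; rewrite coactE (linf_sum (tlift_linear hb)).
under eq_bigr => l _ do rewrite (tlift_pure _ _ hb).
move=> /(congr1 (coord e j)); rewrite linear_sum coord_e => <-.
rewrite (bigD1 j) //= big1 ?addr0 => [|l /negbTE lj].
  by rewrite linearZ /= coord_e eqxx mulr1.
by rewrite linearZ /= coord_e eq_sym lj mulr0.
Qed.

Let smat : 'M[H]_n := map_mx antipode cmat.

Let smatl : smat *m cmat = 1%:M.
Proof.
apply/matrixP => j i; rewrite !mxE.
have hb : bilin (fun y z : H => antipode y * z).
  have := bilin_comp (@alg_mul_bilin k H) (@antipode_linear k H) (@lin_id k H) (@lin_id _ _).
  by apply.
have := antipodel (cmat j i); rewrite cmat_comul (linf_sum (tlift_linear hb)).
under eq_bigr => l _ do rewrite (tlift_pure _ _ hb).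
rewrite cmat_counit scaler_nat => <-.
by apply: eq_bigr => l _; rewrite [smat _ _]mxE.
Qed.

Let smatr : cmat *m smat = 1%:M.
Proof.
apply/matrixP => j i; rewrite !mxE.
have hb : bilin (fun y z : H => y * antipode z).
  have := bilin_comp (@alg_mul_bilin k H) (@lin_id k H) (@antipode_linear k H) (@lin_id _ _).
  by apply.
have := antipoder (cmat j i); rewrite cmat_comul (linf_sum (tlift_linear hb)).
under eq_bigr => l _ do rewrite (tlift_pure _ _ hb).
rewrite cmat_counit scaler_nat => <-.
by apply: eq_bigr => l _; rewrite [smat _ _]mxE.
Qed.

Let smat_comul j i : comul (smat j i) = \sum_(l < n) smat l i ⊗ smat j l.
Proof.
pose r1 (A : 'M[H]_n) : 'M[tensor H H]_n := map_mx (fun h : H => h ⊗ (1 : H)) A.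
pose r2 (A : 'M[H]_n) : 'M[tensor H H]_n := map_mx (fun h : H => (1 : H) ⊗ h) A.
pose D (A : 'M[H]_n) : 'M[tensor H H]_n := map_mx comul A.
have mulE (a b a' b' : H) : ((a ⊗ b) * (a' ⊗ b') : tensor H H) = (a * a') ⊗ (b * b').
  exact: tens_mul_pure.
have r1M A B : r1 (A *m B) = r1 A *m r1 B.
  apply/matrixP => a b; rewrite !mxE (linf_sum (lin_pure1 _)).
  by apply: eq_bigr => l _; rewrite !mxE mulE mulr1.
have r2M A B : r2 (A *m B) = r2 A *m r2 B.
  apply/matrixP => a b; rewrite !mxE (linf_sum (lin_pure2 _)).
  by apply: eq_bigr => l _; rewrite !mxE mulE mulr1.
have DM A B : D (A *m B) = D A *m D B by exact: map_mxM.
have D1 : D 1%:M = 1%:M by exact: map_mx1.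
have r11 : r1 1%:M = 1%:M.
  apply/matrixP => a b; rewrite !mxE; case: (a == b) => //.
  exact: (linf0 (lin_pure1 _)).
have r21 : r2 1%:M = 1%:M.
  apply/matrixP => a b; rewrite !mxE; case: (a == b) => //.
  exact: (linf0 (lin_pure2 _)).
have Dc : D cmat = r1 cmat *m r2 cmat.
  apply/matrixP => a b; rewrite [LHS]mxE cmat_comul [RHS]mxE.
  by apply: eq_bigr => l _; rewrite [r1 _ _ _]mxE [r2 _ _ _]mxE mulE mulr1 mul1r.
have Ds : D smat = r2 smat *m r1 smat.
  have inv : D cmat *m (r2 smat *m r1 smat) = 1%:M.
    by rewrite Dc mulmxA -(mulmxA (r1 cmat)) -r2M smatr r21 mulmx1 -r1M smatr r11.
  by rewrite -[LHS]mulmx1 -inv mulmxA -DM smatl D1 mul1mx.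
have := congr1 (fun A : 'M[tensor H H]_n => A j i) Ds; rewrite [LHS]mxE => ->.
rewrite mxE; apply: eq_bigr => l _.
by rewrite [r1 _ _ _]mxE [r2 _ _ _]mxE mulE mulr1 mul1r.
Qed.

Let dual_coactE f :
  dual_coact f = \sum_(i < n) dual_vec i ⊗ (\sum_(j < n) (f e`_j : k) *: smat j i).
Proof.
apply: eq_bigr => i _; rewrite (contractE i (lin_hom f)).
rewrite (linf_sum (@antipode_linear k H)); congr (_ ⊗ _).
by apply: eq_bigr => j _; rewrite (linfZ (@antipode_linear k H)) [smat _ _]mxE.
Qed.

Lemma dual_coact_linear : linear dual_coact.
Proof.
apply: lin_sumf => i; apply: lin_comp (lin_pure2 _) _.
apply: lin_comp (@antipode_linear k H) _.
apply: tlift_lin => u h c f g.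
by rewrite !lfunE /= lfunE scalerDl -scalerA.
Qed.

Lemma dual_coactA f :
  tassoc (tmap dual_coact idfun (dual_coact f)) =
  tmap idfun (@comul k H) (dual_coact f).
Proof.
have lc := @comul_linear k H; have ld := dual_coact_linear.
have lm1 := tmap_linear ld (@lin_id _ H).
have lm2 := tmap_linear (@lin_id _ (hom V k^o)) lc.
pose F (f : 'Hom(V, k^o)) := tassoc (tmap dual_coact idfun (dual_coact f)).
pose G (f : 'Hom(V, k^o)) := tmap idfun (@comul k H) (dual_coact f).
have lF : linear F by exact: (lin_comp (@tassoc_linear _ _ _ _) (lin_comp lm1 ld)).
have lG : linear G by exact: (lin_comp lm2 ld).
have dual_e j : dual_coact (dual_vec j) = \sum_(i < n) dual_vec i ⊗ smat j i.
  rewrite dual_coactE; apply: eq_bigr => i _; congr (_ ⊗ _).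
  rewrite (bigD1 j) //= big1 ?addr0 => [|l /negbTE lj].
    by rewrite dual_vecE coord_e eqxx scale1r.
  by rewrite dual_vecE coord_e eq_sym lj scale0r.
have fE : f = \sum_(j < n) (f e`_j : k) *: dual_vec j.
  apply/lfunP => v; rewrite {1}(coordE v) linear_sum sum_lfunE.
  by apply: eq_bigr => j _; rewrite linearZ scale_lfunE dual_vecE; apply: mulrC.
suff E j : F (dual_vec j) = G (dual_vec j).
  rewrite -/(F f) -/(G f) fE (linf_sum lF) (linf_sum lG).
  by apply: eq_bigr => j _; rewrite (linfZ lF) (linfZ lG) E.
rewrite /F /G dual_e (linf_sum lm1) (linf_sum lm2) (linf_sum (@tassoc_linear _ _ _ _)).
transitivity (\sum_(i < n) \sum_(l < n) dual_vec l ⊗ (smat i l ⊗ smat j i)).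
  apply: eq_bigr => i _; rewrite tmap_pure // dual_e (linf_sum (lin_pure1 _)).
  by rewrite (linf_sum (@tassoc_linear _ _ _ _)); apply: eq_bigr => l _; rewrite tassoc_pure.
rewrite exchange_big; apply: eq_bigr => l _ /=.
by rewrite tmap_pure // smat_comul (linf_sum (lin_pure2 _)).
Qed.

Let smat_counit j i : counit (smat j i) = (j == i)%:R.
Proof.
have E : map_mx (@counit k H) cmat = 1%:M.
  by apply/matrixP => a b; rewrite [LHS]mxE cmat_counit mxE.
have := congr1 (fun A => map_mx (@counit k H) A j i) smatl.
by rewrite map_mxM E mulmx1 map_mx1 !mxE.
Qed.

Lemma dual_coact_counit f :
  tlift (fun (g : 'Hom(V, k^o)) (h : H) => counit h *: g) (dual_coact f) = f.
Proof.
have hb := scale_bilin (hom V k^o) (@counit_lin k H).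
rewrite dual_coactE (linf_sum (tlift_linear hb)); apply/lfunP => v.
rewrite sum_lfunE [in RHS](coordE v) linear_sum; apply: eq_bigr => i _.
rewrite (tlift_pure _ _ hb) scale_lfunE dual_vecE linearZ /=.
rewrite (linf_sum (@counit_lin k H)) (bigD1 i) //= big1 ?addr0 => [|j /negbTE ji].
  by rewrite (linfZ (@counit_lin k H)) smat_counit eqxx [X in X *: _]mulr1 [LHS]mulrC.
by rewrite (linfZ (@counit_lin k H)) smat_counit ji [LHS]mulr0.
Qed.

Definition dual_comod : comod H :=
  Comod dual_coact_linear dual_coactA dual_coact_counit.

End DualComod.

Definition cosemisimple (k : fieldType) (H : hopfAlgType k) : Prop :=
  forall V : comod H, exists (n : nat) (S : 'I_n -> comod H),
    (forall i, simple_comod (S i)) /\ comod_iso V (dsums [seq S i | i : 'I_n]).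

Section Words.
Variables (R : eqType) (star : R -> R) (op : R -> R -> option R).
Implicit Types x y v g w : seq R.

Definition wstar x : seq R := rev (map star x).

(* None stands for the value ∅. *)
Definition wop v w : option (seq R) :=
  match rev v, w with
  | r :: v', s :: w' => omap (fun t => rev v' ++ t :: w') (op r s)
  | _, _ => None
  end.

(* The triples (v, g, w) such that x = v g and y = g^* w, each listed once.   *)
Definition splittings x y : seq (seq R * seq R * seq R) :=
  [seq (take i x, drop i x, drop (size x - i) y) |
     i <- iota 0 (size x).+1 & prefix (wstar (drop i x)) y].

Lemma size_wstar x : size (wstar x) = size x.
Proof. by rewrite size_rev size_map. Qed.

Lemma splittingsP x y v g w :
  reflect (x = v ++ g /\ y = wstar g ++ w) ((v, g, w) \in splittings x y).
Proof.
apply: (iffP mapP) => [[i + [-> -> ->]]|[-> ->]].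
  rewrite mem_filter => /andP[/prefixP[y' ->] _]; rewrite cat_take_drop; split=> //.
  by rewrite -(size_drop i x) -(size_wstar (drop i x)) drop_size_cat.
exists (size v).
  rewrite mem_filter drop_size_cat // prefix_prefix mem_iota /= add0n ltnS.
  by rewrite size_cat leq_addr.
rewrite take_size_cat // drop_size_cat // size_cat addKn.
by rewrite drop_size_cat // size_wstar.
Qed.

Lemma splittings_uniq x y : uniq (splittings x y).
Proof.
rewrite map_inj_in_uniq ?filter_uniq ?iota_uniq // => i j.
rewrite !mem_filter !mem_iota /= !add0n !ltnS => /andP[_ hi] /andP[_ hj] [E _ _].
by move/(congr1 size): E; rewrite !size_take_min !(minn_idPl _).
Qed.

(* The words u such that a_u occurs, with multiplicity, in a_x a_y. *)
Definition fusion_words x y : seq (seq R) :=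
  flatten [seq (t.1.1 ++ t.2) :: oapp (fun u => [:: u]) [::] (wop t.1.1 t.2) |
             t <- splittings x y].

End Words.

(* In the Grothendieck semiring of the (semisimple) category of comodules a    *)
(* comodule is identified with its isomorphism class, the sum is the direct    *)
(* sum and the product the tensor product.  The simple comodule a x            *)
(* represents the class a_x.                                                   *)
Record free_labelling (k : fieldType) (H : hopfAlgType k) (R : eqType)
    (star : R -> R) (op : R -> R -> option R) (a : seq R -> comod H) : Prop := {
  label_simple : forall x, simple_comod (a x);
  label_inj : forall x y, comod_iso (a x) (a y) -> x = y;
  label_surj : forall V : comod H, simple_comod V -> exists x, comod_iso V (a x);
  label_unit : comod_iso (a [::]) (triv_comod H);
  label_dual : forall x, comod_iso (a (wstar star x)) (dual_comod (a x));
  label_mul : forall x y,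
    comod_iso (ctens (a x) (a y)) (dsums (map a (fusion_words star op x y)))
}.

Definition free_fusion_semiring (k : fieldType) (H : hopfAlgType k) (R : eqType)
    (star : R -> R) (op : R -> R -> option R) : Prop :=
  exists a : seq R -> comod H, free_labelling star op a.

Section Normality.
Variable k : fieldType.
Implicit Types H K P : hopfAlgType k.

Definition left_hker H K (p : H -> K) (h : H) : Prop :=
  tmap p idfun (comul h) = 1 ⊗ h.

Definition right_hker H K (p : H -> K) (h : H) : Prop :=
  tmap idfun p (comul h) = h ⊗ 1.

Definition normal_map H K (p : H -> K) : Prop :=
  hopf_map p /\ forall h, left_hker p h <-> right_hker p h.

Definition normal_quantum_subgroup H K (p : H -> K) : Prop :=
  [/\ normal_map p, forall y, exists x, p x = y & cosemisimple K].

Definition hopf_simple H : Prop :=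
  forall K (p : H -> K), normal_quantum_subgroup p ->
    arrow_iso p (idfun : H -> H) \/ arrow_iso p (counit : H -> k^o).

Definition central_map H K (p : H -> K) : Prop :=
  hopf_map p /\
  forall h, tmap p idfun (comul h) = tmap p idfun (tswap (comul h)).

(* the initial object of the category of central arrows H -> k[G] *)
Definition is_center H (G : groupType) (z : H -> galg k G) : Prop :=
  central_map z /\
  forall (G' : groupType) (z' : H -> galg k G'), central_map z' ->
    (exists f : galg k G -> galg k G', hopf_map f /\ f \o z =1 z') /\
    (forall f f' : galg k G -> galg k G',
       hopf_map f -> f \o z =1 z' -> hopf_map f' -> f' \o z =1 z' -> f =1 f').

(* The Hopf subalgebra P, given by its inclusion i into H, is the Hopf kernel *)
(* of the center z.                                                           *)
Definition is_cocenter H (G : groupType) (z : H -> galg k G) P (i : P -> H) : Prop :=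
  [/\ is_center z, hopf_map i, injective i &
      forall h, left_hker z h <-> exists x, i x = h].

End Normality.

(* Main.v *)
From HB Require Import structures.
From mathcomp Require Import all_boot all_algebra.
From mathcomp Require Import finmap boolp.
From mathcomp Require classical_sets.
From mathcomp.multinomials Require Import monalg.
Require Import Defs.

(* Idea.  Write [N] for the set of words [x] whose comodule [a x] becomes      *)
(* trivial along a normal quotient [p : P -> K].  If [a x] comes from [P],     *)
(* [n] lies in [N] and [y] occurs in [a x (x) a n], then over [K] the          *)
(* coefficients of [a y] are among those of [a x], so [a y (x) a x^*] contains *)
(* a [K]-coinvariant vector; by normality some constituent of it lies in [N].  *)
(* Take [x = v v^*], which comes from the cocenter by Schur's lemma, [n] a     *)
(* long power of a nonempty word of [N], and [y = x n]: that constituent       *)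
(* begins with [v], so [v v^*] is in [N] for every word [v].  The quotient of  *)
(* the free monoid of words by the syntactic congruence of [N] is then a group *)
(* grading the fusion rules, and the universal property of the center forces   *)
(* every comodule of [P] into [N], i.e. [K] is trivial.  If [N] contains only  *)
(* the empty word, the Haar functional of [K] pulls back to that of [P], which *)
(* is nondegenerate, so [p] is injective.                                      *)

Set Implicit Arguments.
Unset Strict Implicit.
Unset Printing Implicit Defensive.

Import GRing.Theory.
Local Open Scope ring_scope.

(** * Functionals and tensors *)

(** A comodule of [P] is an [H]-comodule with coefficients in [i(P)]. A normal quotient [p : P -> K]
    is therefore studied through two sets of words: [in_image], the labels coming from [P], and
    inside it [in_kernel], the labels that become trivial over [K]. Either [in_kernel] contains only
    the empty word and [p] is injective, or it exhausts [in_image] and [K] is the ground field.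

    The first alternative is [trivial_kernel_injective]; it rests on the existence ([haar_ex]) and
    nondegeneracy ([haar_nondegenerate]) of the Haar functional.

    In the second, normality enters through [kernel_dichotomy]: a simple comodule of [P] on whose
    coefficients the Haar functional of [K] does not vanish is trivial over [K]. Hence
    [kernel_meets]: if [y] occurs in [x n] with [n] in the kernel, some constituent of [y x^*] is in
    the kernel. Freeness enters through length: when [n] is long, all constituents of [(x n) x^*]
    begin with [x] ([long_fusion_prefix]). Applied to [x = v v^*], which comes from the cocenter by
    Schur's lemma ([central_coeffs], [cocenter_adjoint]), this puts every [v v^*] in the kernel
    ([kernel_contains_adjoint]).

    Now [r r^*] may be inserted or deleted, and [r s] exchanged with its fusion [r ∘ s], without
    leaving [in_kernel]; the second point needs Frobenius reciprocity ([label_op_rotate]). The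
    syntactic quotient of the words is then a group grading the fusion rules, whose words of degree
    1 lie in the kernel ([grading_group]). The grading gives a central map ([graded_central_map]),
    which factors through the center, so labels coming from [P] have degree 1
    ([image_in_kernel]). *)

Section Subspaces.
Variable k : fieldType.
Implicit Types U V W : lmodType k.

Definition subspace U (D : U -> Prop) : Prop :=
  D 0 /\ forall (c : k) x y, D x -> D y -> D (c *: x + y).

Lemma subspace0 U (D : U -> Prop) : subspace D -> D 0.
Proof. by case. Qed.

Lemma subspaceD U (D : U -> Prop) x y : subspace D -> D x -> D y -> D (x + y).
Proof. by move=> [_ hD] Dx Dy; rewrite -[x]scale1r; apply: hD. Qed.

Lemma subspaceZ U (D : U -> Prop) (c : k) x : subspace D -> D x -> D (c *: x).
Proof. by move=> [D0 hD] Dx; rewrite -[_ *: _]addr0; apply: hD. Qed.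

Lemma subspaceB U (D : U -> Prop) x y : subspace D -> D x -> D y -> D (x - y).
Proof. by move=> hD Dx Dy; apply: subspaceD => //; rewrite -scaleN1r; apply: subspaceZ. Qed.

Lemma subspace_sum U (D : U -> Prop) I (r : seq I) (F : I -> U) :
  subspace D -> (forall i, D (F i)) -> D (\sum_(i <- r) F i).
Proof.
by move=> hD DF; elim/big_ind: _ => [|x y|//]; [apply: subspace0 | apply: subspaceD].
Qed.

(** Zorn's lemma is applied to arbitrary sets whose stable hull together with [S] avoids [u], not to
    stable subspaces: this makes the union of the empty chain admissible. It serves with no
    operators for linear functionals, and with translations for the Haar functional. *)
Lemma maximal_stable U (A : (U -> U) -> Prop) (S : U -> Prop) (u : U) :
    subspace S -> (forall a x, A a -> S x -> S (a x)) -> ~ S u ->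
  exists M : U -> Prop,
  [/\ subspace M, forall a x, A a -> M x -> M (a x), forall x, S x -> M x, ~ M u &
      forall M' : U -> Prop, subspace M' -> (forall a x, A a -> M' x -> M' (a x)) ->
        (forall x, M x -> M' x) -> forall x, ~ M x -> M' x -> M' u].
Proof.
move=> hS stS Su.
pose hull (X : U -> Prop) y := forall D : U -> Prop, subspace D ->
  (forall a x, A a -> D x -> D (a x)) -> (forall x, S x -> D x) ->
  (forall x, X x -> D x) -> D y.
have hull_sub X : subspace (hull X).
  split=> [D hD _ _ _|c x y hx hy D hD stD SD XD]; first exact: subspace0.
  by apply: hD.2; [exact: hx | exact: hy].
have hull_st X a x : A a -> hull X x -> hull X (a x).
  by move=> Aa hx D hD stD SD XD; apply: (stD _ _ Aa); exact: hx.
have hullS X x : S x -> hull X x by move=> Sx D _ _ SD _; exact: SD.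
have hullX (X : U -> Prop) x : X x -> hull X x by move=> Xx D _ _ _ XD; exact: XD.
have hull_mono (X Y : U -> Prop) x : (forall x, X x -> Y x) -> hull X x -> hull Y x.
  by move=> XY hx D hD stD SD YD; apply: hx => // z /XY; apply: YD.
have [F FP Ftot|X0 [PX0 maxX0]] :=
    @classical_sets.Zorn_bigcup U (fun X => ~ hull X u).
  move=> hu.
  suff [//|[X FX]] : S u \/ exists2 X, F X & hull X u by apply: FP.
  apply: (hu (fun y => S y \/ exists2 X, F X & hull X y)).
  - split=> [|c x y]; first by left; apply: subspace0.
    move=> [Sx|[X FX hx]] [Sy|[Y FY hy]].
    + by left; apply: hS.2.
    + by right; exists Y => //; apply: (hull_sub Y).2 => //; exact: hullS Sx.
    + by right; exists X => //; apply: (hull_sub X).2 => //; exact: hullS Sy.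
    + right; case: (Ftot X Y FX FY) => XY.
        by exists Y => //; apply: (hull_sub Y).2 => //; exact: hull_mono hx.
      by exists X => //; apply: (hull_sub X).2 => //; exact: hull_mono hy.
  - move=> a x Aa [Sx|[X FX hx]]; first by left; apply: stS.
    by right; exists X => //; exact: hull_st hx.
  - by left.
  - by move=> x [X FX Xx]; right; exists X => //; exact: hullX Xx.
exists (hull X0); split.
- exact: hull_sub.
- by move=> a x; apply: hull_st.
- by move=> x; apply: hullS.
- exact: PX0.
move=> M' hM' stM' le x nx M'x; apply: contrapT => nu.
apply: (maxX0 (fun y => X0 y \/ y = x)).
  split; first by move=> y; left.
  move=> /(_ x (or_intror erefl)) X0x; apply: nx; exact: hullX.
move=> /(_ M' hM' stM'); apply: contra_not nu; apply.
  by move=> y Sy; exact: le (hullS _ _ Sy).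
by move=> y [X0y|->//]; exact: le (hullX _ _ X0y).
Qed.

(** A maximal subspace [M] containing [S] and avoiding [u] is a complement of the line through [u];
    [f] is the coordinate along that line. *)
Lemma separating_functional U (S : U -> Prop) (u : U) : subspace S -> ~ S u ->
  exists f : U -> k^o, [/\ linear f, forall x, S x -> f x = 0 & f u = 1].
Proof.
move=> hS Su.
have [//|M [hM _ SM Mu maxM]] := @maximal_stable U (fun _ => False) S u hS _ Su.
have ex v : exists c : k, M (v - c *: u).
  have [Mv|nMv] := pselect (M v); first by exists 0; rewrite scale0r subr0.
  have hM' : subspace (fun y => exists m c, M m /\ y = m + c *: v).
    split; first by exists 0, 0; rewrite scale0r addr0; split=> //; apply: subspace0.
    move=> c _ _ [m [d [Mm ->]]] [m' [d' [Mm' ->]]].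
    exists (c *: m + m'), (c * d + d'); split; first by apply: hM.2.
    by rewrite scalerDr addrACA scalerA scalerDl.
  have leM' x : M x -> exists m c, M m /\ x = m + c *: v.
    by move=> Mx; exists x, 0; rewrite scale0r addr0.
  have M'v : exists m c, M m /\ v = m + c *: v.
    by exists 0, 1; rewrite scale1r add0r; split=> //; apply: subspace0.
  have [//|m [c [Mm uE]]] := maxM _ hM' _ leM' _ nMv M'v.
  have c0 : c != 0 by apply: contra_notN Mu => /eqP c0; rewrite uE c0 scale0r addr0.
  exists c^-1; rewrite uE scalerDr scalerA mulVf // scale1r opprD addrCA subrr addr0.
  by rewrite -scaleN1r; do 2!apply: subspaceZ => //.
have [f fP] := choice ex.
have uniq v c d : M (v - c *: u) -> M (v - d *: u) -> c = d.
  move=> Mc Md; have := subspaceB hM Md Mc.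
  rewrite opprB addrC addrA subrK -scalerBl => Mcd.
  apply/eqP; rewrite -subr_eq0; apply: contra_notT Mu => cd0.
  by rewrite -[u]scale1r -(mulVf cd0) -scalerA; apply: subspaceZ.
exists f; split=> [c x y|x Sx|].
- apply: (uniq (c *: x + y)) => //.
  rewrite scalerDl -scalerA opprD addrACA -scalerBr.
  by apply: hM.2.
- by apply: (uniq x) => //; rewrite scale0r subr0; apply: SM.
- by apply: (uniq u) => //; rewrite scale1r subrr; apply: subspace0.
Qed.

Lemma functional_sep U (x y : U) :
  (forall f : U -> k^o, linear f -> f x = f y) -> x = y.
Proof.
move=> E; apply: contrapT => xy.
have h0 : subspace (fun z : U => z = 0).
  by split=> // c _ _ -> ->; rewrite scaler0 addr0.
have nz : x - y <> 0 by move/eqP; rewrite subr_eq0 => /eqP.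
have [f [lf _ f1]] := separating_functional h0 nz.
have : f (x - y) = 0 by rewrite (linfD lf) -scaleN1r (linfZ lf) E // scaleN1r subrr.
by rewrite f1 => /eqP; rewrite oner_eq0.
Qed.

(** The slice map [f ⊗ id], followed by [id ⊗ f]. Identities in tensor products are proved below by
    slicing. *)
Definition evall U V (f : U -> k^o) (t : U ⊗ V) : V := tlift (fun u v => (f u : k) *: v) t.
Definition evalr U V (f : V -> k^o) (t : U ⊗ V) : U := tlift (fun u v => (f v : k) *: u) t.

Lemma evall_linear U V (f : U -> k^o) : linear f -> linear (@evall U V f).
Proof. by move=> lf; apply: tlift_linear (scale_bilin' _ lf). Qed.

Lemma evalr_linear U V (f : V -> k^o) : linear f -> linear (@evalr U V f).
Proof. by move=> lf; apply: tlift_linear (scale_bilin _ lf). Qed.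

Lemma evall_pure U V (f : U -> k^o) (u : U) (v : V) :
  linear f -> evall f (u ⊗ v) = (f u : k) *: v.
Proof. by move=> lf; apply: tlift_pure (scale_bilin' _ lf). Qed.

Lemma evalr_pure U V (f : V -> k^o) (u : U) (v : V) :
  linear f -> evalr f (u ⊗ v) = (f v : k) *: u.
Proof. by move=> lf; apply: tlift_pure (scale_bilin _ lf). Qed.

Lemma evall_map U V (U' V' : lmodType k) (g : U -> U') (h : V -> V') (f : U' -> k^o) t :
  linear g -> linear h -> linear f ->
  evall f (tmap g h t) = h (evall (fun u => f (g u)) t).
Proof.
move=> lg lh lf; have lfg : linear (fun u => f (g u) : k^o) by exact: lin_comp.
move: t; apply: tensor_linext.
- exact: lin_comp (evall_linear lf) (tmap_linear lg lh).
- exact: lin_comp lh (evall_linear lfg).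
by move=> u v; rewrite tmap_pure // !evall_pure // (linfZ lh).
Qed.

Lemma evalr_map U V (U' V' : lmodType k) (g : U -> U') (h : V -> V') (f : V' -> k^o) t :
  linear g -> linear h -> linear f ->
  evalr f (tmap g h t) = g (evalr (fun v => f (h v)) t).
Proof.
move=> lg lh lf; have lfh : linear (fun v => f (h v) : k^o) by exact: lin_comp.
move: t; apply: tensor_linext.
- exact: lin_comp (evalr_linear lf) (tmap_linear lg lh).
- exact: lin_comp lg (evalr_linear lfh).
by move=> u v; rewrite tmap_pure // !evalr_pure // (linfZ lg).
Qed.

Lemma eval_comm U V (f : U -> k^o) (g : V -> k^o) t : linear f -> linear g ->
  f (evalr g t) = g (evall f t).
Proof.
move=> lf lg; move: t; apply: (@tensor_linext _ _ _ k^o).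
- exact: lin_comp lf (evalr_linear lg).
- exact: lin_comp lg (evall_linear lf).
move=> u v; rewrite evalr_pure // evall_pure // (linfZ lf) (linfZ lg).
exact: mulrC.
Qed.

Lemma evall_evalr U V W (f : U -> k^o) (g : W -> k^o) (t : (U ⊗ V) ⊗ W) :
  linear f -> linear g -> evall f (evalr g t) = evalr g (evall f (tassoc t)).
Proof.
move=> lf lg; move: t; apply: tensor_linext.
- exact: lin_comp (evall_linear lf) (evalr_linear lg).
- apply: lin_comp (evalr_linear lg) _.
  exact: lin_comp (evall_linear lf) (@tassoc_linear _ _ _ _).
move=> s w; rewrite evalr_pure // (linfZ (evall_linear lf)).
move: s; apply: tensor_linext.
- by move=> c x y; rewrite (evall_linear lf) scalerDr !scalerA mulrC.
- apply: lin_comp (evalr_linear lg) _; apply: lin_comp (evall_linear lf) _.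
  exact: lin_comp (@tassoc_linear _ _ _ _) (lin_pure1 _).
move=> u v; rewrite tassoc_pure !evall_pure // (linfZ (evalr_linear lg)).
by rewrite evalr_pure // !scalerA mulrC.
Qed.

Lemma evall_evall U V W (f : U -> k^o) (g : V -> k^o) (t : (U ⊗ V) ⊗ W) :
  linear f -> linear g ->
  evall g (evall f (tassoc t)) = evall (fun s => f (evalr g s)) t.
Proof.
move=> lf lg; have lfg : linear (fun s => f (evalr g s) : k^o).
  exact: lin_comp lf (evalr_linear lg).
move: t; apply: tensor_linext.
- apply: lin_comp (evall_linear lg) _.
  exact: lin_comp (evall_linear lf) (@tassoc_linear _ _ _ _).
- exact: evall_linear.
move=> s w; rewrite evall_pure //; move: s; apply: tensor_linext.
- apply: lin_comp (evall_linear lg) _; apply: lin_comp (evall_linear lf) _.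
  exact: lin_comp (@tassoc_linear _ _ _ _) (lin_pure1 _).
- by move=> c x y; rewrite lfg scalerDl scalerA.
move=> u v; rewrite tassoc_pure evall_pure // (linfZ (evall_linear lg)) evall_pure //.
by rewrite evalr_pure // (linfZ lf) scalerA mulrC.
Qed.

Lemma sum_lift U n (F : 'I_n.+1 -> U) (i : 'I_n.+1) :
  \sum_j F j = F i + \sum_(j < n) F (lift i j).
Proof. exact: bigD1_ord. Qed.

Definition dual_family U n (B : 'I_n -> U -> k^o) (b : 'I_n -> U) : Prop :=
  (forall i, linear (B i)) /\ forall i j, B i (b j) = (i == j)%:R.

Lemma dual_family_ex U n (b : 'I_n -> U) :
  (forall i (c : 'I_n -> k), c i = 0 -> b i <> \sum_j c j *: b j) ->
  exists B, dual_family B b.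
Proof.
move=> free.
have ex i : exists f : U -> k^o, linear f /\ forall j, f (b j) = (i == j)%:R.
  have hS : subspace (fun u => exists c : 'I_n -> k, c i = 0 /\ u = \sum_j c j *: b j).
    split=> [|c _ _ [d [di ->]] [e [ei ->]]].
      by exists (fun=> 0); split=> //; rewrite big1 // => j _; rewrite scale0r.
    exists (fun j => c * d j + e j); rewrite di ei mulr0 addr0; split=> //.
    rewrite scaler_sumr -big_split; apply: eq_bigr => j _ /=.
    by rewrite scalerA scalerDl.
  have Si : ~ exists c : 'I_n -> k, c i = 0 /\ b i = \sum_j c j *: b j.
    by move=> [c [ci bi]]; exact: free ci bi.
  have [f [lf f0 f1]] := separating_functional hS Si.
  exists f; split=> // j; have [<-//|ij] := eqVneq i j.
  apply: f0; exists (fun l => (l == j)%:R); rewrite (negbTE ij); split=> //.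
  rewrite (bigD1 j) //= eqxx scale1r big1 ?addr0 // => l /negbTE ->.
  by rewrite scale0r.
by have [B BP] := choice ex; exists B; split=> [i|i j]; have [] := BP i.
Qed.

(* A decomposition with the least number of terms has both families free. *)
Lemma tensor_rank U V (t : U ⊗ V) :
  exists n (b : 'I_n -> U) (y : 'I_n -> V) B Y,
  [/\ dual_family B b, dual_family Y y & t = \sum_i b i ⊗ y i].
Proof.
pose P n := `[< exists (b : 'I_n -> U) (y : 'I_n -> V), t = \sum_i b i ⊗ y i >].
have exP : exists n, P n.
  exists (size (repr t)); apply/asboolP.
  exists (fun i => (nth (0, 0) (repr t) i).1), (fun i => (nth (0, 0) (repr t) i).2).
  by rewrite {1}[t]tensorE (big_nth (0, 0)) big_mkord.
have /asboolP[b [y tE]] : P (ex_minn exP) by case: ex_minnP.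
have minP m : P m -> (ex_minn exP <= m)%N by case: ex_minnP => n _; apply.
move: (ex_minn exP) => n in b y tE minP *.
have [B BP] : exists B, dual_family B b.
  apply: dual_family_ex => i c ci bi.
  case: n => [|n] in b y tE minP i c ci bi *; first by case: i {bi ci}.
  suff /minP : P n by rewrite ltnn.
  apply/asboolP; exists (b \o lift i), (fun j => y (lift i j) + c (lift i j) *: y i).
  rewrite tE (sum_lift _ i) {1}bi (sum_lift _ i) ci scale0r add0r.
  rewrite (linf_sum (lin_pure1 _)) -big_split; apply: eq_bigr => j _ /=.
  by rewrite (linfD (lin_pure2 _)) (linfZ (lin_pure1 _)) (linfZ (lin_pure2 _)) addrC.
have [Y YP] : exists Y, dual_family Y y.
  apply: dual_family_ex => i c ci yi.
  case: n => [|n] in b y tE minP i c ci yi B BP *; first by case: i {yi ci}.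
  suff /minP : P n by rewrite ltnn.
  apply/asboolP; exists (fun j => b (lift i j) + c (lift i j) *: b i), (y \o lift i).
  rewrite tE (sum_lift _ i) {1}yi (sum_lift _ i) ci scale0r add0r.
  rewrite (linf_sum (lin_pure2 _)) -big_split; apply: eq_bigr => j _ /=.
  by rewrite (linfD (lin_pure1 _)) (linfZ (lin_pure1 _)) (linfZ (lin_pure2 _)) addrC.
by exists n, b, y, B, Y.
Qed.

Lemma dual_sumr U V n (B : 'I_n -> U -> k^o) b (y : 'I_n -> V) i :
  dual_family B b -> evall (B i) (\sum_j b j ⊗ y j) = y i.
Proof.
move=> [lB BE]; rewrite (linf_sum (evall_linear (lB i))) (bigD1 i) //=.
rewrite evall_pure // BE eqxx scale1r big1 ?addr0 // => j /negbTE ji.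
by rewrite evall_pure // BE eq_sym ji scale0r.
Qed.

Lemma dual_suml U V n (Y : 'I_n -> V -> k^o) y (b : 'I_n -> U) i :
  dual_family Y y -> evalr (Y i) (\sum_j b j ⊗ y j) = b i.
Proof.
move=> [lY YE]; rewrite (linf_sum (evalr_linear (lY i))) (bigD1 i) //=.
rewrite evalr_pure // YE eqxx scale1r big1 ?addr0 // => j /negbTE ji.
by rewrite evalr_pure // YE eq_sym ji scale0r.
Qed.

(** In a shortest decomposition of [s - t] the left factors are themselves slices of [s - t], hence
    zero. *)
Lemma tensor_sepr U V (s t : U ⊗ V) :
  (forall f : V -> k^o, linear f -> evalr f s = evalr f t) -> s = t.
Proof.
move=> E; apply/eqP; rewrite -subr_eq0; apply/eqP.
have [n [b [y [B [Y [_ hY dE]]]]]] := tensor_rank (s - t).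
rewrite dE big1 // => i _; rewrite -(dual_suml b i hY) -dE.
have lY := hY.1 i; rewrite (linfD (evalr_linear lY)) -scaleN1r.
rewrite (linfZ (evalr_linear lY)) E // scaleN1r subrr.
exact: linf0 (lin_pure1 _).
Qed.

Lemma tensor_sepl U V (s t : U ⊗ V) :
  (forall f : U -> k^o, linear f -> evall f s = evall f t) -> s = t.
Proof.
move=> E; apply/eqP; rewrite -subr_eq0; apply/eqP.
have [n [b [y [B [Y [hB _ dE]]]]]] := tensor_rank (s - t).
rewrite dE big1 // => i _; rewrite -(dual_sumr y i hB) -dE.
have lB := hB.1 i; rewrite (linfD (evall_linear lB)) -scaleN1r.
rewrite (linfZ (evall_linear lB)) E // scaleN1r subrr.
exact: linf0 (lin_pure2 _).
Qed.

End Subspaces.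

(** * Coefficients of comodules *)

Section Translates.
Variables (k : fieldType) (H : hopfAlgType k).
Implicit Types (f g : H -> k^o) (x : H).

(** In Sweedler notation this is [f(x_1) x_2], and [ract f x] is [x_1 f(x_2)]. Over a field, a
    subspace stable under both is a subcoalgebra, which is what [closed_sub] encodes. *)
Definition lact f x : H := evall f (comul x).
Definition ract f x : H := evalr f (comul x).

Definition closed_sub (Q : H -> Prop) : Prop :=
  subspace Q /\ forall f, linear f -> forall x, Q x -> Q (lact f x) /\ Q (ract f x).

Lemma lact_linear f : linear f -> linear (lact f).
Proof. by move=> lf; apply: lin_comp (evall_linear lf) (@comul_linear k H). Qed.

Lemma ract_linear f : linear f -> linear (ract f).
Proof. by move=> lf; apply: lin_comp (evalr_linear lf) (@comul_linear k H). Qed.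

Lemma lact_ract f g x : linear f -> linear g -> lact f (ract g x) = ract g (lact f x).
Proof.
move=> lf lg; have lc := @comul_linear k H; have li := @lin_id k H.
rewrite /lact /ract -[comul (evalr _ _)](evalr_map _ lc li lg) evall_evalr // comulA.
by rewrite evall_map.
Qed.

Lemma pairing f g x : linear f -> linear g -> f (ract g x) = g (lact f x).
Proof. exact: eval_comm. Qed.

Lemma counit_ract f x : linear f -> (counit (ract f x) : k^o) = f x.
Proof.
move=> lf; rewrite (@pairing (@counit k H) f) //; last exact: counit_lin.
by congr f; exact: counitl.
Qed.

Lemma counit_lact f x : linear f -> (counit (lact f x) : k^o) = f x.
Proof.
move=> lf; rewrite -(@pairing f (@counit k H)) //; last exact: counit_lin.
by congr f; exact: counitr.
Qed.

Lemma comul1 : comul (1 : H) = 1 ⊗ 1.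
Proof. exact: (@comul_monoid k H).1. Qed.

Lemma ract1 f : linear f -> ract f 1 = (f 1 : k) *: 1.
Proof. by move=> lf; rewrite /ract comul1 evalr_pure. Qed.

Lemma lact1 f : linear f -> lact f 1 = (f 1 : k) *: 1.
Proof. by move=> lf; rewrite /lact comul1 evall_pure. Qed.

Lemma ract_invariant_scalar x :
  (forall f, linear f -> ract f x = (f 1 : k) *: x) -> x = counit x *: 1.
Proof.
move=> E; apply: functional_sep => f lf.
by rewrite (linfZ lf) -(counit_ract x lf) E // linearZ /= [LHS]mulrC.
Qed.

Definition corep n (m : 'M[H]_n) : Prop :=
  (forall i j, comul (m i j) = \sum_l m i l ⊗ m l j) /\
  forall i j, counit (m i j) = (i == j)%:R.

Lemma corep_antipodel n (m : 'M[H]_n) : corep m -> map_mx antipode m *m m = 1%:M.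
Proof.
move=> [mD me]; apply/matrixP => i j; rewrite !mxE.
have hb : bilin (fun y z : H => antipode y * z).
  have := bilin_comp (@alg_mul_bilin k H) (@antipode_linear k H) (@lin_id k H) (@lin_id _ _).
  by apply.
have := antipodel (m i j); rewrite mD (linf_sum (tlift_linear hb)) me scaler_nat => <-.
by apply: eq_bigr => l _; rewrite (tlift_pure _ _ hb) mxE.
Qed.

Lemma corep_antipoder n (m : 'M[H]_n) : corep m -> m *m map_mx antipode m = 1%:M.
Proof.
move=> [mD me]; apply/matrixP => i j; rewrite !mxE.
have hb : bilin (fun y z : H => y * antipode z).
  have := bilin_comp (@alg_mul_bilin k H) (@lin_id k H) (@antipode_linear k H) (@lin_id _ _).
  by apply.
have := antipoder (m i j); rewrite mD (linf_sum (tlift_linear hb)) me scaler_nat => <-.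
by apply: eq_bigr => l _; rewrite (tlift_pure _ _ hb) mxE.
Qed.

(* The matrix is that of the finite-dimensional subcomodule spanned by the     *)
(* translates [ract f x].                                                     *)
Lemma finiteness x : exists n (m : 'M[H]_n) (c d : 'I_n -> k),
  [/\ corep m, x = \sum_i \sum_j (c i * d j) *: m i j &
      forall Q, closed_sub Q -> Q x -> forall i j, Q (m i j)].
Proof.
have lc := @comul_linear k H; have li := @lin_id k H.
have [n [b [y [B [Y [hB hY xE]]]]]] := tensor_rank (comul x).
have lB i : linear (B i) := hB.1 i; have lY i : linear (Y i) := hY.1 i.
have bE j : b j = ract (Y j) x by rewrite /ract xE (dual_suml b j hY).
have bD j : comul (b j) = \sum_i b i ⊗ ract (Y j) (y i).
  apply: tensor_sepl => f lf.
  transitivity (ract (Y j) (lact f x)); first by rewrite -lact_ract // -bE.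
  rewrite {1}/lact xE.
  rewrite !(linf_sum (evall_linear lf)) (linf_sum (ract_linear (lY j))).
  by apply: eq_bigr => i _; rewrite !evall_pure // (linfZ (ract_linear (lY j))).
have mE i j : ract (Y j) (y i) = lact (B i) (b j).
  by rewrite /lact bD (dual_sumr _ i hB).
pose m : 'M[H]_n := \matrix_(i, j) ract (Y j) (y i).
have yE i : y i = lact (B i) x by rewrite /lact xE (dual_sumr y i hB).
exists n, m, (fun i => counit (b i)), (fun j => counit (y j)); split.
- split=> i j; rewrite mxE mE.
    have lL := lact_linear (lB i).
    apply: tensor_sepr => f lf; rewrite -/(ract f _) -lact_ract // {1}/ract bD.
    rewrite !(linf_sum (evalr_linear lf)) (linf_sum lL); apply: eq_bigr => l _.
    by rewrite !evalr_pure // (linfZ lL) !mxE (mE i l).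
  exact: etrans (counit_lact _ (lB i)) (hB.2 _ _).
- rewrite exchange_big /=; have hb := scale_bilin H (@counit_lin k H).
  rewrite -{1}[x]counitr xE (linf_sum (tlift_linear hb)); apply: eq_bigr => j _.
  rewrite (tlift_pure _ _ hb).
  have hb' := scale_bilin' H (@counit_lin k H).
  have {1}-> : b j = \sum_i counit (b i) *: m i j.
    rewrite -[LHS]counitl bD (linf_sum (tlift_linear hb')); apply: eq_bigr => i _.
    by rewrite (tlift_pure _ _ hb') mxE.
  by rewrite scaler_sumr; apply: eq_bigr => i _; rewrite scalerA mulrC.
- move=> Q [_ cQ] Qx i j; rewrite mxE yE.
  by case: (cQ _ (lY j) (lact (B i) x)) => //; case: (cQ _ (lB i) x).
Qed.

End Translates.

Section Coefficients.
Variables (k : fieldType) (H : hopfAlgType k).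
Implicit Types (V W : comod H) (D Q : H -> Prop).

Definition coeff V (f : V -> k^o) (v : V) : H := evall f (coact V v).
Definition act V (f : H -> k^o) (v : V) : V := evalr f (coact V v).

Definition coeffs_in V D : Prop := forall f : V -> k^o, linear f -> forall v, D (coeff f v).

(** The span of the coefficients, as an intersection of subspaces; it is used by instantiating
    [D]. *)
Definition coeff_space V (c : H) : Prop := forall D, subspace D -> coeffs_in V D -> D c.

Lemma coeff_space_sub V : subspace (coeff_space V).
Proof.
split=> [D [D0 _] _ //|c x y Vx Vy D hD VD].
by apply: hD.2; [apply: Vx | apply: Vy].
Qed.

Lemma coeffs_in_space V : coeffs_in V (coeff_space V).
Proof. by move=> f lf v D hD VD; apply: VD. Qed.

Lemma coeff_linear V (f : V -> k^o) : linear f -> linear (coeff f).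
Proof. by move=> lf; apply: lin_comp (evall_linear lf) (@coact_linear k H V). Qed.

Lemma act_linear V (f : H -> k^o) : linear f -> linear (@act V f).
Proof. by move=> lf; apply: lin_comp (evalr_linear lf) (@coact_linear k H V). Qed.

Lemma coeff_act V (f : V -> k^o) (g : H -> k^o) v : linear f -> linear g ->
  coeff f (act g v) = ract g (coeff f v).
Proof.
move=> lf lg; have lV := @coact_linear k H V; have li := @lin_id k H.
rewrite /coeff /act -(evalr_map _ lV li lg) evall_evalr // coactA.
by rewrite evall_map //; apply: comul_linear.
Qed.

Lemma coeff_actl V (f : V -> k^o) (g : H -> k^o) v : linear f -> linear g ->
  coeff (fun u => f (act g u)) v = lact g (coeff f v).
Proof.
move=> lf lg; have lV := @coact_linear k H V; have li := @lin_id k H.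
have lc := @comul_linear k H; have liV := @lin_id k V.
have lfg : linear (fun s : tensor V H => f (evalr g s) : k^o).
  exact: lin_comp lf (evalr_linear lg).
rewrite /lact /coeff -[comul _](evall_map _ liV lc lf) -coactA evall_evall //.
by rewrite evall_map.
Qed.

Lemma pairing_act V (f : V -> k^o) (g : H -> k^o) v : linear f -> linear g ->
  f (act g v) = g (coeff f v).
Proof. exact: eval_comm. Qed.

Lemma act_counit V v : act (@counit k H) v = v :> V.
Proof. exact: coact_counit. Qed.

Lemma counit_coeff V (f : V -> k^o) v : linear f -> (counit (coeff f v) : k^o) = f v.
Proof.
move=> lf; rewrite -(@pairing_act V f (@counit k H)) //; last exact: counit_lin.
by rewrite act_counit.
Qed.

Lemma coact_sep V v (t : V ⊗ H) :
  (forall f : H -> k^o, linear f -> act f v = evalr f t) -> coact V v = t.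
Proof. by move=> E; apply: tensor_sepr. Qed.

Section Basis.
Variable V : comod H.
Let e := vbasis {:V}.
Let ebasis : basis_of {:V} e := vbasisP _.

Definition bcoord (i : 'I_(\dim {:V})) : V -> k^o := coord e i.

Lemma bcoord_linear i : linear (bcoord i).
Proof. by move=> c x y; rewrite /bcoord linearP. Qed.

Lemma bcoordE v : v = \sum_(i < \dim {:V}) bcoord i v *: e`_i.
Proof. exact: coord_basis ebasis (memvf v). Qed.

Lemma tensor_basis (W : lmodType k) (t : V ⊗ W) : t = \sum_(i < \dim {:V}) e`_i ⊗ evall (bcoord i) t.
Proof.
apply: tensor_sepl => f lf; rewrite (linf_sum (evall_linear lf)).
have fE v : f v = \sum_(i < \dim {:V}) (bcoord i v : k) *: f e`_i.
  by rewrite {1}[v]bcoordE (linf_sum lf); apply: eq_bigr => i _; rewrite (linfZ lf).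
transitivity (\sum_(i < \dim {:V}) (f e`_i : k) *: evall (bcoord i) t); last first.
  by apply: eq_bigr => i _; rewrite evall_pure.
move: t; apply: tensor_linext.
- exact: evall_linear.
- apply: lin_sumf => i c x y.
  by rewrite (evall_linear (bcoord_linear i)) scalerDr !scalerA mulrC.
move=> v w; rewrite evall_pure // fE scaler_suml; apply: eq_bigr => i _.
by rewrite evall_pure ?scalerA 1?mulrC //; apply: bcoord_linear.
Qed.

Lemma coact_basis v : coact V v = \sum_(i < \dim {:V}) e`_i ⊗ coeff (bcoord i) v.
Proof. exact: tensor_basis. Qed.

Lemma act_basis f v : linear f -> act f v = \sum_(i < \dim {:V}) (f (coeff (bcoord i) v) : k) *: e`_i.
Proof.
move=> lf; rewrite /act coact_basis (linf_sum (evalr_linear lf)).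
by apply: eq_bigr => i _; rewrite evalr_pure.
Qed.

Lemma comul_coeff f v : linear f ->
  comul (coeff f v) = \sum_(i < \dim {:V}) coeff f e`_i ⊗ coeff (bcoord i) v.
Proof.
move=> lf; apply: tensor_sepr => g lg; rewrite -/(ract g _) -coeff_act // act_basis //.
rewrite (linf_sum (coeff_linear lf)) (linf_sum (evalr_linear lg)).
by apply: eq_bigr => i _; rewrite (linfZ (coeff_linear lf)) evalr_pure.
Qed.

Lemma coeff_antipoder f v : linear f ->
  \sum_(i < \dim {:V}) coeff f e`_i * antipode (coeff (bcoord i) v) = (f v : k)%:A.
Proof.
move=> lf; have hb : bilin (fun y z : H => y * antipode z).
  have := bilin_comp (@alg_mul_bilin k H) (@lin_id k H) (@antipode_linear k H) (@lin_id _ _).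
  by apply.
rewrite -(counit_coeff v lf) -[RHS]antipoder comul_coeff // (linf_sum (tlift_linear hb)).
by apply: eq_bigr => i _; rewrite (tlift_pure _ _ hb).
Qed.

End Basis.

Lemma coeffs_in_mono V D D' : (forall c, D c -> D' c) -> coeffs_in V D -> coeffs_in V D'.
Proof. by move=> le VD f lf v; apply/le/VD. Qed.

Lemma coeffs_in_iso V W D : comod_iso V W -> coeffs_in V D <-> coeffs_in W D.
Proof.
move=> [h [[lh hE] [h' hK h'K]]].
have cE f v : linear f -> coeff f (h v) = coeff (fun u => f (h u)) v.
  by move=> lf; rewrite /coeff hE evall_map.
split=> VD f lf v.
  by rewrite -[v]h'K cE //; apply: VD; apply: lin_comp lf lh.
have lh' : linear h' by move=> c x y; rewrite -[LHS]hK /= -[x]h'K -[y]h'K -lh !hK.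
have -> : f = fun u => f (h' (h u)) by apply: funext => u; rewrite hK.
have lf' : linear (fun w => f (h' w) : k^o) by exact: lin_comp lf lh'.
by rewrite -(cE _ _ lf'); apply: VD.
Qed.

Lemma coeffs_in_dsum V W D : subspace D ->
  coeffs_in (dsum_comod V W) D <-> coeffs_in V D /\ coeffs_in W D.
Proof.
move=> hD; have li := @lin_id k H.
have linl := @dsum_inl_linear k H V W; have linr := @dsum_inr_linear k H V W.
split=> [VD|[VD WD] f lf v]; [split=> f lf v|].
- pose f' (x : V * W) : k^o := f x.1.
  have lf' : linear f' by move=> c x y; rewrite /f' lf.
  have := VD f' lf' (@dsum_inl k H V W v); rewrite /coeff /= dsum_coact_inl.
  by rewrite evall_map.
- pose f' (x : V * W) : k^o := f x.2.
  have lf' : linear f' by move=> c x y; rewrite /f' lf.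
  have := VD f' lf' (@dsum_inr k H V W v); rewrite /coeff /= dsum_coact_inr.
  by rewrite evall_map.
rewrite /coeff /= /dsum_coact (linfD (evall_linear lf)) !evall_map //.
by apply: subspaceD => //; [apply: VD | apply: WD]; apply: lin_comp lf _.
Qed.

Lemma coeffs_in_dsums (T : eqType) (a : T -> comod H) (s : seq T) D : subspace D ->
  coeffs_in (dsums (map a s)) D <-> forall x, x \in s -> coeffs_in (a x) D.
Proof.
move=> hD; elim: s => [|y s IH] /=.
  split=> // _ f lf v; rewrite /coeff [coact _ _]/= (linf0 (evall_linear lf)).
  exact: subspace0.
rewrite coeffs_in_dsum //; split=> [[aD /IH sD] x|aD].
  by rewrite inE => /predU1P[->//|]; apply: sD.
split; first by apply: aD; rewrite mem_head.
by apply/IH => x xs; apply: aD; rewrite inE xs orbT.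
Qed.

(** The functional [f ⊗ g] at [v ⊗ w] yields [coeff f v * coeff g w], and such products span all
    coefficients. With [D] arbitrary, fusion rules become closure properties of subspaces. *)
Lemma coeffs_in_tens V W D : subspace D ->
  coeffs_in (ctens V W) D <->
  forall c d, coeff_space V c -> coeff_space W d -> D (c * d).
Proof.
move=> hD; have hm := @alg_mul_bilin k H; split=> VD.
  move=> c d Vc Wd; apply: (Wd (fun d => D (c * d))).
    split=> [|u x y Dx Dy]; first by rewrite mulr0; apply: subspace0.
    by rewrite mulrDr -scalerAr; apply: hD.2.
  move=> g lg w; apply: (Vc (fun c => D (c * coeff g w))) => [|f lf v].
    split=> [|u x y Dx Dy]; first by rewrite mul0r; apply: subspace0.
    by rewrite mulrDl -scalerAl; apply: hD.2.
  have hfg : bilin (fun (v : V) (w : W) => (f v : k) *: g w).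
    exact: bilin_comp (@triv_scale_bilin1 k) lf lg (@lin_id _ _).
  pose F : (V ⊗ W)%type -> k^o := tlift (fun (v : V) (w : W) => (f v : k) *: g w).
  have lF : linear F := tlift_linear hfg.
  have := VD F lF (v ⊗ w); rewrite /coeff /= ctens_coact_pure.
  suff -> : forall (s : V ⊗ H) (t : W ⊗ H),
      evall F (tens_legs *%R s t) = evall f s * evall g t by [].
  apply: (@tens_legs_ext k V W H H (fun s t => evall F (tens_legs *%R s t))
            (fun s t => evall f s * evall g t)).
  - have := bilin_comp (tens_legs_bilin V W hm) (@lin_id k (tensor V H)) (@lin_id k (tensor W H))
              (evall_linear lF).
    by apply.
  - by have := bilin_comp hm (evall_linear lf) (evall_linear lg) (@lin_id k H); apply.
  move=> u h w' h'; rewrite tens_legs_pure // !evall_pure // /F tlift_pure //.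
  by rewrite -scalerAl -scalerAr scalerA.
move=> f lf t.
rewrite (tensorE t) (linf_sum (coeff_linear (lf : linear (f : ctens V W -> k^o)))).
apply: subspace_sum => // -[v w] /=; rewrite /coeff /= ctens_coact_pure !coact_basis.
rewrite (linf_sum (tens_legs_linear1 hm _)) (linf_sum (evall_linear lf)).
apply: subspace_sum => // i; rewrite (linf_sum (tens_legs_linear2 hm _)).
rewrite (linf_sum (evall_linear lf)); apply: subspace_sum => // j.
rewrite tens_legs_pure // evall_pure //; apply: subspaceZ => //.
by apply: VD; apply: coeffs_in_space; apply: bcoord_linear.
Qed.

Lemma coeffs_in_dual V D : subspace D ->
  coeffs_in (dual_comod V) D <-> forall c, coeff_space V c -> D (antipode c).
Proof.
move=> hD; have lS := @antipode_linear k H; split=> VD.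
  move=> c Vc; apply: (Vc (fun c => D (antipode c))).
    split=> [|u x y Dx Dy]; first by rewrite (linf0 lS); apply: subspace0.
    by rewrite lS; apply: hD.2.
  move=> f lf v; pose F (g : 'Hom(V, k^o)) : k^o := g v.
  have lF : linear F by move=> c' x y; rewrite /F !lfunE /= lfunE.
  pose fl : {linear V -> k^o} := HB.pack f (GRing.isLinear.Build k V k^o *:%R f lf).
  have := VD F lF (linfun fl); rewrite /coeff /= /dual_coact.
  rewrite (linf_sum (evall_linear lF)).
  suff -> : \sum_i evall F (dual_vec i ⊗ antipode (contract (linfun fl) (coact V (vbasis {:V})`_i)))
     = antipode (coeff f v) by [].
  rewrite {1}[v]bcoordE (linf_sum (coeff_linear lf)) (linf_sum lS).
  apply: eq_bigr => i _; rewrite evall_pure // (linfZ (coeff_linear lf)) (linfZ lS).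
  rewrite /F /dual_vec lfunE; congr (_ *: antipode _); rewrite /contract /coeff.
  by congr (evall _ _); apply: funext => u; rewrite lfunE.
move=> F lF f; rewrite /coeff /= /dual_coact (linf_sum (evall_linear lF)).
apply: subspace_sum => // i; rewrite evall_pure //; apply: subspaceZ => //.
by apply: VD; apply: (coeffs_in_space (f := f)) => c x y; rewrite linearP.
Qed.

Lemma coeffs_in_triv D : subspace D -> coeffs_in (triv_comod H) D <-> D 1.
Proof.
move=> hD; split=> [TD|D1 f lf v].
  by have := TD idfun (@lin_id _ _) 1; rewrite /coeff /= evall_pure // scale1r.
by rewrite /coeff /= evall_pure //; apply: subspaceZ.
Qed.

End Coefficients.

Section MatrixComodule.
Variables (k : fieldType) (H : hopfAlgType k) (n : nat) (m : 'M[H]_n).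
Hypothesis mP : corep m.
Local Notation rV := 'rV[k]_n.

Definition mx_coact (v : rV) : rV ⊗ H :=
  \sum_j v 0 j *: \sum_i (delta_mx 0 i : rV) ⊗ m i j.

Lemma mx_coact_linear : linear mx_coact.
Proof. by apply: lin_sumf => j c x y; rewrite !mxE scalerDl scalerA. Qed.

Lemma mx_coact_delta j : mx_coact (delta_mx 0 j) = \sum_i (delta_mx 0 i : rV) ⊗ m i j.
Proof.
rewrite /mx_coact (bigD1 j) //= mxE !eqxx scale1r [X in _ + X]big1 ?addr0 // => l /negbTE lj.
by rewrite mxE lj andbF scale0r.
Qed.

Lemma rV_linext (W : lmodType k) (f g : rV -> W) : linear f -> linear g ->
  (forall j, f (delta_mx 0 j) = g (delta_mx 0 j)) -> f =1 g.
Proof.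
move=> lf lg E v; rewrite [v]row_sum_delta (linf_sum lf) (linf_sum lg).
by apply: eq_bigr => j _; rewrite (linfZ lf) (linfZ lg) E.
Qed.

Lemma mx_coactA v :
  tassoc (tmap mx_coact idfun (mx_coact v)) = tmap idfun (@comul k H) (mx_coact v).
Proof.
have lm := mx_coact_linear; have lc := @comul_linear k H.
have lmi := tmap_linear lm (@lin_id _ H); have lic := tmap_linear (@lin_id _ rV) lc.
move: v; apply: rV_linext.
- by apply: lin_comp (@tassoc_linear _ _ _ _) _; apply: lin_comp lmi lm.
- exact: lin_comp lic lm.
move=> j; rewrite mx_coact_delta (linf_sum lmi) (linf_sum lic) (linf_sum (@tassoc_linear _ _ _ _)).
transitivity (\sum_i \sum_l (delta_mx 0 l : rV) ⊗ (m l i ⊗ m i j)).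
  apply: eq_bigr => i _; rewrite tmap_pure // mx_coact_delta (linf_sum (lin_pure1 _)).
  by rewrite (linf_sum (@tassoc_linear _ _ _ _)); apply: eq_bigr => l _; rewrite tassoc_pure.
rewrite exchange_big; apply: eq_bigr => l _ /=.
by rewrite tmap_pure // mP.1 (linf_sum (lin_pure2 _)).
Qed.

Lemma mx_coact_counit v :
  tlift (fun (w : rV) (h : H) => counit h *: w) (mx_coact v) = v.
Proof.
have hb := scale_bilin rV (@counit_lin k H).
move: v; apply: rV_linext => //.
  exact: lin_comp (tlift_linear hb) mx_coact_linear.
move=> j; rewrite mx_coact_delta (linf_sum (tlift_linear hb)) (bigD1 j) //=.
rewrite (tlift_pure _ _ hb) mP.2 eqxx scale1r big1 ?addr0 // => i /negbTE ij.
by rewrite (tlift_pure _ _ hb) mP.2 ij scale0r.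
Qed.

Definition mx_comod : comod H := Comod mx_coact_linear mx_coactA mx_coact_counit.

Lemma coeffs_in_mx D : subspace D ->
  coeffs_in mx_comod D <-> forall i j, D (m i j).
Proof.
move=> hD; split=> [mD i j|mD f lf v].
  have lf : linear (fun v : rV => v 0 i : k^o) by move=> c x y; rewrite !mxE.
  have := mD _ lf (delta_mx 0 j); rewrite /coeff /= mx_coact_delta.
  rewrite (linf_sum (evall_linear lf)) (bigD1 i) //= evall_pure // mxE !eqxx scale1r.
  rewrite big1 ?addr0 // => l /negbTE li.
  by rewrite evall_pure // mxE eqxx eq_sym li scale0r.
rewrite /coeff /= /mx_coact (linf_sum (evall_linear lf)).
apply: subspace_sum => // j; rewrite (linfZ (evall_linear lf)); apply: subspaceZ => //.
rewrite (linf_sum (evall_linear lf)); apply: subspace_sum => // i.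
by rewrite evall_pure //; apply: subspaceZ.
Qed.

End MatrixComodule.

(** Peter-Weyl decomposition relative to a subcoalgebra [Q]: by [finiteness], [x] is a combination
    of coefficients of a finite-dimensional comodule with coefficients in [Q], and that comodule is
    a sum of simple ones. *)
Lemma cosemisimple_ind (k : fieldType) (H : hopfAlgType k) (Q D : H -> Prop) x :
    cosemisimple H -> closed_sub Q -> Q x -> subspace D ->
    (forall S : comod H, simple_comod S -> coeffs_in S Q -> coeffs_in S D) -> D x.
Proof.
move=> ssH cQ Qx hD SD; have [n [m [c [d [mP xE mQ]]]]] := finiteness x.
have [p [S [simS iso]]] := ssH (mx_comod mP).
have /(coeffs_in_iso _ iso)/(coeffs_in_dsums _ _ cQ.1) SQ : coeffs_in (mx_comod mP) Q.
  by apply/(coeffs_in_mx _ cQ.1); apply: mQ.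
have /(coeffs_in_dsums _ _ hD)/(coeffs_in_iso _ iso)/(coeffs_in_mx _ hD) mD :
    forall i, i \in enum 'I_p -> coeffs_in (S i) D.
  by move=> i ip; apply: SD => //; apply: SQ.
rewrite xE; apply: subspace_sum => // i; apply: subspace_sum => // j.
exact: subspaceZ.
Qed.

(** * Simple comodules, the Haar functional and Hopf kernels *)

Section SimpleComodules.
Variables (k : fieldType) (H : hopfAlgType k).

(** Take [U] of largest dimension inside [D]; a vector of [D] outside [U] would enlarge it. This
    makes predicates usable with [simple_comod], which quantifies over [{vspace V}]. *)
Lemma subspace_vspace (V : vectType k) (D : V -> Prop) : subspace D ->
  exists U : {vspace V}, forall v, v \in U <-> D v.
Proof.
move=> hD; pose P n := `[< exists2 U : {vspace V}, (forall v, v \in U -> D v) & \dim U = n >].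
have P0 : exists n, P n.
  exists 0; apply/asboolP; exists 0%VS; last exact: dimv0.
  by move=> v /[!memv0]/eqP->; apply: subspace0.
have Pmax n : P n -> (n <= \dim {:V})%N.
  by move=> /asboolP[U _ <-]; apply: dimvS; apply: subvf.
case: (ex_maxnP P0 Pmax) => n /asboolP[U UD dU] maxn; exists U => v; split; first exact: UD.
move=> Dv; apply: contrapT => /negP nU.
have lt : (\dim U < \dim (U + <[v]>)%VS)%N.
  rewrite ltnNge; apply: contra nU => le.
  have /eqP -> : U == (U + <[v]>)%VS by rewrite -(geq_leqif (dimv_leqif_eq (addvSl _ _))).
  by apply: subvP (memv_line v); apply: addvSr.
suff /maxn : P (\dim (U + <[v]>)%VS) by rewrite -dU leqNgt lt.
apply/asboolP; exists (U + <[v]>)%VS => // _ /memv_addP[u uU [_ /vlineP[c ->] ->]].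
by apply: subspaceD => //; [apply: UD | apply: subspaceZ].
Qed.

(** Stability under every [act f] is the slice form of being a subcomodule. *)
Lemma simple_stable (V : comod H) (D : V -> Prop) v : simple_comod V -> subspace D ->
    (forall f, linear f -> forall u, D u -> D (act f u)) -> D v -> v != 0 ->
  forall u, D u.
Proof.
move=> [_ simV] hD stD Dv v0 u; have [U UD] := subspace_vspace hD.
have lp : linear (vsproj U : V -> subvs_of U) by move=> c x y; rewrite linearP.
have lv : linear (vsval : subvs_of U -> V) by move=> c x y; rewrite linearP.
have li := @lin_id k H.
case: (simV U) => [w /UD Dw|U0|Uf].
- exists (tmap (vsproj U : V -> subvs_of U) idfun (coact V w)).
  rewrite tmap_comp //; apply: coact_sep => f lf.
  rewrite evalr_map //; last exact: lin_comp lv lp.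
  by rewrite vsprojK //; apply/UD/stD.
- by move/UD: Dv v0; rewrite U0 memv0 => ->.
- by apply/UD; rewrite Uf memvf.
Qed.

Definition coinvariant (V : comod H) (w : V) : Prop :=
  forall f : H -> k^o, linear f -> act f w = (f 1 : k) *: w.

Lemma simple_coinvariant_line (V : comod H) (w : V) : simple_comod V -> coinvariant w ->
  w != 0 -> forall v, exists c : k, v = c *: w.
Proof.
move=> simV hw w0.
have hD : subspace (fun v => exists c : k, v = c *: w).
  split=> [|c _ _ [a ->] [b ->]]; first by exists 0; rewrite scale0r.
  by exists (c * a + b); rewrite scalerDl scalerA.
apply: (simple_stable simV hD _ _ w0) => [f lf _ [c ->]|].
  by exists (c * f 1); rewrite (linfZ (act_linear lf)) hw // scalerA.
by exists 1; rewrite scale1r.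
Qed.

Lemma simple_coinvariant_triv (V : comod H) (w : V) : simple_comod V -> coinvariant w ->
  w != 0 -> comod_iso V (triv_comod H).
Proof.
move=> simV hw w0; have line := simple_coinvariant_line simV hw w0.
have [f fE] : {f : V -> k^o | forall v, v = (f v : k) *: w}.
  by have [f fE] := choice line; exists f.
have inj c d : c *: w = d *: w -> c = d.
  by move/eqP; rewrite -subr_eq0 -scalerBl scaler_eq0 (negbTE w0) orbF subr_eq0 => /eqP.
have lf : linear f.
  by move=> c x y; apply: inj; rewrite -fE scalerDl -scalerA -!fE.
exists f; split; last first.
  by exists (fun c => c *: w) => [v|c]; [rewrite -fE | apply: inj; rewrite -fE].
split=> // v; apply: tensor_sepr => g lg; rewrite /= /triv_coact evalr_pure //.
rewrite evalr_map // -/(act g v); apply: inj; rewrite -fE {2}(fE v) (linfZ (act_linear lg)) hw //.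
by rewrite scalerA; congr (_ *: _); apply: mulrC.
Qed.

(** The kernel of [F] is a proper subcomodule, so [F] is injective; it kills [act f w - f(1) w]. *)
Lemma simple_invariant_functional (V : comod H) (F : V -> k^o) (v : V) :
    simple_comod V -> linear F ->
    (forall f, linear f -> forall u, F (act f u) = f 1 * F u) -> F v != 0 ->
  exists w : V, F w = 1 /\ coinvariant w.
Proof.
move=> simV lF hF Fv; have [w Fw] : exists w, F w = 1.
  by exists ((F v)^-1 *: v); rewrite (linfZ lF); apply: mulVf.
have hD : subspace (fun u => F u = 0).
  by split=> [|c x y Fx Fy]; [apply: linf0 lF | rewrite lF Fx Fy scaler0 addr0].
have FK u : F u = 0 -> u = 0.
  move=> Fu; apply/eqP/negP => /negP u0.
  have Fall : forall u', F u' = 0.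
    apply: (simple_stable simV hD _ Fu u0) => f lf u' Fu'.
    by rewrite hF // Fu' mulr0.
  by rewrite Fall eqxx in Fv.
exists w; split=> // f lf; apply/eqP; rewrite -subr_eq0; apply/eqP/FK.
rewrite (linfD lF) -scaleN1r !(linfZ lF) hF // Fw; rewrite /GRing.scale /= mulr1 mulN1r.
exact: subrr.
Qed.

End SimpleComodules.

(** * Existence of the Haar functional *)

Section Haar.
Variables (k : fieldType) (H : hopfAlgType k).
Hypothesis ssH : cosemisimple H.

Definition haar (h : H -> k^o) : Prop :=
  [/\ linear h, h 1 = 1 & forall x, ract h x = (h x : k) *: 1].

(** Let [M] be a maximal subspace stable under all [ract f] and avoiding 1. Then [H = M + k 1], and
    [h] is the projection along [M]; it satisfies [h(x_1) x_2 = h(x) 1]. *)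
Let left_haar_ex : exists h : H -> k^o,
  [/\ linear h, h 1 = 1 & forall f, linear f -> forall x, h (ract f x) = f 1 * h x].
Proof.
pose A (a : H -> H) := exists2 f : H -> k^o, linear f & a = ract f.
have h0 : subspace (fun x : H => x = 0) by split=> // c _ _ -> ->; rewrite scaler0 addr0.
have st0 a x : A a -> x = 0 -> a x = 0.
  by move=> [f lf ->] ->; apply: linf0 (ract_linear lf).
have H1 : (1 : H) <> 0.
  by move=> /(congr1 (@counit k H)); rewrite linear0 rmorph1 => /eqP; rewrite oner_eq0.
have [M [hM stM _ M1 maxM]] := maximal_stable h0 st0 H1.
have stM' f x : linear f -> M x -> M (ract f x) by move=> lf; apply: stM; exists f.
pose D x := exists c : k, M (x - c *: 1).
have hD : subspace D.
  split=> [|c x y [a Ma] [b Mb]]; first by exists 0; rewrite scale0r subr0; apply: subspace0.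
  exists (c * a + b); rewrite scalerDl -scalerA opprD addrACA -scalerBr.
  exact: hM.2.
have stD f x : linear f -> D x -> D (ract f x).
  move=> lf [c Mx]; exists (c * f 1); have := stM' f _ lf Mx; have lr := ract_linear lf.
  by rewrite (linfD lr) -scaleN1r !(linfZ lr) ract1 // scaleN1r scalerA.
have MD x : M x -> D x by exists 0; rewrite scale0r subr0.
have allD x : D x.
  apply: (@cosemisimple_ind k H (fun _ => True)) => // S simS _ f lf v.
  have [Mf|/existsNP[s0 nM]] := pselect (forall s, M (coeff f s)); first exact/MD/Mf.
  (* If [coeff f] does not map [S] into [M], then [M + coeff f (S)] is stable and larger than [M],
     so it contains 1. The vectors [s] with [coeff f s] in [M + k 1] then form a nonzero
     subcomodule, hence all of [S]. *)
  have hM' : subspace (fun y => exists m s, M m /\ y = m + coeff f s).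
    split=> [|c _ _ [m [s [Mm ->]]] [m' [s' [Mm' ->]]]].
      exists 0, 0; rewrite (linf0 (coeff_linear lf)) addr0; split=> //.
      exact: subspace0.
    exists (c *: m + m'), (c *: s + s'); split; first exact: hM.2.
    by rewrite (coeff_linear lf) scalerDr addrACA.
  have stM'' a y : A a -> (exists m s, M m /\ y = m + coeff f s) ->
      exists m s, M m /\ a y = m + coeff f s.
    move=> [g lg ->] [m [s [Mm ->]]]; exists (ract g m), (act g s).
    by split; [apply: stM' | rewrite (linfD (ract_linear lg)) coeff_act].
  have leM' y : M y -> exists m s, M m /\ y = m + coeff f s.
    by exists y, 0; rewrite (linf0 (coeff_linear lf)) addr0.
  have M's0 : exists m s, M m /\ coeff f s0 = m + coeff f s.
    by exists 0, s0; rewrite add0r; split=> //; apply: subspace0.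
  have [m [s [Mm E1]]] := maxM _ hM' stM'' leM' _ nM M's0.
  have s_neq0 : s != 0.
    by apply: contra_notN M1 => /eqP s0'; rewrite E1 s0' (linf0 (coeff_linear lf)) addr0.
  apply: (@simple_stable k H S (fun s => D (coeff f s)) s) => //.
  - split; first by rewrite (linf0 (coeff_linear lf)); apply: subspace0.
    by move=> c y z Dy Dz; rewrite (coeff_linear lf); apply: hD.2.
  - by move=> g lg u Du; rewrite coeff_act //; apply: stD.
  - exists 1; rewrite scale1r E1 opprD addrCA subrr addr0 -scaleN1r.
    exact: subspaceZ.
have [h [lh hM0 h1]] := separating_functional hM M1.
exists h; split=> // f lf x; have [c Mx] := allD x.
have lr := ract_linear lf; have hx : h x = c.
  have := hM0 _ Mx; rewrite (linfD lh) -scaleN1r !(linfZ lh) h1 => /eqP.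
  by rewrite scaleN1r subr_eq0 => /eqP->; apply: mulr1.
have := hM0 _ (stM' f _ lf Mx).
rewrite (linfD lr) -scaleN1r !(linfZ lr) ract1 // (linfD lh) !(linfZ lh) h1 hx => /eqP.
rewrite scaleN1r subr_eq0 => /eqP->; rewrite -[RHS]mulrC; congr (_ * _).
exact: mulr1.
Qed.

(** The functional above is invariant on one side, and [g] measures its defect on the other. On a
    simple comodule [g] gives an invariant functional; were it nonzero, there would be a coinvariant
    vector on which it is 1. The coefficients of such a vector are scalars, and [g 1 = 0]. *)
Lemma haar_ex : exists h, haar h.
Proof.
have [h [lh h1 hinv]] := left_haar_ex; exists h; split=> // x.
apply: functional_sep => f lf; rewrite pairing // (linfZ lf).
pose g y : k^o := h (lact f y) - f 1 * h y.
have lg : linear g.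
  move=> c y z; rewrite /g (lact_linear lf) !lh mulrDr opprD scalerBr addrACA.
  by congr (_ - _ + _); apply: mulrCA.
suff gx : g x = 0.
  apply/eqP; rewrite -subr_eq0; apply/eqP; rewrite -[RHS]gx /g; congr (_ - _).
  exact: mulrC.
apply: (@cosemisimple_ind k H (fun _ => True) (fun y => g y = 0)) => //.
  by split=> [|c y z gy gz]; [apply: linf0 lg | rewrite lg gy gz scaler0 addr0].
move=> S simS _ F lF v; apply/eqP/negP => /negP nz.
have lgF : linear (fun u => g (coeff F u) : k^o) by exact: lin_comp lg (coeff_linear lF).
have gFinv e : linear e -> forall u, g (coeff F (act e u)) = e 1 * g (coeff F u).
  move=> le u; rewrite coeff_act // /g lact_ract // !hinv // mulrBr.
  by rewrite [f 1 * _]mulrCA.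
have [w [gw cow]] := simple_invariant_functional simS lgF gFinv nz.
have : coeff F w = (counit (coeff F w) : k) *: 1.
  apply: ract_invariant_scalar => e le.
  by rewrite -coeff_act // cow // (linfZ (coeff_linear lF)).
move=> wE; move: gw; rewrite wE (linfZ lg) /g lact1 // (linfZ lh) h1.
by rewrite /GRing.scale /= mulr1 subrr mulr0 => /esym/eqP; rewrite oner_eq0.
Qed.

End Haar.

Section Nondegeneracy.
Variables (k : fieldType) (H : hopfAlgType k) (h : H -> k^o).
Hypothesis haarh : haar h.

Lemma evalr_mul (f : H -> k^o) (a b : H) (t : H ⊗ H) : linear f ->
  evalr f ((a ⊗ b) * t) = a * evalr (fun c => f (b * c)) t.
Proof.
move=> lf; have lb : linear (fun c => f (b * c) : k^o) by exact: lin_comp lf (@lin_mull _ _ _).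
move: t; apply: tensor_linext.
- exact: lin_comp (evalr_linear lf) (tens_mulr_linear _).
- exact: lin_comp (@lin_mull _ _ _) (evalr_linear lb).
by move=> c d; rewrite [(_ * _ : tensor H H)]tens_mul_pure !evalr_pure // scalerAr.
Qed.

(* [b_1 h(a b_2) = S(a_1) h(a_2 b)] makes the right-hand radical a left coideal. *)
Lemma haar_nondegenerate (b : H) : (forall a, h (a * b) = 0) -> b = 0.
Proof.
case: haarh => lh h1 hinv; pose J x := forall a, h (a * x) = 0.
have lm a : linear (fun c => h (a * c) : k^o) by exact: lin_comp lh (@lin_mull _ _ _).
have J_ract a x : J x -> ract (fun c => h (a * c)) x = 0.
  move=> Jx; have [n [m [c [d [mP aE _]]]]] := finiteness a.
  pose G : 'M[H]_n := \matrix_(i, j) ract (fun y => h (m i j * y)) x.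
  have mG : m *m G = 0.
    apply/matrixP => i j; rewrite !mxE.
    transitivity (ract h (m i j * x)); last by rewrite hinv Jx scale0r.
    rewrite /ract (@comul_monoid k H).2 mP.1 mulr_suml (linf_sum (evalr_linear lh)).
    by apply: eq_bigr => s _; rewrite evalr_mul // mxE.
  have G0 : G = 0 by rewrite -[G]mul1mx -(corep_antipodel mP) -mulmxA mG mulmx0.
  have -> : ract (fun y => h (a * y)) x = \sum_i \sum_j (c i * d j) *: G i j.
    apply: functional_sep => f lf; rewrite pairing // {1}aE mulr_suml (linf_sum lh).
    rewrite (linf_sum lf); apply: eq_bigr => i _; rewrite mulr_suml (linf_sum lh).
    rewrite (linf_sum lf); apply: eq_bigr => j _.
    rewrite -scalerAl (linfZ lh) (linfZ lf) mxE; congr (_ *: _); symmetry.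
    exact: (@pairing _ _ f (fun y => h (m i j * y))).
  by rewrite big1 // => i _; rewrite big1 // => j _; rewrite G0 mxE scaler0.
have J_lact f x : linear f -> J x -> J (lact f x).
  move=> lf Jx a; rewrite -[RHS](linf0 lf) -(J_ract a x Jx); symmetry.
  exact: (@pairing _ _ f (fun y => h (a * y))).
(* [counit x] equals [h(S(x_1) x_2)], and the legs [x_2] stay in the radical [J]. *)
have J_counit x : J x -> counit x = 0.
  move=> Jx; have [n [u [y [B [Y [hB _ xE]]]]]] := tensor_rank (comul x).
  have Jy i : J (y i).
    have -> : y i = lact (B i) x by rewrite /lact xE (dual_sumr y i hB).
    by apply: J_lact => //; apply: hB.1.
  have hb : bilin (fun y z : H => antipode y * z).
    have := bilin_comp (@alg_mul_bilin k H) (@antipode_linear k H) (@lin_id k H) (@lin_id _ _).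
    by apply.
  have /(congr1 h) := antipodel x; rewrite xE (linf_sum (tlift_linear hb)).
  rewrite (linf_sum lh) (linfZ lh) h1 big1 => [/esym E|i _].
    by rewrite -E; apply/esym/mulr1.
  by rewrite (tlift_pure _ _ hb); apply: Jy.
move=> Jb; apply: functional_sep => f lf.
by rewrite -(counit_lact b lf) (linf0 lf); apply: J_counit; apply: J_lact.
Qed.

End Nondegeneracy.

(** * Hopf maps and their kernels *)

Section HopfMaps.
Variables (k : fieldType) (H K : hopfAlgType k) (p : H -> K).
Hypothesis hp : hopf_map p.

Let lp : linear p. Proof. by case: hp. Qed.

Lemma ract_map f x : linear f -> ract f (p x) = p (ract (fun y => f (p y)) x).
Proof. by move=> lf; case: hp => _ _ pD _; rewrite /ract pD evalr_map. Qed.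

Lemma lact_map f x : linear f -> lact f (p x) = p (lact (fun y => f (p y)) x).
Proof. by move=> lf; case: hp => _ _ pD _; rewrite /lact pD evall_map. Qed.

Lemma corep_map n (m : 'M[H]_n) : corep m -> corep (map_mx p m).
Proof.
move=> [mD me]; case: hp => _ _ pD pe; split=> i j; rewrite mxE; last by rewrite pe me.
rewrite pD mD (linf_sum (tmap_linear lp lp)); apply: eq_bigr => l _.
by rewrite tmap_pure // !mxE.
Qed.

(** Both sides give the inverse of the corepresentation [map_mx p m], which is unique. *)
Lemma hopf_map_antipode x : p (antipode x) = antipode (p x).
Proof.
have [n [m [c [d [mP xE _]]]]] := finiteness x; case: hp => _ [p1 pM] _ _.
suff E : map_mx p (map_mx antipode m) = map_mx antipode (map_mx p m).
  rewrite xE !(linf_sum (@antipode_linear k H)) !(linf_sum lp) (linf_sum (@antipode_linear k K)).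
  apply: eq_bigr => i _.
  rewrite (linf_sum (@antipode_linear k H)) !(linf_sum lp) (linf_sum (@antipode_linear k K)).
  apply: eq_bigr => j _.
  rewrite (linfZ (@antipode_linear k H)) !(linfZ lp) (linfZ (@antipode_linear k K)).
  by have := congr1 (fun M : 'M[K]_n => M i j) E; rewrite !mxE => ->.
have inv : map_mx p (map_mx antipode m) *m map_mx p m = 1%:M.
  apply/matrixP => i j; have := congr1 (fun M : 'M[H]_n => p (M i j)) (corep_antipodel mP).
  rewrite !mxE (linf_sum lp) => E; transitivity (p (i == j)%:R).
    by rewrite -E; apply: eq_bigr => l _; rewrite !mxE pM.
  by case: (i == j); [apply: p1 | apply: linf0 lp].
by rewrite -[LHS]mulmx1 -(corep_antipoder (corep_map mP)) mulmxA inv mul1mx.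
Qed.

Lemma right_hkerP x :
  right_hker p x <-> forall f, linear f -> ract (fun y => f (p y)) x = (f 1 : k) *: x.
Proof.
have li := @lin_id k H; split=> [E f lf|E].
  by have /(congr1 (evalr f)) := E; rewrite evalr_map // evalr_pure.
by apply: tensor_sepr => f lf; rewrite evalr_map // evalr_pure //; apply: E.
Qed.

Lemma left_hkerP x :
  left_hker p x <-> forall f, linear f -> lact (fun y => f (p y)) x = (f 1 : k) *: x.
Proof.
have li := @lin_id k H; split=> [E f lf|E].
  by have /(congr1 (evall f)) := E; rewrite evall_map // evall_pure.
by apply: tensor_sepl => f lf; rewrite evall_map // evall_pure //; apply: E.
Qed.

Definition trivial_on (x : H) : Prop := p x = (counit x : k) *: 1.

Lemma trivial_on_sub : subspace trivial_on.
Proof.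
split=> [|c x y tx ty]; first by rewrite /trivial_on (linf0 lp) linear0 scale0r.
by rewrite /trivial_on lp tx ty linearP scalerDl scalerA.
Qed.

Lemma right_hker_trivial x : right_hker p x -> trivial_on x.
Proof.
move=> /right_hkerP E; apply: functional_sep => f lf.
have lfp : linear (fun y => f (p y) : k^o) by exact: lin_comp lf lp.
by rewrite -(counit_ract x lfp) E // linearZ (linfZ lf); apply: mulrC.
Qed.

Lemma left_hker_trivial x : left_hker p x -> trivial_on x.
Proof.
move=> /left_hkerP E; apply: functional_sep => f lf.
have lfp : linear (fun y => f (p y) : k^o) by exact: lin_comp lf lp.
by rewrite -(counit_lact x lfp) E // linearZ (linfZ lf); apply: mulrC.
Qed.

(** Triviality on all coefficients of [V] makes each [act (g \o p)] the scalar [g 1]; transposing to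
    functionals on [V] by [coeff_actl] gives invariance of the coefficients under left
    translation. *)
Lemma trivial_left_hker (V : comod H) :
  coeffs_in V trivial_on -> coeffs_in V (left_hker p).
Proof.
move=> tV f lf v; apply/left_hkerP => g lg.
have lgp : linear (fun y => g (p y) : k^o) by exact: lin_comp lg lp.
rewrite -coeff_actl //.
have -> : (fun u => f (act (fun y => g (p y)) u)) = (fun u : V => (g 1 : k) *: f u).
  apply: funext => u; rewrite -(linfZ lf); congr f; rewrite act_basis //.
  rewrite {2}[u]bcoordE scaler_sumr; apply: eq_bigr => i _.
  rewrite (tV _ (bcoord_linear i)) (linfZ lg) counit_coeff; last exact: bcoord_linear.
  by rewrite scalerA; congr (_ *: _); apply: mulrC.
apply: functional_sep => e le; rewrite (linfZ le) -!pairing_act //.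
move=> c x y; rewrite lf scalerDr !scalerA; congr (_ *: _ + _); exact: mulrC.
Qed.

End HopfMaps.

(** By coassociativity the right Hopf kernel is stable under [lact] and the left one under [ract];
    normality identifies the two. *)
Lemma normal_map_closed (k : fieldType) (H K : hopfAlgType k) (p : H -> K) :
  normal_map p -> closed_sub (right_hker p).
Proof.
move=> [hp nor]; have lp : linear p by case: hp.
have lfp (f : K -> k^o) : linear f -> linear (fun y => f (p y) : k^o).
  by move=> lf; exact: lin_comp lf lp.
split.
  split=> [|c x y /(right_hkerP hp) rx /(right_hkerP hp) ry]; apply/(right_hkerP hp) => f lf.
    by rewrite (linf0 (ract_linear (lfp f lf))) scaler0.
  by rewrite (ract_linear (lfp f lf)) rx // ry // scalerDr !scalerA mulrC.
move=> f lf x rx; split.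
  apply/(right_hkerP hp) => g lg; move/(right_hkerP hp): rx => rx.
  by rewrite -lact_ract ?rx // ?(linfZ (lact_linear lf)) //; apply: lfp.
apply/nor/(left_hkerP hp) => g lg; move/nor/(left_hkerP hp): rx => rx.
by rewrite lact_ract ?rx // ?(linfZ (ract_linear lf)) //; apply: lfp.
Qed.

(** * Words *)

Section Words.
Local Open Scope quotient_scope.
Variables (R : eqType) (star : R -> R) (op : R -> R -> option R).
Hypothesis starK : involutive star.
Implicit Types x y z u v w g : seq R.
Local Notation "x ^*" := (wstar star x).
Local Notation fusion := (fusion_words star op).

Lemma wstar_cat x y : (x ++ y)^* = y^* ++ x^*.
Proof. by rewrite /wstar map_cat rev_cat. Qed.

Lemma wstarK x : x^*^* = x.
Proof. by rewrite /wstar map_rev revK mapK. Qed.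

Lemma wopP v w z : reflect (exists v' r s w' t,
  [/\ v = rcons v' r, w = s :: w', op r s = Some t & z = v' ++ t :: w']) (wop op v w == Some z).
Proof.
apply: (iffP eqP) => [|[v' [r [s [w' [t [-> -> E ->]]]]]]]; last first.
  by rewrite /wop rev_rcons E /= revK.
rewrite /wop; case/lastP: v => [|v r] //; rewrite rev_rcons.
case: w => [|s w] //; case E: (op r s) => [t|] //= [<-].
by exists v, r, s, w, t; rewrite revK.
Qed.

Lemma fusionP x y z : reflect (exists v g w,
  [/\ x = v ++ g, y = g^* ++ w & z = v ++ w \/ wop op v w = Some z]) (z \in fusion x y).
Proof.
apply: (iffP flatten_mapP) => [[[[v g] w] /splittingsP[-> ->] /=]|[v [g [w [-> -> zE]]]]].
  rewrite inE => /predU1P zE; exists v, g, w; split=> //.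
  case: zE => [->|]; first by left.
  by case: wop => //= z'; rewrite inE => /eqP->; right.
exists (v, g, w); first exact/splittingsP.
rewrite inE; case: zE => [->|/= ->] /=; first by rewrite eqxx.
by rewrite mem_head orbT.
Qed.

Lemma cat_fusion x y : x ++ y \in fusion x y.
Proof. by apply/fusionP; exists x, [::], y; rewrite cats0; split=> //; left. Qed.

Lemma cancel_fusion v g w : v ++ w \in fusion (v ++ g) (g^* ++ w).
Proof. by apply/fusionP; exists v, g, w; split=> //; left. Qed.

Lemma nil_fusion x y : [::] \in fusion x y -> y = x^*.
Proof.
case/fusionP=> v [g [w [-> ->]]] [|/eqP/wopP[v' [r [s [w' [t [_ _ _]]]]]]].
  by case: v w => [|a v] [|b w] //= _; rewrite cats0.
by case: v'.
Qed.

Lemma fusion_letters r s t : [:: t] \in fusion [:: r] [:: s] <-> op r s = Some t.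
Proof.
split=> [/fusionP[v [g [w [rE sE tE]]]]|E]; last first.
  by apply/fusionP; exists [:: r], [::], [:: s]; split=> //; right; rewrite /wop /= E.
case: v rE tE => [|b v] /=.
  move=> gE; move: sE; rewrite -gE /wstar /= => -[_ <-] [|]; first by [].
  by rewrite /wop.
case: v => [|? ?] //= [<- gE]; move: sE; rewrite -gE /= => <- [//|].
by rewrite /wop /=; case: op => //= u [->].
Qed.

(** Fusing with [x^*] cancels at most [size x] final letters and [op] alters one more, so a strictly
    longer [n] shields the prefix [x]. *)
Lemma long_fusion_prefix x n z :
  (size x < size n)%N -> z \in fusion (x ++ n) x^* -> exists u, z = x ++ u.
Proof.
move=> lt /fusionP[v [g [w [xn xs zE]]]].
have le : (size g <= size x)%N by rewrite -(size_wstar star x) xs size_cat size_wstar leq_addr.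
have lv : (size x < size v)%N.
  have := congr1 size xn; rewrite !size_cat => E.
  rewrite -(ltn_add2r (size g)) -E -addnS; apply: leq_add => //.
  exact: leq_ltn_trans lt.
have [u uE] : exists u, v = x ++ u.
  exists (drop (size x) v); have := congr1 (take (size x)) xn.
  by rewrite take_size_cat // takel_cat 1?ltnW // => {1}->; rewrite cat_take_drop.
case: zE => [->|/eqP/wopP[v' [r [s [w' [t [vE _ _ ->]]]]]]].
  by exists (u ++ w); rewrite uE catA.
case/lastP: u uE lv vE => [|u r'] ->; first by rewrite cats0 ltnn.
rewrite -rcons_cat => _ /rcons_inj[<- _].
by exists (u ++ t :: w'); rewrite catA.
Qed.

(** * The syntactic congruence and its quotient group *)

Section Congruence.
Variable N : seq R -> Prop.

(** The syntactic congruence of [N]. The alias [{classic seq R}] supplies the choice structure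
    needed by the quotient, [R] being only an [eqType]. *)
Definition word_cong (x y : {classic seq R}) : bool :=
  `[< forall u v, N (u ++ (x : seq R) ++ v) <-> N (u ++ (y : seq R) ++ v) >].

Lemma word_cong_refl : reflexive word_cong.
Proof. by move=> x; apply/asboolP. Qed.

Lemma word_cong_sym : symmetric word_cong.
Proof. by move=> x y; apply/asboolP/asboolP => E u v; rewrite E. Qed.

Lemma word_cong_trans : transitive word_cong.
Proof. by move=> y x z /asboolP Exy /asboolP Eyz; apply/asboolP => u v; rewrite Exy. Qed.

Canonical word_cong_equiv := EquivRel word_cong word_cong_refl word_cong_sym word_cong_trans.

Definition word_class : Type := {eq_quot word_cong}%qT.
HB.instance Definition _ := Choice.on word_class.
HB.instance Definition _ : EqQuotient _ word_cong word_class := EqQuotient.on word_class.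

Hypotheses (N0 : N [::]) (Nfusion : forall x y z, N x -> N y -> z \in fusion x y -> N z).
Hypotheses (Nstar : forall x, N x -> N x^*) (Nadj : forall x, N (x ++ x^*)).
Hypothesis op_rotate : forall r s t, op r s = Some t -> op s (star t) = Some (star r).

(** Multiply on the left by [(u r)(u r)^* = u r r^* u^*], which is in [N]. Against [u v], cancelling
    [u] leaves [u r r^* v]; against [u r r^* v], cancelling [u r r^*] leaves [u v]. *)
Lemma cong_cancel r : word_cong [::] [:: r; star r].
Proof.
apply/asboolP => u v /=; split=> Nuv.
  apply: Nfusion (Nadj (u ++ [:: r])) Nuv _.
  have -> : (u ++ [:: r]) ++ (u ++ [:: r])^* = (u ++ [:: r; star r]) ++ u^*.
    by rewrite wstar_cat -!catA.
  rewrite -[X in fusion _ (X ++ v)]wstarK.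
  have -> : u ++ r :: star r :: v = (u ++ [:: r; star r]) ++ v by rewrite -catA.
  exact: cancel_fusion.
apply: Nfusion (Nadj (u ++ [:: r])) Nuv _.
have -> : u ++ r :: star r :: v = ([:: r] ++ (u ++ [:: r])^*)^* ++ v.
  by rewrite wstar_cat wstarK -!catA.
by rewrite -catA; apply: cancel_fusion.
Qed.

Lemma N_fuse r s t u v : op r s = Some t -> N (u ++ [:: r; s] ++ v) -> N (u ++ t :: v).
Proof.
move=> rst Nuv; apply: Nfusion (Nadj (u ++ [:: r])) Nuv _.
apply/fusionP; exists (u ++ [:: r]), (u ++ [:: r])^*, (s :: v).
rewrite wstarK -!catA; split=> //; right; apply/eqP/wopP.
by exists u, r, s, v, t; rewrite -cats1.
Qed.

(** For the converse, pass from [u t v] to its star, insert [s^* s], contract [s t^*] to [r^*] by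
    [op_rotate], and take the star again. *)
Lemma cong_fuse r s t : op r s = Some t -> word_cong [:: r; s] [:: t].
Proof.
move=> rst; apply/asboolP => u v; split; first exact: N_fuse.
move=> Nuv; have Nvu : N (v^* ++ star t :: u^*).
  by have := Nstar Nuv; rewrite !wstar_cat -catA.
have /asboolP E := cong_cancel (star s); have {}Nvu := (E v^* (star t :: u^*)).1 Nvu.
have /(N_fuse (op_rotate rst)) : N ((v^* ++ [:: star s]) ++ [:: s; star t] ++ u^*).
  by move: Nvu; rewrite starK -catA.
move=> /Nstar; rewrite !wstar_cat wstarK -cat1s wstar_cat wstarK.
by rewrite /wstar /= !starK -!catA.
Qed.

Lemma cong_cat x x' y y' : word_cong x x' -> word_cong y y' -> word_cong (x ++ y) (x' ++ y').
Proof.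
move=> /asboolP Ex /asboolP Ey; apply/asboolP => u v.
by rewrite -!catA Ex catA Ey -catA.
Qed.

Lemma cong_cat_star x : word_cong [::] (x ++ x^*).
Proof.
elim/last_ind: x => [|x r IH]; first exact: word_cong_refl.
apply: word_cong_trans IH _.
have := cong_cat (word_cong_refl x) (cong_cat (cong_cancel r) (word_cong_refl x^*)).
by rewrite /= -cats1 wstar_cat -catA.
Qed.

Lemma cong_fusion x y z : z \in fusion x y -> word_cong z (x ++ y).
Proof.
case/fusionP=> v [g [w [-> -> zE]]]; apply: (@word_cong_trans (v ++ w)).
  case: zE => [->|/eqP/wopP[v' [r [s [w' [t [-> -> rst ->]]]]]]].
    exact: word_cong_refl.
  have := cong_cat (word_cong_refl v') (cong_cat (cong_fuse rst) (word_cong_refl w')).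
  by rewrite word_cong_sym -cats1 -catA.
have := cong_cat (word_cong_refl v) (cong_cat (cong_cat_star g) (word_cong_refl w)).
by rewrite /= -!catA.
Qed.

Lemma cong_star x y : word_cong x y -> word_cong x^* y^*.
Proof.
move=> /asboolP E; apply/asboolP => u v.
have EN a : N (u ++ a^* ++ v) <-> N (v^* ++ a ++ u^*).
  by split=> /Nstar; rewrite !wstar_cat ?wstarK -?catA.
by rewrite !EN E.
Qed.

(** Classes multiply by concatenation, with the class of [x^*] inverse to that of [x]. A word
    congruent to the empty word lies in [N] because the empty word does. *)
Lemma grading_group : exists (G : groupType) (deg : seq R -> G),
  [/\ forall x y z, z \in fusion x y -> deg z = (deg x * deg y)%g,
      forall a : G, exists x, deg x = a & forall x, deg x = 1%g -> N x].
Proof.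
pose cl (x : seq R) : word_class := \pi_(word_class) (x : {classic seq R}).
have clP x y : cl x = cl y <-> word_cong x y.
  by split=> [/eqmodP|E]; last exact/eqmodP.
have reprP (a : word_class) : cl (repr a) = a by exact: reprK.
pose mul (a b : word_class) := cl ((repr a : seq R) ++ (repr b : seq R)).
pose inv (a : word_class) := cl (repr a : seq R)^*.
have mulE x y : mul (cl x) (cl y) = cl (x ++ y).
  by apply/clP; apply: cong_cat; apply/clP; rewrite reprP.
have invE x : inv (cl x) = cl x^*.
  by apply/clP; apply: cong_star; apply/clP; rewrite reprP.
have mulA : associative mul.
  by move=> a b c; rewrite -(reprP a) -(reprP b) -(reprP c) !mulE catA.
have mul1 : left_id (cl [::]) mul by move=> a; rewrite -(reprP a) mulE.
have mulr1 : right_id (cl [::]) mul by move=> a; rewrite -(reprP a) mulE cats0.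
have mulV : right_inverse (cl [::]) inv mul.
  move=> a; rewrite -(reprP a) invE mulE; apply/esym/clP; exact: cong_cat_star.
have Vmul : left_inverse (cl [::]) inv mul.
  move=> a; rewrite -(reprP a) invE mulE; apply/esym/clP.
  by rewrite -{2}[repr a : seq R]wstarK; apply: cong_cat_star.
pose G : groupType := HB.pack word_class (isGroup.Build word_class mulA mul1 mulr1 Vmul mulV).
exists G, (cl : seq R -> G); split=> [x y z zxy|a|x].
- by rewrite [RHS]mulE; apply/clP; apply: cong_fusion.
- by exists (repr (a : word_class)); apply: reprP.
move=> /clP/asboolP/(_ [::] [::]) /=; rewrite cats0 => E; exact/E.
Qed.

End Congruence.
End Words.

(** * Free fusion semirings *)

Lemma tmap_id (k : fieldType) (U V : lmodType k) (t : U ⊗ V) : tmap idfun idfun t = t.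
Proof. by apply: tensor_sepr => f lf; rewrite evalr_map. Qed.

Lemma comod_iso_sym (k : fieldType) (H : hopfAlgType k) (V W : comod H) :
  comod_iso V W -> comod_iso W V.
Proof.
move=> [f [[lf fE] [g fK gK]]]; have li := @lin_id k H.
have lg : linear g by move=> c x y; rewrite -[LHS]fK /= -[x]gK -[y]gK -lf !fK.
exists g; split; last by exists f.
split=> // w; rewrite -[in RHS](gK w) fE tmap_comp //.
have -> : (fun x => g (f x)) = idfun by apply: funext => x; rewrite fK.
by rewrite tmap_id.
Qed.

Lemma comod_iso_trans (k : fieldType) (H : hopfAlgType k) (V W U : comod H) :
  comod_iso V W -> comod_iso W U -> comod_iso V U.
Proof.
move=> [f [[lf fE] bf]] [g [[lg gE] bg]]; have li := @lin_id k H.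
exists (g \o f); split; last exact: bij_comp.
split=> [|v /=]; first exact: lin_comp lg lf.
by rewrite gE fE tmap_comp.
Qed.

Lemma counit_hopf_map (k : fieldType) (H : hopfAlgType k) :
  hopf_map (@counit k H : H -> k^o).
Proof.
have le := @counit_lin k H; split=> //; first exact: (@counit_monoid k H).
move=> x; apply: tensor_sepr => f lf; rewrite evalr_map //.
have lfe : linear (fun y : H => f (counit y : k^o) : k^o) by exact: lin_comp lf le.
transitivity (f (counit x : k^o)); last exact/esym/(@counit_ract k H).
rewrite [X in evalr f X]/comul /= /triv_comul (linfZ (evalr_linear lf)) evalr_pure //.
rewrite -{2}[counit x : k^o]mulr1 (linfZ lf (counit x) 1); congr (_ * _).
exact: mulr1.
Qed.

Section Eigenvector.
Import VectorInternalTheory.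

Lemma linear_eigenvector (k : closedFieldType) (V : vectType k) (T : V -> V) (v0 : V) :
  linear T -> v0 != 0 -> exists (c : k) (v : V), v != 0 /\ T v = c *: v.
Proof.
move=> lT v00; pose n := dim V.
pose r2v := @r2v k V; pose v2r := @v2r k V.
have rK : cancel v2r r2v := @v2rK k V.
have vK : cancel r2v v2r := @r2vK k V.
have lv : linear v2r by move=> c x y; rewrite /v2r linearP.
have lr : linear r2v by move=> c x y; apply: (can_inj rK); rewrite lv !vK.
pose A : 'M[k]_n := \matrix_i v2r (T (r2v (delta_mx 0 i))).
have AE u : u *m A = v2r (T (r2v u)).
  rewrite [u in RHS]row_sum_delta (linf_sum lr) (linf_sum lT) (linf_sum lv).
  rewrite mulmx_sum_row; apply: eq_bigr => i _.
  by rewrite rowK (linfZ lr) (linfZ lT) (linfZ lv).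
have : size (char_poly A) != 1.
  rewrite size_char_poly; apply: contra v00 => /eqP[n0].
  rewrite -[v0]rK.
  have -> : v2r v0 = 0 by apply/rowP => i; have := ltn_ord i; rewrite [X in (_ < X)%N]n0.
  by rewrite (linf0 lr).
move=> /closed_rootP[c]; rewrite -eigenvalue_root_char => /eigenvalueP[u uA u0].
exists c, (r2v u); split.
  apply: contra u0 => /eqP ru; rewrite -[u]vK ru.
  by rewrite (linf0 lv).
by rewrite -(linfZ lr) -uA AE rK.
Qed.

End Eigenvector.

Lemma coeff_counit1 (k : fieldType) (H : hopfAlgType k) (V : comod H) :
  simple_comod V -> exists (f : V -> k^o) (v : V), linear f /\ f v = 1.
Proof.
move=> [[v v0] _]; have h0 : subspace (fun z : V => z = 0).
  by split=> // c _ _ -> ->; rewrite scaler0 addr0.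
by have [f [lf _ fv]] := separating_functional h0 (elimN eqP v0); exists f, v.
Qed.

(* Schur's lemma: for every functional [f] the operator [v_0 f(z v_1)] is an *)
(* endomorphism of the simple comodule, hence a scalar.                      *)
Lemma central_coeffs (k : closedFieldType) (H : hopfAlgType k) (A : lmodType k)
    (z : H -> A) (V : comod H) :
    linear z -> (forall x, tmap z idfun (comul x) = tmap z idfun (tswap (comul x))) ->
    simple_comod V ->
  exists g : A, coeffs_in V (fun c => z c = (counit c : k) *: g).
Proof.
move=> lz zc simV; have li := @lin_id k H.
have lfz (f : A -> k^o) : linear f -> linear (fun x => f (z x) : k^o).
  by move=> lf; exact: lin_comp lf lz.
have swapE (f : H -> k^o) (t : H ⊗ H) : linear f -> evall f (tswap t) = evalr f t.
  move=> lf; move: t; apply: tensor_linext.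
  - exact: lin_comp (evall_linear lf) (@tswap_linear _ _ _).
  - exact: evalr_linear.
  by move=> u v; rewrite tswap_pure evall_pure // evalr_pure.
have lract f x : linear f -> lact (fun y => f (z y)) x = ract (fun y => f (z y)) x.
  move=> lf; have /(congr1 (evall f)) := zc x.
  by rewrite !evall_map //= => zE; rewrite /lact zE; apply: swapE; apply: lfz.
have [v0 v00] := simV.1.
have scal (f : A -> k^o) : linear f -> exists c : k, forall v : V,
    act (fun y => f (z y)) v = c *: v.
  move=> lf; pose T : V -> V := act (fun y => f (z y)).
  have lT : linear T by apply: act_linear; apply: lfz.
  have [c [v [v_neq0 Tv]]] := linear_eigenvector lT v00.
  (* The eigenspace is a subcomodule: [T] commutes with every [act g], since the left and right
     translates by [f \o z] coincide. *)
  exists c => u; apply: (@simple_stable k H V (fun u => T u = c *: u) v) => //.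
    split=> [|d x y Tx Ty]; first by rewrite (linf0 lT) scaler0.
    by rewrite lT Tx Ty scalerDr !scalerA mulrC.
  move=> g lg x Tx; rewrite -(linfZ (act_linear lg)) -Tx.
  apply: functional_sep => e le; rewrite !pairing_act ?coeff_act //; try exact: lfz.
  by rewrite -lract // -pairing //; apply: lfz.
have [e0 [u0 [le0 e0u0]]] := coeff_counit1 simV.
exists (z (coeff e0 u0)) => e le v; apply: functional_sep => f lf.
have [c cE] := scal f lf; rewrite (linfZ lf) -!(@pairing_act k H V _ (fun y => f (z y))) //;
  try exact: lfz.
rewrite !cE (linfZ le) (linfZ le0) e0u0.
have -> : (counit (coeff e v) : k) = e v := counit_coeff v le.
by rewrite /GRing.scale /= mulr1 mulrC.
Qed.

Section FreeHopf.
Variables (k : closedFieldType) (H : hopfAlgType k) (ssH : cosemisimple H).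
Variables (R : eqType) (star : R -> R) (op : R -> R -> option R).
Variable a : seq R -> comod H.
Hypothesis lab : free_labelling star op a.
Local Notation "x ^*" := (wstar star x).
Local Notation fusion := (fusion_words star op).
Local Notation C x := (coeff_space (a x)).

Lemma coeffs_in_fusion x y D : subspace D ->
  (forall z, z \in fusion x y -> coeffs_in (a z) D) <->
  (forall c d, C x c -> C y d -> D (c * d)).
Proof.
move=> hD; rewrite -coeffs_in_tens // (coeffs_in_iso _ (label_mul lab x y)).
by rewrite coeffs_in_dsums.
Qed.

Lemma coeffs_in_star x D : subspace D ->
  coeffs_in (a x^*) D <-> forall c, C x c -> D (antipode c).
Proof. by move=> hD; rewrite (coeffs_in_iso _ (label_dual lab x)) coeffs_in_dual. Qed.

Lemma coeffs_in_nil D : subspace D -> coeffs_in (a [::]) D <-> D 1.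
Proof. by move=> hD; rewrite (coeffs_in_iso _ (label_unit lab)) coeffs_in_triv. Qed.

Lemma label_ind (Q D : H -> Prop) c : closed_sub Q -> Q c -> subspace D ->
  (forall x, coeffs_in (a x) Q -> coeffs_in (a x) D) -> D c.
Proof.
move=> cQ Qc hD aD; apply: (cosemisimple_ind ssH cQ Qc hD) => S simS.
have [x iso] := label_surj lab simS.
by move=> /(coeffs_in_iso _ iso)/aD/(coeffs_in_iso _ iso).
Qed.

Lemma label_span D : subspace D -> (forall x, coeffs_in (a x) D) -> forall c, D c.
Proof. by move=> hD aD c; apply: (@label_ind (fun _ => True)). Qed.

Lemma counit1_coeff x : exists2 c, C x c & counit c = 1.
Proof.
have [f [v [lf fv]]] := coeff_counit1 (label_simple lab x).
exists (coeff f v); first exact: coeffs_in_space.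
exact: etrans (counit_coeff v lf) fv.
Qed.

Section WithHaar.
Variable h : H -> k^o.
Hypothesis haarh : haar h.

Let lh : linear h. Proof. by case: haarh. Qed.

Let kernel_sub : subspace (fun c => h c = 0).
Proof.
by split=> [|u c d hc hd]; [apply: linf0 lh | rewrite lh hc hd scaler0 addr0].
Qed.

(** Invariance of [h] makes [act h v] coinvariant; were it nonzero, [a x] would be the trivial
    comodule. *)
Lemma haar_coeff x : x != [::] -> coeffs_in (a x) (fun c => h c = 0).
Proof.
move=> x0 f lf v; case: haarh => _ _ hinv; rewrite -pairing_act //.
suff -> : act h v = 0 by apply: linf0 lf.
apply/eqP; apply: contraNT x0 => w0; apply/eqP/(label_inj lab).
have co : coinvariant (act h v).
  move=> g lg; apply: functional_sep => e le; rewrite pairing_act // coeff_act // hinv.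
  by rewrite !(linfZ lg) (linfZ le) (pairing_act _ le lh); apply: mulrC.
have iso := simple_coinvariant_triv (label_simple lab x) co w0.
exact: comod_iso_trans iso (comod_iso_sym (label_unit lab)).
Qed.

Lemma haar_orthogonal x y c d :
  [::] \notin fusion x y -> C x c -> C y d -> h (c * d) = 0.
Proof.
move=> xy; move: c d; apply/(coeffs_in_fusion _ _ kernel_sub) => z zxy.
by apply: haar_coeff; apply: contraNneq xy => <-.
Qed.

(** Frobenius reciprocity. Otherwise the trivial comodule would not occur in the product of [r],
    [s], [t^*], and [h] would vanish on products of their coefficients; as [t] occurs in [r s], it
    would vanish on products of coefficients of [t] and [t^*]. The antipode identity writes 1 as a
    sum of such products. *)
Lemma label_op_rotate r s t : op r s = Some t -> op s (star t) = Some (star r).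
Proof.
move=> rst; apply: contrapT => nE.
have nfus u : u \in fusion [:: s] [:: star t] -> [::] \notin fusion [:: r] u.
  move=> us; apply/negP => /nil_fusion uE; apply: nE.
  by apply/(@fusion_letters R star); rewrite -[[:: star r]]/[:: r]^* -uE.
have rst0 c d e : C [:: r] c -> C [:: s] d -> C [:: star t] e -> h (c * d * e) = 0.
  move=> rc sd te; rewrite -mulrA; move: d e sd te.
  have hD : subspace (fun d => h (c * d) = 0).
    split=> [|u x y hx hy]; first by rewrite mulr0; apply: linf0 lh.
    by rewrite mulrDr -scalerAr lh hx hy scaler0 addr0.
  apply/(coeffs_in_fusion [:: s] [:: star t] hD) => u us f lf v.
  by apply: (haar_orthogonal (nfus u us)) => //; apply: coeffs_in_space.
have t0 c e : C [:: t] c -> C [:: star t] e -> h (c * e) = 0.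
  move=> tc te; pose D d := h (d * e) = 0.
  have hD : subspace D.
    split=> [|u x y hx hy]; rewrite /D; first by rewrite mul0r; apply: linf0 lh.
    by rewrite mulrDl -scalerAl lh hx hy scaler0 addr0.
  apply: (tc D hD); apply: (iffRL (coeffs_in_fusion [:: r] [:: s] hD)); last first.
    exact/fusion_letters.
  by move=> c' d rc sd; apply: rst0.
have [f [v [lf fv]]] := coeff_counit1 (label_simple lab [:: t]).
have := coeff_antipoder v lf; move=> /(congr1 h); rewrite (linfZ lh) fv (linf_sum lh).
rewrite big1 => [|i _].
  by case: haarh => _ -> _; rewrite scale1r => /esym/eqP; rewrite oner_eq0.
apply: t0; first exact: coeffs_in_space.
have /(coeffs_in_star [:: t] (coeff_space_sub _))/(_ _) : coeffs_in (a [:: t]^*) (C [:: t]^*).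
  exact: coeffs_in_space.
by apply; apply: coeffs_in_space; apply: bcoord_linear.
Qed.

End WithHaar.
End FreeHopf.

(** * The central map attached to a grading of the fusion rules *)

Section GradedCentralMap.
Variables (k : closedFieldType) (H : hopfAlgType k) (ssH : cosemisimple H).
Variables (R : eqType) (star : R -> R) (op : R -> R -> option R).
Variable a : seq R -> comod H.
Hypothesis lab : free_labelling star op a.
Local Notation fusion := (fusion_words star op).
Local Notation C x := (coeff_space (a x)).
Variables (G : groupType) (deg : seq R -> G).
Hypothesis degM : forall x y z, z \in fusion x y -> deg z = (deg x * deg y)%g.
Hypothesis deg_surj : forall g : G, exists x, deg x = g.

Let deg0 : deg [::] = 1%g.
Proof.
have /degM E : [::] \in fusion [::] [::] := cat_fusion star op [::] [::].
by apply: (mulgI (deg [::])); rewrite -E mulg1.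
Qed.

Definition supported (P : G -> Prop) (c : H) : Prop :=
  forall D, subspace D -> (forall x, P (deg x) -> coeffs_in (a x) D) -> D c.

Lemma supported_sub P : subspace (supported P).
Proof.
split=> [D hD _|u c d hc hd D hD PD]; first exact: subspace0.
by apply: hD.2; [apply: hc | apply: hd].
Qed.

Lemma supported_coeffs P x : P (deg x) -> coeffs_in (a x) (supported P).
Proof. by move=> Px f lf v D hD PD; apply: PD. Qed.

(** Let [d] be a coefficient of [a w]. By orthogonality, [h(d c)] can be nonzero only if [P] and
    [P'] both hold at the inverse of [deg w]. So [c] lies in the radical of [h]. *)
Lemma supported_disjoint P P' c : (forall g, P g -> ~ P' g) ->
  supported P c -> supported P' c -> c = 0.
Proof.
move=> disj Pc P'c; have [h hh] := haar_ex ssH; have lh : linear h by case: hh.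
apply: (haar_nondegenerate hh) => d.
have hker e : subspace (fun d => h (e * d) = 0).
  split=> [|u x y hx hy]; first by rewrite mulr0; apply: linf0 lh.
  by rewrite mulrDr -scalerAr lh hx hy scaler0 addr0.
have hkerl e : subspace (fun d => h (d * e) = 0).
  split=> [|u x y hx hy]; first by rewrite mul0r; apply: linf0 lh.
  by rewrite mulrDl -scalerAl lh hx hy scaler0 addr0.
apply: (label_span ssH lab (hkerl c)) => w f lf v.
have kill P0 : supported P0 c -> ~ P0 (deg w)^-1%g -> h (coeff f v * c) = 0.
  move=> P0c nP0; apply: (P0c _ (hker _)) => x Px f' lf' v'.
  apply: (haar_orthogonal lab hh (x := w) (y := x)); try exact: coeffs_in_space.
  apply/negP => /degM/esym; rewrite deg0 => wx; apply: nP0.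
  suff <- : deg x = (deg w)^-1%g by [].
  by rewrite -[LHS]mul1g -(mulVg (deg w)) -mulgA wx mulg1.
have [Pw|] := pselect (P (deg w)^-1%g); last exact: kill.
by apply: (kill P') => //; apply: disj.
Qed.

(** This is the counit cut down to degree [g]. It separates [u], of degree [g] and counit 1, from
    the space [S] spanned by the other degrees and by the degree [g] elements of counit 0. *)
Lemma degree_functional g : exists2 chi : H -> k^o, linear chi &
  forall x, coeffs_in (a x) (fun c => chi c = if deg x == g then counit c : k^o else 0).
Proof.
have [x0 x0g] := deg_surj g; have [u Cu u1] := counit1_coeff lab x0.
pose on := supported (fun g' => g' = g); pose off := supported (fun g' => g' <> g).
have hon : subspace on := supported_sub _.
have hoff : subspace off := supported_sub _.
pose S s := exists s1 s2, [/\ s = s1 + s2, off s1, on s2 & counit s2 = 0].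
have hS : subspace S.
  split=> [|c _ _ [s1 [s2 [-> os1 os2 e]]] [t1 [t2 [-> ot1 ot2 e']]]].
    exists 0, 0; rewrite addr0 linear0.
    by split=> //; [apply: subspace0 hoff | apply: subspace0 hon].
  exists (c *: s1 + t1), (c *: s2 + t2); rewrite scalerDr addrACA; split=> //.
  - exact: hoff.2.
  - exact: hon.2.
  - by rewrite (@counit_linear k H) e e' mulr0 addr0.
have onu : on u by apply: (Cu _ hon); apply: supported_coeffs.
have Su : ~ S u.
  move=> [s1 [s2 [uE os1 os2 e]]].
  have s10 : s1 = 0.
    apply: (supported_disjoint (P := fun g' => g' <> g) (P' := fun g' => g' = g)) => //.
    have -> : s1 = u - s2 by rewrite uE addrK.
    exact: subspaceB hon onu os2.
  by move: u1; rewrite uE s10 add0r e => /esym/eqP; rewrite oner_eq0.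
have [chi [lchi chi0 chi1]] := separating_functional hS Su.
exists chi => // x f lf v; case: eqVneq => [xg|/eqP xg].
  have /chi0 : S (coeff f v - counit (coeff f v) *: u).
    exists 0, (coeff f v - counit (coeff f v) *: u); rewrite add0r; split=> //.
    - exact: subspace0 hoff.
    - apply: (subspaceB hon); last exact: subspaceZ hon onu.
      exact: (supported_coeffs (P := fun g' => g' = g)).
    - by rewrite linearB linearZ /= u1 mulr1 subrr.
  rewrite (linfD lchi) -scaleN1r !(linfZ lchi) chi1 scaleN1r => /eqP.
  by rewrite subr_eq0 => /eqP->; apply: mulr1.
apply: chi0; exists (coeff f v), 0; rewrite addr0 linear0; split=> //.
  exact: (supported_coeffs (P := fun g' => g' <> g)).
exact: subspace0 hon.
Qed.

Lemma graded_central_map : exists2 z : H -> galg k G, central_map z &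
  forall x, coeffs_in (a x) (fun c => z c = (counit c : k) *: gelt k (deg x)).
Proof.
have exchi g : exists chi : H -> k^o, linear chi /\ forall x,
    coeffs_in (a x) (fun c => chi c = if deg x == g then counit c : k^o else 0).
  by have [chi lchi chiE] := degree_functional g; exists chi.
have [chi chiP] := choice exchi.
have lchi g : linear (chi g) := (chiP g).1; have chiE g := (chiP g).2.
(* The point is finite support in [g]: for a coefficient of [a x] only [g = deg x] contributes, and
   such [c] form a subspace. *)
have exz c : exists w : galg k G, forall g, w@_g = chi g c.
  pose D c := exists w : galg k G, forall g, w@_g = chi g c.
  have hD : subspace D.
    split=> [|u x y [w wE] [w' w'E]].
      by exists 0 => g; rewrite mcoeff0 (linf0 (lchi g)).
    by exists (u *: w + w') => g; rewrite mcoeffD mcoeffZ wE w'E lchi.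
  apply: (label_span (D := D) ssH lab hD) => x f lf v.
  exists ((counit (coeff f v) : k) *: gelt k (deg x)) => g.
  rewrite chiE // mcoeffZ mcoeffU; case: (deg x == g); last exact: mulr0.
  exact: mulr1.
have [z zP] := choice exz.
have lz : linear z.
  by move=> u c d; apply/malgP => g; rewrite mcoeffD mcoeffZ !zP lchi.
have zE x : coeffs_in (a x) (fun c => z c = (counit c : k) *: gelt k (deg x)).
  move=> f lf v; apply/malgP => g; rewrite zP chiE // mcoeffZ mcoeffU.
  by case: (deg x == g); [apply/esym/mulr1 | apply/esym/mulr0].
have li := @lin_id k H.
have hE (g : galg k G) : subspace (fun c => z c = (counit c : k) *: g).
  split=> [|u c d hc hd]; first by rewrite (linf0 lz) linear0 scale0r.
  by rewrite lz hc hd linearP scalerDl scalerA.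
have z1 : z 1 = 1.
  have /(coeffs_in_nil lab (hE _)) -> := zE [::].
  by rewrite deg0 rmorph1 scale1r.
have zM c d : z (c * d) = z c * z d.
  have hM1 d' : subspace (fun c => z (c * d') = z c * z d').
    split=> [|u x y hx hy]; first by rewrite mul0r (linf0 lz) mul0r.
    by rewrite mulrDl -scalerAl !lz hx hy mulrDl scalerAl.
  have hM2 c' : subspace (fun d => z (c' * d) = z c' * z d).
    split=> [|u x y hx hy]; first by rewrite mulr0 (linf0 lz) mulr0.
    by rewrite mulrDr -scalerAr !lz hx hy mulrDr scalerAr.
  apply: (label_span (D := fun c => z (c * d) = z c * z d) ssH lab (hM1 d)) => x f lf v.
  apply: (label_span (D := fun d => z (coeff f v * d) = z (coeff f v) * z d)
            ssH lab (hM2 _)) => y f' lf' v'.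
  have E : z (coeff f v * coeff f' v') =
      (counit (coeff f v * coeff f' v') : k) *: gelt k (deg x * deg y)%g.
    apply: (iffLR (coeffs_in_fusion lab x y (hE _))); try exact: coeffs_in_space.
    by move=> w wxy; rewrite -(degM wxy); apply: zE.
  rewrite E !zE // rmorphM -scalerAl -scalerAr scalerA; congr (_ *: _).
  exact/esym/gmul_gelt.
have coeff_sum x (V := a x) (f : V -> k^o) (v : V) : linear f ->
    coeff f v = \sum_(i < \dim {:V}) (bcoord i v : k) *: coeff f (vbasis {:V})`_i.
  move=> lf; rewrite {1}[v]bcoordE (linf_sum (coeff_linear lf)).
  by apply: eq_bigr => i _; rewrite (linfZ (coeff_linear lf)).
have coeff_sum' x (V := a x) (f : V -> k^o) (v : V) : linear f ->
    coeff f v = \sum_(i < \dim {:V}) (f (vbasis {:V})`_i : k) *: coeff (bcoord i) v.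
  move=> lf; apply: functional_sep => e lE; rewrite -(@pairing_act k H V) // act_basis //.
  rewrite (linf_sum lf) (linf_sum lE); apply: eq_bigr => i _.
  by rewrite (linfZ lf) (linfZ lE); apply: mulrC.
exists z => //; split; last first.
  move=> c; apply: (label_span (D := fun c => tmap z idfun (comul c) =
      tmap z idfun (tswap (comul c))) ssH lab).
    have l1 : linear (fun c => tmap z idfun (comul c)).
      exact: lin_comp (tmap_linear lz li) (@comul_linear k H).
    have l2 : linear (fun c => tmap z idfun (tswap (comul c))).
      apply: lin_comp (tmap_linear lz li) _.
      exact: lin_comp (@tswap_linear _ _ _) (@comul_linear k H).
    split=> [|u x y hx hy]; first by rewrite (linf0 l1) (linf0 l2).
    by rewrite (l1 u x y) (l2 u x y) hx hy.
  move=> x f lf v; rewrite comul_coeff // (linf_sum (@tswap_linear _ _ _)).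
  rewrite !(linf_sum (tmap_linear lz li)).
  (* Each side reduces to this tensor, by expanding the coefficient along a basis, in [f] for one
     side and in [v] for the other. *)
  transitivity (gelt k (deg x) ⊗ coeff f v).
    rewrite [in RHS]coeff_sum' // (linf_sum (lin_pure2 _)).
    apply: eq_bigr => i _; rewrite tmap_pure // zE //.
    rewrite (linfZ (lin_pure1 _)) (linfZ (lin_pure2 _)); congr (_ *: _).
    exact: counit_coeff.
  rewrite {1}[coeff f v]coeff_sum // (linf_sum (lin_pure2 _)).
  apply: eq_bigr => i _; rewrite tswap_pure tmap_pure // zE; last exact: bcoord_linear.
  rewrite (linfZ (lin_pure1 _)) (linfZ (lin_pure2 _)); congr (_ *: _).
  exact/esym/counit_coeff/bcoord_linear.
split=> //.
  move=> c; apply: (label_span (D := fun c => comul (z c) = tmap z z (comul c)) ssH lab).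
    have l1 : linear (fun c => comul (z c)).
      exact: lin_comp (@comul_linear k (galg k G)) lz.
    have l2 : linear (fun c => tmap z z (comul c)).
      exact: lin_comp (tmap_linear lz lz) (@comul_linear k H).
    split=> [|u x y hx hy]; first by rewrite (linf0 l1) (linf0 l2).
    by rewrite (l1 u x y) (l2 u x y) hx hy.
  move=> x f lf v; rewrite zE // (linfZ (@comul_linear k (galg k G))).
  rewrite [comul (gelt k _)]gcomul_gelt comul_coeff // (linf_sum (tmap_linear lz lz)).
  rewrite (coeff_sum x f v lf) linear_sum scaler_suml; apply: eq_bigr => i _.
  rewrite tmap_pure // !zE //; last exact: bcoord_linear.
  rewrite (linfZ (lin_pure1 _)) (linfZ (lin_pure2 _)) scalerA linearZ /= mulrC.
  congr (_ * _ *: _); exact/esym/counit_coeff/bcoord_linear.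
move=> c; apply: (label_span (D := fun c => counit (z c) = counit c) ssH lab).
  split=> [|u x y hx hy]; first by rewrite (linf0 lz) !linear0.
  by rewrite lz !counit_linear hx hy.
move=> x f lf v; rewrite zE // linearZ /= [counit (gelt k _)]gcounit_gelt.
exact: mulr1.
Qed.

End GradedCentralMap.

(** * Normal quantum subgroups *)

Lemma hopf_map_inverse (k : fieldType) (H K : hopfAlgType k) (p : H -> K) (q : K -> H) :
  hopf_map p -> cancel p q -> cancel q p -> hopf_map q.
Proof.
move=> [lp [p1 pM] pD pe] pK qK.
have lq : linear q by move=> c x y; rewrite -[LHS]pK /= -[x]qK -[y]qK -lp !pK.
split=> // [|y|y]; last by rewrite -{2}[y]qK pe.
  by split=> [|x y]; [rewrite -p1 pK | rewrite -{1}[x]qK -{1}[y]qK -pM pK].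
rewrite -{2}[y]qK pD tmap_comp //.
have -> : (fun x => q (p x)) = idfun by apply: funext => x; rewrite pK.
by rewrite tmap_id.
Qed.

Section ImageSubspaces.
Variables (k : fieldType) (P H : hopfAlgType k) (i : P -> H).
Hypothesis hi : hopf_map i.

Let li : linear i. Proof. by case: hi. Qed.

Definition image_of (D : P -> Prop) (c : H) : Prop := exists2 p, i p = c & D p.

Lemma image_of_sub D : subspace D -> subspace (image_of D).
Proof.
move=> hD; split=> [|c _ _ [p <- Dp] [q <- Dq]].
  by exists 0; [apply: linf0 li | apply: subspace0].
by exists (c *: p + q); [apply: li | apply: hD.2].
Qed.

Lemma image_of_closed D : closed_sub D -> closed_sub (image_of D).
Proof.
move=> [hD cD]; split=> [|f lf _ [p <- Dp]]; first exact: image_of_sub.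
have [Dl Dr] := cD _ (lin_comp lf li : linear (fun y => f (i y) : k^o)) _ Dp.
by split; [rewrite (lact_map hi) //; exists (lact (fun y => f (i y)) p)
          |rewrite (ract_map hi) //; exists (ract (fun y => f (i y)) p)].
Qed.

End ImageSubspaces.

Section NormalSubgroups.
Variables (k : closedFieldType) (H : hopfAlgType k) (ssH : cosemisimple H).
Variables (R : eqType) (star : R -> R) (op : R -> R -> option R).
Variable a : seq R -> comod H.
Hypothesis lab : free_labelling star op a.
Local Notation "x ^*" := (wstar star x).
Local Notation fusion := (fusion_words star op).
Local Notation C x := (coeff_space (a x)).
Variables (P K : hopfAlgType k) (i : P -> H) (p : P -> K).
Hypotheses (hi : hopf_map i) (inj_i : injective i).
Hypothesis np : normal_map p.

Let li : linear i. Proof. by case: hi. Qed.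
Let i1 : i 1 = 1. Proof. by case: hi => _ []. Qed.
Let iM x y : i (x * y) = i x * i y. Proof. by case: hi => _ []. Qed.
Let ie x : counit (i x) = counit x. Proof. by case: hi. Qed.
Let hp : hopf_map p. Proof. by case: np. Qed.
Let lp : linear p. Proof. by case: hp. Qed.
Let p1 : p 1 = 1. Proof. by case: hp => _ []. Qed.
Let pM x y : p (x * y) = p x * p y. Proof. by case: hp => _ []. Qed.

Definition in_image x : Prop := coeffs_in (a x) (image_of i (fun _ => True)).
Definition in_kernel x : Prop := coeffs_in (a x) (image_of i (trivial_on p)).

Let ker_sub : subspace (image_of i (trivial_on p)).
Proof. exact: image_of_sub hi _ (trivial_on_sub hp). Qed.

Let im_sub : subspace (image_of i (fun _ => True)).
Proof. by apply: image_of_sub. Qed.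

Lemma in_kernel_nil : in_kernel [::].
Proof.
by apply/(coeffs_in_nil lab ker_sub); exists 1; rewrite // /trivial_on p1 rmorph1 scale1r.
Qed.

Lemma in_kernel_fusion x y z : in_kernel x -> in_kernel y -> z \in fusion x y -> in_kernel z.
Proof.
move=> Nx Ny; move: z; apply/(coeffs_in_fusion lab _ _ ker_sub).
move=> c d /(_ _ ker_sub Nx)[q <- tq] /(_ _ ker_sub Ny)[r <- tr].
exists (q * r); first exact: iM.
by rewrite /trivial_on pM tq tr rmorphM -scalerAl -scalerAr scalerA mulr1.
Qed.

Lemma in_image_fusion x y z : in_image x -> in_image y -> z \in fusion x y -> in_image z.
Proof.
move=> Nx Ny; move: z; apply/(coeffs_in_fusion lab _ _ im_sub).
move=> c d /(_ _ im_sub Nx)[q <- _] /(_ _ im_sub Ny)[r <- _].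
by exists (q * r); first exact: iM.
Qed.

Lemma in_kernel_star x : in_kernel x -> in_kernel x^*.
Proof.
move=> Nx; apply/(coeffs_in_star lab _ ker_sub) => c /(_ _ ker_sub Nx)[q <- tq].
exists (antipode q); first exact: hopf_map_antipode.
have Se : counit (antipode q) = counit q := hopf_map_antipode (counit_hopf_map P) q.
have S1 : antipode (1 : K) = 1.
  have := antipodel (1 : K); rewrite comul1 tlift_pure ?mulr1 ?rmorph1 ?scale1r //.
  have := bilin_comp (@alg_mul_bilin k K) (@antipode_linear k K) (@lin_id k K) (@lin_id _ _).
  by apply.
by rewrite /trivial_on hopf_map_antipode // tq (linfZ (@antipode_linear k K)) S1 Se.
Qed.

Lemma in_image_star x : in_image x -> in_image x^*.
Proof.
move=> Nx; apply/(coeffs_in_star lab _ im_sub) => c /(_ _ im_sub Nx)[q <- _].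
by exists (antipode q); first exact: hopf_map_antipode.
Qed.

Lemma in_kernel_image x : in_kernel x -> in_image x.
Proof. by apply: coeffs_in_mono => c [q <- _]; exists q. Qed.

Variable h : K -> k^o.
Hypothesis haarh : haar h.

Let lh : linear h. Proof. by case: haarh. Qed.
Let h1 : h 1 = 1. Proof. by case: haarh. Qed.
Let lhp : linear (fun y => h (p y) : k^o). Proof. exact: lin_comp lh lp. Qed.

(** By invariance of [h], the map [p] sends every average [x_1 h(p(x_2))] to a scalar;
    coassociativity transfers this to the second leg. *)
Lemma average_right_hker y : right_hker p (ract (fun y => h (p y)) y).
Proof.
have pE x : p (ract (fun y => h (p y)) x) = (h (p x) : k) *: 1.
  by rewrite -(ract_map hp) //; case: haarh => _ _ ->.
apply/(right_hkerP hp) => f lf; have lfp : linear (fun y => f (p y) : k^o).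
  exact: lin_comp lf lp.
apply: functional_sep => e le; rewrite (@pairing _ _ e (fun y => f (p y))) //.
rewrite lact_ract // pE !(linfZ lf) (linfZ le) (@pairing _ _ e (fun y => h (p y))) //.
exact: mulrC.
Qed.

(* Averaging a simple comodule over [h \o p] produces vectors whose           *)
(* coefficients lie in the Hopf kernel; by normality they span a subcomodule. *)
Lemma kernel_dichotomy x : in_image x ->
  in_kernel x \/ coeffs_in (a x) (image_of i (fun y => h (p y) = 0)).
Proof.
move=> Px; pose kerh := image_of i (fun y => h (p y) = 0).
have hk : subspace (fun y => h (p y) = 0).
  split=> [|c y z hy hz]; first exact: linf0 lhp.
  by rewrite (lhp c y z) hy hz scaler0 addr0.
have nk1 : ~ kerh 1.
  by move=> [q]; rewrite -i1 => /inj_i->; rewrite p1 h1 => /eqP; rewrite oner_eq0.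
(* [psi] extends [h \o p] from [i(P)] to all of [H], so that it can act on [a x]. *)
have [psi [lpsi psi0 psi1]] := separating_functional (image_of_sub hi hk) nk1.
have psiE y : psi (i y) = h (p y).
  have : psi (i (y - (h (p y) : k) *: 1)) = 0.
    apply: psi0; exists (y - (h (p y) : k) *: 1) => //.
    rewrite (linfD lp) -scaleN1r !(linfZ lp) p1 (linfD lh) !(linfZ lh) h1 scaleN1r.
    by apply/eqP; rewrite subr_eq0; apply/eqP/esym/mulr1.
  rewrite (linfD li) -scaleN1r !(linfZ li) i1 (linfD lpsi) !(linfZ lpsi) psi1 scaleN1r.
  by move=> /eqP; rewrite subr_eq0 => /eqP->; apply: mulr1.
have [zero|/existsNP[v /eqP nz]] := pselect (forall v : a x, act psi v = 0).
  right=> f lf v; have [q qE _] := Px f lf v; exists q => //.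
  by rewrite -psiE qE -pairing_act // zero; apply: linf0.
left; pose D (u : a x) := forall f : a x -> k^o, linear f ->
  image_of i (right_hker p) (coeff f u).
have [hQ cQ] := image_of_closed hi (normal_map_closed np).
have Dall : forall u, D u.
  apply: (simple_stable (label_simple lab x) _ _ _ nz).
  - split=> [f lf|c y z Dy Dz f lf]; first by rewrite (linf0 (coeff_linear lf)); apply: subspace0.
    by rewrite (coeff_linear lf); apply: hQ.2; [apply: Dy | apply: Dz].
  - move=> f lf u Du e le; rewrite coeff_act //.
    by case: (cQ f lf _ (Du e le)).
  - move=> f lf; have [q qE _] := Px f lf v; rewrite coeff_act // -qE (ract_map hi) //.
    exists (ract (fun y => psi (i y)) q) => //.
    have -> : (fun y => psi (i y)) = (fun y => h (p y)) by apply: funext.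
    exact: average_right_hker.
move=> f lf v'; have [q <- rq] := Dall v' f lf; exists q => //.
exact: right_hker_trivial rq.
Qed.

(* On K the constituent [y] of [x n] has its coefficients among those of [x], *)
(* so that [y x^*] contains the trivial comodule of K.                        *)
Lemma kernel_meets x n y : in_image x -> in_kernel n -> y \in fusion x n ->
  exists2 z, z \in fusion y x^* & in_kernel z.
Proof.
move=> Px Nn yxn; have Py := in_image_fusion Px (in_kernel_image Nn) yxn.
apply: contrapT => none.
pose kerh := image_of i (fun y => h (p y) = 0).
have hk : subspace kerh.
  apply: image_of_sub => //; split=> [|c u z hy hz]; first exact: linf0 lhp.
  by rewrite (lhp c u z) hy hz scaler0 addr0.
have prod0 c d : C y c -> C x^* d -> kerh (c * d).
  apply: (iffLR (coeffs_in_fusion lab y x^* hk)) => z zyx.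
  have [] // := kernel_dichotomy (in_image_fusion Py (in_image_star Px) zyx).
  by move=> Nz; case: none; exists z.
(* The elements of [i(P)] that agree over [K] with a coefficient of [a x]. Coefficients of [a y] are
   of this kind because those of [n] contribute only their counits. *)
pose D := image_of i (fun q => exists2 q', C x (i q') & p q' = p q).
have hD : subspace D.
  apply: image_of_sub => //; split=> [|c q r [q' xq' pq'] [r' xr' pr']].
    by exists 0 => //; rewrite (linf0 li); apply: subspace0 (coeff_space_sub _).
  exists (c *: q' + r'); last by rewrite !lp pq' pr'.
  by rewrite li; apply: (coeff_space_sub _).2.
have yD : coeffs_in (a y) D.
  apply: (iffRL (coeffs_in_fusion lab x n hD)) yxn => c d xc nd.
  have [q qE _] := xc _ im_sub Px; have [r rE tr] := nd _ ker_sub Nn.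
  exists (q * r); first by rewrite iM qE rE.
  exists ((counit r : k) *: q); first by rewrite (linfZ li) qE; apply: subspaceZ (coeff_space_sub _) xc.
  by rewrite pM tr (linfZ lp) -scalerAr mulr1.
have [f [v [lf fv]]] := coeff_counit1 (label_simple lab y).
pose e (j : 'I_(\dim {:a y})) := (vbasis {:a y})`_j.
have /choice[q qP] : forall j, exists q, i q = coeff f (e j).
  by move=> j; have [q qE _] := Py f lf (e j); exists q.
have /choice[rr rP] : forall j, exists rr : P * P,
    [/\ i rr.1 = coeff (bcoord j) v, C x (i rr.2) & p rr.2 = p rr.1].
  by move=> j; have [r rE [r' xr' pr']] := yD _ (bcoord_linear j) v; exists (r, r').
(* The antipode identity for [a y]. Replacing [(rr j).1] by [(rr j).2] does not change the image in
   [K], but makes the second factor a coefficient of [x^*], so that [h \o p] kills the sum while it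
   should take the value 1. *)
have sum1 : \sum_j q j * antipode (rr j).1 = 1.
  apply: inj_i; rewrite i1 (linf_sum li) -[RHS]scale1r -[X in _ = X *: _]fv.
  rewrite -(coeff_antipoder v lf); apply: eq_bigr => j _.
  by rewrite iM qP hopf_map_antipode //; have [-> _ _] := rP j.
have : h (p (\sum_j q j * antipode (rr j).2)) = 0.
  have [s sE hs] : kerh (i (\sum_j q j * antipode (rr j).2)).
    rewrite (linf_sum li); apply: subspace_sum => // j; rewrite iM; apply: prod0.
      by rewrite qP; apply: coeffs_in_space.
    rewrite hopf_map_antipode //; have [_ xr _] := rP j.
    apply: (iffLR (coeffs_in_star lab x (coeff_space_sub (a x^*)))) xr.
    exact: coeffs_in_space.
  by rewrite -(inj_i sE).
have -> : p (\sum_j q j * antipode (rr j).2) = p (\sum_j q j * antipode (rr j).1).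
  rewrite !(linf_sum lp); apply: eq_bigr => j _.
  by rewrite !pM !(hopf_map_antipode hp); have [_ _ ->] := rP j.
by rewrite sum1 p1 h1 => /eqP; rewrite oner_eq0.
Qed.

(** Powers of [n] give kernel words [m] of any length. For a long one, [kernel_meets] yields a
    kernel word [z = v v^* u], and cancelling [v^* u] in [z z^*] leaves [v v^*]. *)
Lemma kernel_contains_adjoint n v : in_kernel n -> n != [::] ->
  in_image (v ++ v^*) -> in_kernel (v ++ v^*).
Proof.
move=> Nn n0; set x := v ++ v^* => Px.
have [m Nm lt] : exists2 m, in_kernel m & (size x < size m)%N.
  elim: (size x) => [|l [m Nm lt]]; first by exists n; rewrite // lt0n size_eq0.
  exists (m ++ n); first exact: in_kernel_fusion Nm Nn (cat_fusion _ _ _ _).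
  by rewrite size_cat (leq_ltn_trans lt) // -addn1 leq_add2l lt0n size_eq0.
have [z zx Nz] := kernel_meets Px Nm (cat_fusion star op x m).
have [u zE] := long_fusion_prefix lt zx.
apply: in_kernel_fusion Nz (in_kernel_star Nz) _.
rewrite zE /x -catA wstar_cat; exact: cancel_fusion.
Qed.

(** The Hopf kernel of [p] is reduced to the scalars, so averaging over [h \o p] gives scalars and
    [h \o p] is a Haar functional of [P]. If [p b = 0], then [b] is in its radical, which is
    zero. *)
Lemma trivial_kernel_injective : (forall x, in_kernel x -> x = [::]) -> injective p.
Proof.
move=> N0.
have ker1 q : right_hker p q -> q = counit q *: 1.
  move=> rq; apply: inj_i; rewrite (linfZ li) i1 -ie.
  have hD : subspace (fun c : H => c = counit c *: 1).
    split=> [|u c d hc hd]; first by rewrite linear0 scale0r.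
    by rewrite linearP scalerDl {1}hc {1}hd scalerA.
  have cQ := image_of_closed hi (normal_map_closed np).
  apply: (label_ind ssH lab cQ _ hD); first by exists q.
  move=> x xQ; have /N0-> : in_kernel x.
    by apply: coeffs_in_mono xQ => c [r <- rr]; exists r => //; apply: right_hker_trivial.
  by apply/(coeffs_in_nil lab hD); rewrite rmorph1 scale1r.
have haarP : haar (fun y => h (p y) : k^o).
  split=> // [|y]; first by rewrite p1.
  by rewrite [LHS]ker1; [congr (_ *: _); apply: counit_ract | apply: average_right_hker].
have ker0 b : p b = 0 -> b = 0.
  move=> pb; apply: (haar_nondegenerate haarP) => c.
  by rewrite pM pb mulr0; apply: linf0.
move=> x y pxy; apply/eqP; rewrite -subr_eq0; apply/eqP/ker0.
by rewrite (linfD lp) -scaleN1r (linfZ lp) pxy scaleN1r subrr.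
Qed.

End NormalSubgroups.

(** * Words coming from the cocenter *)

Section Cocenter.
Variables (k : closedFieldType) (H : hopfAlgType k) (ssH : cosemisimple H).
Variables (R : eqType) (star : R -> R) (op : R -> R -> option R).
Hypothesis starK : involutive star.
Variable a : seq R -> comod H.
Hypothesis lab : free_labelling star op a.
Local Notation "x ^*" := (wstar star x).
Local Notation C x := (coeff_space (a x)).
Variables (G : groupType) (z : H -> galg k G) (P : hopfAlgType k) (i : P -> H).
Hypothesis coc : is_cocenter z i.

(** By Schur's lemma [z] is [counit] times some [g] on the coefficients of [a v], and [counit] times
    [S(g)] on those of its dual. Since [g S(g) = 1], it is trivial on their products. *)
Lemma cocenter_adjoint v : in_image a i (v ++ v^*).
Proof.
case: coc => -[[hz zc] _] hi _ kerE; have lz : linear z by case: hz.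
have z1 : z 1 = 1 by case: hz => _ [].
have zM x y : z (x * y) = z x * z y by case: hz => _ [].
have [g gE] := central_coeffs lz zc (label_simple lab v).
have hE (g' : galg k G) : subspace (fun c => z c = (counit c : k) *: g').
  split=> [|u c d hc hd]; first by rewrite (linf0 lz) linear0 scale0r.
  by rewrite lz hc hd linearP scalerDl scalerA.
have lS := @antipode_linear k (galg k G).
have CE c : C v c -> z c = (counit c : k) *: g by move=> Cc; apply: Cc gE.
have Se c : counit (antipode c) = counit c := hopf_map_antipode (counit_hopf_map H) c.
have CSE d : C v^* d -> z d = (counit d : k) *: antipode g.
  move=> Cd; apply: (Cd _ (hE _)).
  apply/(coeffs_in_star lab v (hE _)) => c /CE zE.
  by rewrite (hopf_map_antipode hz) zE (linfZ lS) Se.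
have gS : g * antipode g = 1.
  have [f [w [lf fw]]] := coeff_counit1 (label_simple lab v).
  have /(congr1 z) := coeff_antipoder w lf; rewrite fw scale1r z1 (linf_sum lz) => <-.
  have -> : g * antipode g = (f w : k) *: (g * antipode g) by rewrite fw scale1r.
  rewrite {1}[w]bcoordE (linf_sum lf) scaler_suml; apply: eq_bigr => j _.
  have Cf := coeffs_in_space lf (vbasis {:a v})`_j.
  have Cj := coeffs_in_space (bcoord_linear j) w.
  rewrite zM (hopf_map_antipode hz) (CE _ Cf) (CE _ Cj).
  rewrite (linfZ lS) -scalerAl -scalerAr scalerA (linfZ lf); congr (_ *: _).
  have -> : (counit (coeff f (vbasis {:a v})`_j) : k) = f (vbasis {:a v})`_j.
    exact: counit_coeff.
  have -> : (counit (coeff (bcoord j) w) : k) = bcoord j w.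
    exact/counit_coeff/bcoord_linear.
  exact: mulrC.
have tz : coeffs_in (a (v ++ v^*)) (trivial_on z).
  apply: (iffRL (coeffs_in_fusion lab v v^* (trivial_on_sub hz))) (cat_fusion _ _ _ _).
  move=> c d Cc Cd; rewrite /trivial_on zM (CE c Cc) (CSE d Cd).
  by rewrite -scalerAl -scalerAr scalerA gS rmorphM.
move: (trivial_left_hker hz tz); apply: coeffs_in_mono => c /kerE[x xE].
by exists x.
Qed.

(* The universal property of the center is used through the quotient of the   *)
(* words by the congruence attached to [in_kernel].                           *)
Lemma image_in_kernel (K : hopfAlgType k) (p : P -> K) h n x :
    normal_map p -> haar (h : K -> k^o) -> in_kernel a i p n -> n != [::] ->
  in_image a i x -> in_kernel a i p x.
Proof.
move=> np hh Nn n0 Px; case: coc => -[[hz zc] univ] hi inj_i kerE.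
have lz : linear z by case: hz.
have [h' hh'] := haar_ex ssH.
have Nadj v : in_kernel a i p (v ++ v^*).
  exact: (kernel_contains_adjoint lab hi inj_i np hh Nn n0 (@cocenter_adjoint v)).
have [G' [deg [degM degsurj deg1]]] := grading_group starK
  (in_kernel_nil lab hi np) (in_kernel_fusion lab hi np) (in_kernel_star lab hi np) Nadj
  (label_op_rotate lab hh').
apply: deg1; have [z' cz' z'E] := graded_central_map ssH lab degM degsurj.
have [[f [hf fz]] _] := univ G' z' cz'.
have [c Cc c1] := counit1_coeff lab x.
have hE (g' : galg k G') : subspace (fun c => z' c = (counit c : k) *: g').
  have lz' : linear z' by case: cz' => -[].
  split=> [|u d e hd he]; first by rewrite (linf0 lz') linear0 scale0r.
  by rewrite lz' hd he linearP scalerDl scalerA.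
have := Cc _ (hE _) (z'E x); rewrite -fz /= c1 scale1r.
have hT : subspace (fun _ : P => True) by [].
have [q qE _] := Cc _ (image_of_sub hi hT) Px.
(* As [c] comes from [P], the center sends it to 1, hence so does [z']; but [z' c] is the group
   element [deg x]. *)
have /(left_hker_trivial hz) -> : left_hker z c by apply/kerE; exists q.
case: hf => lf [f1 _] _ _; rewrite c1 scale1r f1 => E.
have /malgP/(_ 1%g) := E; rewrite mcoeffU eqxx mcoeffU.
by case: eqP => // _ /eqP; rewrite oner_eq0.
Qed.

End Cocenter.

Theorem theorem3p1 (k : closedFieldType) (H : hopfAlgType k)
    (cosemisimple_H : cosemisimple H)
    (R : eqType) (star : R -> R) (op : R -> R -> option R)
    (starK : involutive star)
    (free_H : free_fusion_semiring H star op)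
    (G : groupType) (z : H -> galg k G)
    (P : hopfAlgType k) (i : P -> H)
    (cocenter_P : is_cocenter z i) :
  hopf_simple P.
Proof.
move=> K p [np surj_p ssK]; have [a lab] := free_H.
have [_ hi inj_i _] := cocenter_P; have [h hh] := haar_ex ssK.
have hp := np.1; have lp : linear p by case: hp.
have [[n [Nn n0]]|none] := pselect (exists n, in_kernel a i p n /\ n != [::]).
  right; have PK : forall q, trivial_on p q.
    move=> q; have hT : subspace (fun _ : P => True) by [].
    have cI : closed_sub (image_of i (fun _ => True)) by exact: (image_of_closed hi).
    have hN := image_of_sub hi (trivial_on_sub hp).
    have [||q' /inj_i<-//] := label_ind cosemisimple_H lab cI _ hN (c := i q).
      by exists q.
    by move=> x; apply: (image_in_kernel cosemisimple_H starK lab cocenter_P np hh Nn n0).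
  (* By surjectivity [K] consists of scalars, so its counit is the required isomorphism. *)
  have pe : forall y : K, y = (counit y : k) *: 1.
    by move=> y; have [q <-] := surj_p y; rewrite {1}PK; case: hp => _ _ _ ->.
  exists (@counit k K : K -> k^o); split; first exact: counit_hopf_map.
    exists (fun c : k^o => (c : k) *: (1 : K)) => [y|c]; first by rewrite -pe.
    by rewrite linearZ /= rmorph1; apply: mulr1.
  by move=> q /=; case: hp => _ _ _ ->.
left; have N0 x : in_kernel a i p x -> x = [::].
  by move=> Nx; apply: contrapT => /eqP nx; apply: none; exists x.
have inj_p := trivial_kernel_injective cosemisimple_H lab hi inj_i np hh N0.
have [q qP] := choice surj_p.
have pK : cancel p q by move=> x; apply: inj_p; rewrite qP.
exists q; split; [exact: hopf_map_inverse hp pK qP | by exists p | exact: pK].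
Qed.
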